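(* Let $\mathfrak g=\mathfrak q(\infty)$. For $m\in\mathbb Z$ let $\operatorname{Trep}_m\mathfrak g$ be the full subcategory of $\operatorname{Trep}\mathfrak g$ with simple objects $V(\lambda,\mu)$, $\Pi V(\lambda,\mu)$ for all strict bipartitions $(\lambda,\mu)$ such that $|\lambda|-|\mu|=m$ (i.e. the modules all of whose simple subquotients are of this form). Then there is a decomposition $$\operatorname{Trep}\mathfrak g=\bigoplus_{m\in\mathbb Z}\operatorname{Trep}_m\mathfrak g .$$
   Context: All vector spaces are over $\mathbb C$ and $\mathbb Z_2$-graded; $p(x)$ is the parity of $x$; $\Pi$ is the parity switch; morphisms in module categories preserve parity. The Lie superalgebra: $V=V_0\oplus V_1$ has even basis $\{e_i\}$ and odd basis $\{\bar e_i\}$, $W=W_0\oplus W_1$ has even basis $\{f_i\}$ and odd basis $\{\bar f_i\}$, $i\in\mathbb Z\setminus 0$; the even pairing $W\times V\to\mathbb C$ is given by $(f_i,e_j)=(\bar f_i,\bar e_j)=\delta_{ij}$, all other pairings of basis vectors being $0$. The odd operator $P$ is $Pe_i=\bar e_i$, $P\bar e_i=-e_i$ on $V$ and $Pf_i=\bar f_i$, $P\bar f_i=f_i$ on $W$. $\mathfrak g=\mathfrak q(\infty)$ is the Lie superalgebra of finitary operators $X$ on $V\oplus W$ preserving $V$ and $W$ with $(Xw,v)=-(-1)^{p(w)p(X)}(w,Xv)$ and $[X,P]=0$; it is spanned by $e_i\otimes f_j+\bar e_i\otimes\bar f_j$ and $e_i\otimes\bar f_j+\bar e_i\otimes f_j$,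 $i,j\in\mathbb Z\setminus 0$ (where $u\otimes w$ acts on $V$ by $v\mapsto (w,v)u$). For $n\ge1$ let $\mathfrak g_n\simeq\mathfrak q(n)$ be the span of these elements with $i,j\in I_n=\{i\ne 0:-\lfloor n/2\rfloor\le i\le\lceil n/2\rceil\}$, and let $\mathfrak c_n\simeq\mathfrak q(\infty)$ be the subalgebra (commuting with $\mathfrak g_n$) spanned by these elements with $i,j\notin I_n$. A $\mathfrak g$-module $M$ satisfies the large annihilator condition if $M=\bigcup_n M^{\mathfrak c_n}$. $M$ is integrable if for every $n>0$ its restriction to $\mathfrak g_n$ lifts to a representation of the algebraic supergroup $Q(n)$. $\operatorname{Trep}\mathfrak g$ is the full subcategory of $\mathfrak g$-modules that are integrable, have finite length and satisfy the large annihilator condition. Order $\mathbb Z\setminus0$ by $1\prec2\prec\dots\prec-2\prec-1$. Let $\mathfrak h$ be spanned by the elements $e_i\otimes f_j+\bar e_i\otimes\bar f_j$ and $e_i\otimes\bar f_j+\bar e_i\otimes f_j$ with $i=j$, let $\mathfrak h_0$ be its even part with $\{\varepsilon_i\}$ the system dual to its basis $e_i\otimes f_i+\bar e_i\otimes\bar f_i$; let $\mathfrak n$ be spanned by the elements with $i\prec j$, and $\mathfrak b=\mathfrak h\oplus\mathfrak n$. A strict bipartition is a pair of strict partitions $\lambda=(a_1>\dots>a_k>0)$, $\mu=(a_{-1}>\dots>a_{-l}>0)$ (possibly empty); it is identified with the weight $a_1\varepsilon_1+\dots+a_k\varepsilon_k-a_{-l}\varepsilon_{-l}-\dots-a_{-1}\varepsilon_{-1}$.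 $|\lambda|$ denotes the size of $\lambda$. $V(\lambda,\mu)$ denotes a simple $\mathfrak g$-module with highest weight $(\lambda,\mu)$ with respect to $\mathfrak b$; it is unique up to isomorphism and $\Pi$, and the simple objects of $\operatorname{Trep}\mathfrak g$ are the $V(\lambda,\mu)$ and $\Pi V(\lambda,\mu)$. *)

(* Defs.v *)
From HB Require Import structures.
From mathcomp Require Import all_boot all_order all_algebra.
From mathcomp Require Import finmap.
From mathcomp Require Import boolp classical_sets functions.
From mathcomp Require Import monalg.

Set Implicit Arguments.
Unset Strict Implicit.
Unset Printing Implicit Defensive.

Import Order.TTheory GRing.Theory Num.Theory.

Local Open Scope classical_set_scope.
Local Open Scope ring_scope.

(* Parities are booleans: false is even, true is odd, (+) is their sum.       *)

Section LinearAlgebra.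
Variables (K : fieldType) (U : lmodType K).

Definition is_subspace (S : set U) : Prop :=
  S 0 /\ forall a u v, S u -> S v -> S (a *: u + v).

Inductive lspan (S : set U) : set U :=
| lspan_0 : lspan S 0
| lspan_add a u v : S u -> lspan S v -> lspan S (a *: u + v).

Definition is_grading (par : bool -> set U) : Prop :=
  [/\ forall p, is_subspace (par p),
      forall u, exists u0 u1, [/\ par false u0, par true u1 & u = u0 + u1]
    & forall u, par false u -> par true u -> u = 0].

Definition finite_rank (f : U -> U) : Prop :=
  exists s : seq U, forall u, lspan [set` s] (f u).

End LinearAlgebra.

Record zindex : Type := ZIndex { zval : int; _ : zval != 0 }.
HB.instance Definition _ := [isSub for zval].
HB.instance Definition _ := [Countable of zindex by <:].

Section QInfinity.
(* the field of scalars; the complex numbers are the case C = R[i]            *)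
Variable C : numClosedFieldType.

(* V has basis << (i, false) >> = e_i and << (i, true) >> = \bar e_i;         *)
(* W has basis << (i, false) >> = f_i and << (i, true) >> = \bar f_i.         *)
Local Notation Vsp := {malg C[(zindex * bool)%type]}.
Local Notation Wsp := {malg C[(zindex * bool)%type]}.

Definition vbas (i : zindex) (p : bool) : Vsp := << (i, p) >>.
Definition wbas (i : zindex) (p : bool) : Wsp := << (i, p) >>.

Definition Vpar (p : bool) : set Vsp :=
  [set v : Vsp | forall k, v@_k != 0 -> k.2 = p].
Definition Wpar (p : bool) : set Wsp :=
  [set w : Wsp | forall k, w@_k != 0 -> k.2 = p].

Definition pairing (w : Wsp) (v : Vsp) : C :=
  \sum_(k <- msupp w) w@_k * v@_k.

(* An operator on V (+) W preserving V and W is the pair of its restrictions. *)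
Local Notation qop := ((Vsp -> Vsp) * (Wsp -> Wsp))%type.

Definition qcomp (X Y : qop) : qop := (X.1 \o Y.1, X.2 \o Y.2).

(* [X, Y] for X of parity p and Y of parity r *)
Definition qbracket (p r : bool) (X Y : qop) : qop :=
  qcomp X Y - (-1) ^+ (p && r) *: qcomp Y X.

Definition Pop : qop :=
  (fun v => \sum_(k <- msupp v)
              v@_k *: (if k.2 then - vbas k.1 false else vbas k.1 true),
   fun w => \sum_(k <- msupp w) w@_k *: wbas k.1 (~~ k.2)).

Definition q_homog (p : bool) : set qop := [set X |
  [/\ linear X.1 /\ linear X.2,
      finite_rank X.1 /\ finite_rank X.2,
      (forall r v, Vpar r v -> Vpar (p (+) r) (X.1 v)) /\
      (forall r w, Wpar r w -> Wpar (p (+) r) (X.2 w)),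
      forall r w v, Wpar r w ->
        pairing (X.2 w) v = - (-1) ^+ (r && p) * pairing w (X.1 v)
    & qbracket p true X Pop = 0]].

(* the Lie superalgebra q(oo) *)
Definition q_oo : set qop := [set X |
  exists X0 X1, [/\ q_homog false X0, q_homog true X1 & X = X0 + X1]].

(* The element  e_i (x) f_j + \bar e_i (x) \bar f_j  (p = false), resp.       *)
(* e_i (x) \bar f_j + \bar e_i (x) f_j  (p = true); its component on W is     *)
(* the one forced by the compatibility with the pairing, see qgen_homog.      *)
Definition qgen (p : bool) (i j : zindex) : qop :=
  (fun v => pairing (wbas j false) v *: vbas i p
            + pairing (wbas j true) v *: vbas i (~~ p),
   fun w => - (pairing w (vbas i false) *: wbas j p)
            + (-1) ^+ (~~ p) *: (pairing w (vbas i true) *: wbas j (~~ p))).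

Lemma pairing_fsetE (D : {fset zindex * bool}) (w : Wsp) (v : Vsp) :
  (msupp w `<=` D)%fset -> pairing w v = \sum_(k <- D) w@_k * v@_k.
Proof.
move=> wD; rewrite /pairing; apply: big_fset_incl => // k _ kw.
by rewrite mcoeff_outdom ?mul0r.
Qed.

Lemma pairing_is_linearl (v : Vsp) : scalar (pairing^~ v).
Proof.
move=> a w1 w2; set D := (msupp w1 `|` msupp w2 `|` msupp (a *: w1 + w2))%fset.
rewrite !(@pairing_fsetE D);
  try by apply/fsubsetP => k; rewrite !in_fsetU => ->; rewrite ?orbT.
rewrite mulr_sumr -big_split /=; apply: eq_bigr => k _.
by rewrite mcoeffD mcoeffZ mulrDl -mulrA.
Qed.

Lemma pairing_is_linearr (w : Wsp) : scalar (pairing w).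
Proof.
move=> a v1 v2; rewrite /pairing mulr_sumr -big_split /=.
apply: eq_bigr => k _.
by rewrite mcoeffD mcoeffZ mulrDr mulrCA.
Qed.

Lemma pairing_wbas j p v : pairing (wbas j p) v = v@_(j, p).
Proof.
rewrite (@pairing_fsetE [fset (j, p)]%fset) ?msuppU_le//.
by rewrite big_seq_fset1 mcoeffUU mul1r.
Qed.

Lemma pairing_vbas w i p : pairing w (vbas i p) = w@_(i, p).
Proof.
rewrite (@pairing_fsetE ((i, p) |` msupp w)%fset) ?fsubsetU1//.
rewrite (big_fsetD1 (i, p)) ?fset1U1//= mcoeffUU mulr1 big1_fset ?addr0//.
move=> k; rewrite in_fsetD1 => /andP[ki _] _.
by rewrite mcoeffU eq_sym (negbTE ki) mulr0.
Qed.

Lemma mcoeff_qgenV p i j v k : ((qgen p i j).1 v)@_k =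
   v@_(j, false) *+ ((i, p) == k) + v@_(j, true) *+ ((i, ~~ p) == k).
Proof.
by rewrite /= !pairing_wbas mcoeffD !mcoeffZ !mcoeffU !mulrnAr !mulr1.
Qed.

Lemma mcoeff_qgenW p i j w k : ((qgen p i j).2 w)@_k =
   - (w@_(i, false) *+ ((j, p) == k)) + ((-1) ^+ (~~ p) * w@_(i, true)) *+ ((j, ~~ p) == k).
Proof.
by rewrite /= !pairing_vbas mcoeffD mcoeffN !mcoeffZ !mcoeffU !mulrnAr !mulr1.
Qed.

Lemma sum_msupp1 (v : Vsp) (F : zindex * bool -> C) k1 :
  (forall k, k != k1 -> F k = 0) ->
  \sum_(k <- msupp v) v@_k * F k = v@_k1 * F k1.
Proof.
move=> F0; have [k1v|k1v] := boolP (k1 \in msupp v); last first.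
  rewrite (mcoeff_outdom k1v) mul0r big1_fset // => k kv _.
  rewrite F0 ?mulr0 //; by apply: contraNneq k1v => <-.
rewrite (big_fsetD1 k1) //= big1_fset ?addr0 // => k.
by rewrite in_fsetD1 => /andP[kk _] _; rewrite F0 ?mulr0.
Qed.

Lemma mcoeff_PopV v i q : (Pop.1 v)@_(i, q) = if q then v@_(i, false) else - v@_(i, true).
Proof.
rewrite /= raddf_sum /=; under eq_bigr do rewrite mcoeffZ.
rewrite (@sum_msupp1 _ _ (i, ~~ q)).
  by case: q => /=; rewrite ?mcoeffN mcoeffU eqxx ?mulr1 ?mulrN1.
move=> [k b] /=; rewrite xpair_eqE => H; case: b H; case: q; rewrite /= ?andbT ?mcoeffN mcoeffU xpair_eqE /= ?andbF ?oppr0 // andbT ?andbF => H; by rewrite (negbTE H) ?oppr0.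
Qed.

Lemma mcoeff_PopW w i q : (Pop.2 w)@_(i, q) = w@_(i, ~~ q).
Proof.
rewrite /= raddf_sum /=; under eq_bigr do rewrite mcoeffZ.
rewrite (@sum_msupp1 _ _ (i, ~~ q)).
  by rewrite /= negbK mcoeffU eqxx ?mulr1.
by move=> [k b]; rewrite mcoeffU !xpair_eqE; case: b; case: q => /=; rewrite ?andbT ?andbF // => /negbTE ->.
Qed.

Lemma linear_from_mcoeff (f : Vsp -> Vsp) (s t : C) a b c d :
  (forall v k, (f v)@_k = s * v@_a *+ (b == k) + t * v@_c *+ (d == k)) -> linear f.
Proof.
move=> fE z x y; apply/malgP => k; 
transitivity (z * (f x)@_k + (f y)@_k); last first.
  by rewrite mcoeffD; congr (_ + _); symmetry; exact: mcoeffZ.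
rewrite !fE.
have E1 h : (z *: x + y)@_h = z * x@_h + y@_h by rewrite mcoeffD mcoeffZ.
rewrite !E1 !mulrDr !mulrnDl addrACA !mulrnAr.
by rewrite (mulrCA s) (mulrCA t).
Qed.

Lemma qgen_homog p i j : q_homog p (qgen p i j).
Proof.
split.
- split.
    apply: (@linear_from_mcoeff _ 1 1 (j, false) (i, p) (j, true) (i, ~~ p)) => v k.
    by rewrite mcoeff_qgenV !mul1r.
  apply: (@linear_from_mcoeff _ (-1) ((-1) ^+ (~~ p)) (i, false) (j, p) (i, true) (j, ~~ p)) => v k.
  by rewrite mcoeff_qgenW mulN1r mulNrn.
- split.
    exists [:: vbas i p; vbas i (~~ p)] => v /=.
    apply: lspan_add; first by rewrite /= inE eqxx.
    rewrite -[_ *: _]addr0; apply: lspan_add; first by rewrite /= !inE eqxx orbT.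
    exact: lspan_0.
  exists [:: wbas j p; wbas j (~~ p)] => w /=.
  rewrite -scaleNr; apply: lspan_add; first by rewrite /= inE eqxx.
  rewrite scalerA -[_ *: _]addr0; apply: lspan_add; first by rewrite /= !inE eqxx orbT.
  exact: lspan_0.
- split=> r v vr k.
    have z : v@_(j, ~~ r) = 0.
      by apply/eqP; apply/negPn/negP => /vr /=; case: (r).
    rewrite mcoeff_qgenV; case: r vr z => vr /= ->;
      rewrite mul0rn ?add0r ?addr0 mulrb; case: ifP => [/eqP <-|_]; rewrite ?eqxx //=;
      by case: (p).
  have z : v@_(i, ~~ r) = 0.
    by apply/eqP; apply/negPn/negP => /vr /=; case: (r).
  rewrite mcoeff_qgenW; case: r vr z => vr; rewrite [~~ _]/= => z; rewrite z;
    rewrite ?mulr0 mul0rn ?oppr0 ?add0r ?addr0 mulrb; case: ifP => [/eqP <-|_]; rewrite ?oppr0 ?eqxx //=;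
    by case: (p).
- move=> r w v wr.
  have z : w@_(i, ~~ r) = 0.
    by apply/eqP; apply/negPn/negP => /wr /=; case: (r).
  have -> : pairing ((qgen p i j).2 w) v =
     - (w@_(i, false) * v@_(j, p)) + (-1) ^+ (~~ p) * (w@_(i, true) * v@_(j, ~~ p)).
    rewrite /= !pairing_vbas -scaleNr pairing_is_linearl.
    rewrite -[_ *: (_ *: wbas _ _)]addr0 scalerA pairing_is_linearl.
    rewrite !pairing_wbas -[X in _ + (_ + X)]/(pairing 0 v).
    have -> : pairing 0 v = 0.
      by rewrite /pairing big1_fset // => k _ _; rewrite mcoeff0 mul0r.
    by rewrite addr0 mulNr mulrA.
  have -> : pairing w ((qgen p i j).1 v) =
     v@_(j, false) * w@_(i, p) + v@_(j, true) * w@_(i, ~~ p).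
    rewrite /= !pairing_wbas pairing_is_linearr.
    rewrite -[_ *: vbas _ (~~ _)]addr0 pairing_is_linearr !pairing_vbas.
    have -> : pairing w 0 = 0.
      by rewrite /pairing big1_fset // => k _ _; rewrite mcoeff0 mulr0.
    by rewrite addr0.
  case: r wr z => wr /= z; case: (p) => /=; rewrite ?z ?mulr0 ?mul0r ?expr1 ?expr0 ?opprK ?mulN1r ?mul1r ?oppr0 ?addr0 ?add0r // [in RHS]mulrC //.
- rewrite /qbracket andbT; apply/eqP; rewrite subr_eq0; apply/eqP.
  congr pair; apply/funext => v; apply/malgP => -[k q].
    change (((qgen p i j).1 (Pop.1 v))@_(k, q) = ((-1) ^+ p *: Pop.1 ((qgen p i j).1 v))@_(k, q)).
    rewrite mcoeffZ mcoeff_qgenV !mcoeff_PopV !mcoeff_qgenV !xpair_eqE.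
    by case: p; case: q; rewrite /= ?andbT ?andbF ?mulr0n ?addr0 ?add0r ?expr1 ?expr0 ?mulN1r ?mul1r ?opprK ?mulNrn.
  change (((qgen p i j).2 (Pop.2 v))@_(k, q) = ((-1) ^+ p *: Pop.2 ((qgen p i j).2 v))@_(k, q)).
  rewrite mcoeffZ mcoeff_qgenW !mcoeff_PopW !mcoeff_qgenW !xpair_eqE.
  by case: p; case: q; rewrite /= ?andbT ?andbF ?mulr0n ?addr0 ?add0r ?expr1 ?expr0 ?mulN1r ?mul1r ?opprK ?mulNrn ?oppr0 ?add0r ?addr0.
Qed.

Definition Iset (n : nat) : set zindex :=
  [set i | - (n./2)%:Z <= zval i <= (uphalf n)%:Z].

Definition g_ (n : nat) : set qop :=
  lspan [set X | exists p i j, [/\ Iset n i, Iset n j & X = qgen p i j]].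

Definition c_ (n : nat) : set qop :=
  lspan [set X | exists p i j, [/\ ~ Iset n i, ~ Iset n j & X = qgen p i j]].

(* 1 < 2 < ... < -2 < -1 *)
Definition prec (i j : zindex) : bool :=
  if (0 < zval i) == (0 < zval j) then zval i < zval j else 0 < zval i.

Definition n_plus : set qop :=
  lspan [set X | exists p i j, prec i j /\ X = qgen p i j].

Record qmod : Type := QMod {
  qcar :> lmodType C;
  qpar : bool -> set qcar;
  qpar_grading : is_grading qpar;
  (* only meaningful on q_oo *)
  qact : qop -> qcar -> qcar;
  qact_linl : forall a X Y v, q_oo X -> q_oo Y ->
    qact (a *: X + Y) v = a *: qact X v + qact Y v;
  qact_linr : forall X, q_oo X -> linear (qact X);
  qact_par : forall p r X v, q_homog p X -> qpar r v ->
    qpar (p (+) r) (qact X v);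
  qact_bracket : forall p r X Y v, q_homog p X -> q_homog r Y ->
    qact (qbracket p r X Y) v
      = qact X (qact Y v) - (-1) ^+ (p && r) *: qact Y (qact X v)
}.

Definition is_qhom (M N : qmod) (f : M -> N) : Prop :=
  [/\ linear f, forall p v, qpar p v -> qpar p (f v)
    & forall X v, q_oo X -> f (qact X v) = qact X (f v)].

Definition is_submod (M : qmod) (N : set M) : Prop :=
  [/\ is_subspace N,
      forall v, N v -> exists v0 v1,
        [/\ qpar false v0 /\ N v0, qpar true v1 /\ N v1 & v = v0 + v1]
    & forall X v, q_oo X -> N v -> N (qact X v)].

Definition is_simple (M : qmod) : Prop :=
  (exists v : M, v != 0) /\
  forall N : set M, is_submod N -> N = [set 0] \/ N = setT.

Definition finite_length (M : qmod) : Prop :=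
  exists (k : nat) (F : nat -> set M),
    [/\ F 0%N = [set 0], F k = setT,
        forall i, (i <= k)%N -> is_submod (F i)
      & forall i, (i < k)%N ->
          [/\ F i `<=` F i.+1, F i <> F i.+1
            & forall N, is_submod N -> F i `<=` N -> N `<=` F i.+1 ->
                N = F i \/ N = F i.+1]].

Definition large_annihilator (M : qmod) : Prop :=
  forall v : M, exists n, (0 < n)%N /\ forall X, c_ n X -> qact X v = 0.

Record salg : Type := SAlg {
  scar :> algType C;
  spar : bool -> set scar;
  spar_grading : is_grading spar;
  spar_1 : spar false 1;
  spar_M : forall p r a b, spar p a -> spar r b -> spar (p (+) r) (a * b);
  sparC : forall p r a b, spar p a -> spar r b ->
    a * b = (-1) ^+ (p && r) *: (b * a)
}.

(* Elements of M (x) A are formal sums of pure tensors; by the universal      *)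
(* property two of them are equal in M (x) A iff every bilinear map agrees.   *)
Definition is_bilinear (M A U : lmodType C) (b : M -> A -> U) : Prop :=
  (forall a, linear (b^~ a)) /\ (forall m, linear (b m)).

Definition tens_eq (M A : lmodType C) (s t : seq (M * A)) : Prop :=
  forall (U : lmodType C) (b : M -> A -> U), is_bilinear b ->
    \sum_(x <- s) b x.1 x.2 = \sum_(x <- t) b x.1 x.2.

Definition tens_homog (M : qmod) (A : salg) (p : bool) (s : seq (M * A))
    : Prop :=
  exists2 t : seq (M * A), tens_eq s t &
    forall x, x \in t -> exists r, qpar r x.1 /\ spar (p (+) r) x.2.

(* The A-points of Q(n): the invertible even right A-linear operators on      *)
(* A^(n|n) commuting with P.  Column j < n (resp. n + j) is the image of e_j  *)
(* (resp. \bar e_j).                                                          *)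
Definition Pmx (A : salg) (n : nat) : 'M[A]_(n + n) :=
  block_mx 0 (- 1%:M) 1%:M 0.

Definition Q_points (A : salg) (n : nat) : set 'M[A]_(n + n) := [set g |
  [/\ forall i j, spar false (ulsubmx g i j) /\ spar false (drsubmx g i j),
      forall i j, spar true (ursubmx g i j) /\ spar true (dlsubmx g i j),
      g *m Pmx A n = Pmx A n *m g
    & exists h, g *m h = 1%:M /\ h *m g = 1%:M]].

Lemma Ienum_subproof n (k : 'I_n) :
  (if (k < uphalf n)%N then (k.+1)%:Z else k%:Z - n%:Z) != 0.
Proof. by case: ifP => // _; rewrite subr_eq0 eqz_nat ltn_eqF. Qed.

(* I_n, enumerated increasingly for prec *)
Definition Ienum n (k : 'I_n) : zindex := ZIndex (Ienum_subproof k).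

Definition g_elt n (p : bool) (x : 'M[C]_n) : qop :=
  \sum_(i < n) \sum_(j < n) x i j *: qgen p (Ienum i) (Ienum j).

(* the operator 1 + X (x) a, where X = g_elt p x acts on C^(n|n) and a has    *)
(* parity p; the sign comes from moving a past the odd vectors \bar e_j       *)
Definition infinitesimal_point (A : salg) n (p : bool) (x : 'M[C]_n) (a : A)
    : 'M[A]_(n + n) :=
  let xa := \matrix_(i, j) (x i j *: a) in
  if p then block_mx 1%:M (- xa) xa 1%:M
  else block_mx (1%:M + xa) 0 0 (1%:M + xa).

(* A representation of the algebraic supergroup Q(n) on M: a natural family   *)
(* of homomorphisms from Q(n)(A) to the even A-linear automorphisms of        *)
(* M (x) A; rho A g m stands for the image of m (x) 1 under g.                *)
Definition Q_rep (n : nat) (M : qmod)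
    (rho : forall A : salg, 'M[A]_(n + n) -> M -> seq (M * A)) : Prop :=
  [/\ forall A g p v, Q_points g -> qpar p v -> tens_homog p (rho A g v),
      forall A g a u v, Q_points g ->
        tens_eq (rho A g (a *: u + v))
                ([seq (a *: x.1, x.2) | x <- rho A g u] ++ rho A g v),
      forall A v, tens_eq (rho A 1%:M v) [:: (v, 1)],
      forall A g h v, Q_points g -> Q_points h ->
        tens_eq (rho A (g *m h) v)
                [seq (y.1, y.2 * x.2) | x <- rho A h v, y <- rho A g x.1]
    & forall (A B : salg) (f : {lrmorphism A -> B}) g v,
        (forall p a, spar p a -> spar p (f a)) -> Q_points g ->
        tens_eq (rho B (map_mx f g) v) [seq (x.1, f x.2) | x <- rho A g v]].

(* the differential of rho is the action of g_n on M *)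
Definition Q_lifts (n : nat) (M : qmod)
    (rho : forall A : salg, 'M[A]_(n + n) -> M -> seq (M * A)) : Prop :=
  forall (A : salg) p r (x : 'M[C]_n) (a : A) v,
    spar p a -> a * a = 0 -> qpar r v ->
    tens_eq (rho A (infinitesimal_point p x a) v)
            [:: (v, 1); ((-1) ^+ (p && r) *: qact (g_elt p x) v, a)].

Definition integrable (M : qmod) : Prop :=
  forall n, (0 < n)%N -> exists rho, @Q_rep n M rho /\ Q_lifts rho.

Definition Trep (M : qmod) : Prop :=
  [/\ integrable M, finite_length M & large_annihilator M].

Definition strict_partition (s : seq nat) : bool :=
  sorted gtn s && (0%N \notin s).

(* the eps_i-coordinate of the weight (lambda, mu) *)
Definition bip_weight (lambda mu : seq nat) (i : zindex) : int :=
  if 0 < zval i then (nth 0%N lambda `|zval i|.-1)%:Z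
  else - (nth 0%N mu `|zval i|.-1)%:Z.

Definition has_highest_weight (S : qmod) (lambda mu : seq nat) : Prop :=
  exists v : S,
    [/\ v != 0, forall X, n_plus X -> qact X v = 0
      & forall i, qact (qgen false i i) v = (bip_weight lambda mu i)%:~R *: v].

(* S is isomorphic to V(lambda, mu) or to \Pi V(lambda, mu); these two have   *)
(* the same highest weight.                                                   *)
Definition is_V (S : qmod) (lambda mu : seq nat) : Prop :=
  is_simple S /\ has_highest_weight S lambda mu.

Definition is_subquotient (S M : qmod) : Prop :=
  exists (L : qmod) (i : L -> M) (q : L -> S),
    [/\ is_qhom i, injective i, is_qhom q & forall s, exists l, q l = s].

Definition Trep_ (m : int) (M : qmod) : Prop :=
  Trep M /\
  forall S, is_simple S -> is_subquotient S M ->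
    exists lambda mu, [/\ strict_partition lambda, strict_partition mu,
      (sumn lambda)%:Z - (sumn mu)%:Z = m & is_V S lambda mu].

(* M is the direct sum of the D m, all but finitely many of which vanish *)
Definition is_direct_sum (M : qmod) (D : int -> qmod) : Prop :=
  exists (inj : forall m, D m -> M) (prj : forall m, M -> D m) (s : seq int),
    [/\ forall m, is_qhom (inj m) /\ is_qhom (prj m),
        forall m x, prj m (inj m x) = x,
        forall m m' x, m != m' -> prj m' (inj m x) = 0,
        uniq s /\ (forall m, m \notin s -> forall x : D m, x = 0)
      & forall v, v = \sum_(m <- s) inj m (prj m v)].

(* the full subcategory A of q(oo)-modules is the direct sum of its full      *)
(* subcategories B m                                                          *)
Definition category_direct_sum (A : qmod -> Prop) (B : int -> qmod -> Prop)
    : Prop :=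
  [/\ forall m M, B m M -> A M,
      forall M, A M <->
        exists D : int -> qmod, (forall m, B m (D m)) /\ is_direct_sum M D
    & forall m m' (M N : qmod) (f : M -> N), m != m' -> B m M -> B m' N ->
        is_qhom f -> forall v, f v = 0].

End QInfinity.

(* Main.v *)
Require Import Defs.
From HB Require Import structures.
From mathcomp Require Import all_boot all_order all_algebra.
From mathcomp Require Import finmap.
From mathcomp Require Import boolp classical_sets functions.
From mathcomp Require Import monalg.
From mathcomp Require Import reals complex.
From mathcomp Require Import ring zify.

(** The sum E of the even diagonal elements e_i (x) f_i + \bar e_i (x) \bar f_i over
    all indices i is not in q(oo), but it acts on every module with large
    annihilators, since only finitely many terms are nonzero on a given vector.
    This Euler operator commutes with q(oo) ([euler_qhom]) and with all
    homomorphisms ([euler_hom]), and on a highest weight vector of weight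
    (lambda, mu) it is multiplication by |lambda| - |mu| ([euler_hw]).  The
    decomposition is the one into generalized eigenspaces of E.

    A module M of finite length is killed by a product of factors E - m with
    integers m ([euler_killer]), because E has an integral eigenvalue on every
    simple submodule.  Polynomials in E project M onto its generalized
    eigenspaces ([direct_sum_summands]), which are submodules, and there is no
    homomorphism between parts of different eigenvalues ([Trep_hom0]).  Three
    points need an argument.

    Simple subquotients have highest weights ([hw_exists]).  More generally, a
    nonzero module with large annihilators on which the even root vectors are
    locally nilpotent has a highest weight vector whose weight is a strict
    bipartition.  The indices are taken in the order 1, -1, 2, -2, ...; at each
    stage the positive root vectors from one index to all later ones are killed
    ([stage]).  They are infinitely many, but they supercommute and the large
    annihilator condition bounds the length of their nonzero products
    ([word_kill]).  After finitely many stages the vector has a zero weight both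
    at a positive and at a negative index, which forces all the remaining root
    vectors to vanish ([killed_weights0]).  Weights are integers by the theory of
    sl(2), and strictness comes from the odd root vectors ([strict_weights]).

    Integrability gives local nilpotency: by the group law over the dual numbers,
    the orbit of a vector under a one-parameter subgroup 1 + t E_ij is a
    polynomial in t whose coefficients are the divided powers of the root vector
    ([gen_coefS], [gen_nilp]).

    Direct summands are integrable ([integrable_retract]).  A representation of
    Q(n) is related to the Lie superalgebra at infinitesimal points only, so it is
    not clear that points commute with the projection.  Identify Q(n)(A) with GL_n(A), A
    being regarded as a ring ([Theta]), and let g act through diag(g, 1, g^-1) in
    a larger group, with g^-1 placed where the vector is killed by the
    centralizer.  By Whitehead's lemma this is a product of elementary matrices
    ([whword_wmat]), and those act by exponentials of root vectors ([Ract_word]).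

    Conversely a finite direct sum of modules of the category belongs to it:
    representations add up ([sum_rho_rep]), and so do filtrations
    ([finite_length_sum]). *)

Set Implicit Arguments.
Unset Strict Implicit.
Unset Printing Implicit Defensive.

Import Order.TTheory GRing.Theory Num.Theory.

Local Open Scope classical_set_scope.
Local Open Scope ring_scope.

(** * Linear maps *)

Section LinearFacts.
Variables (C : pzRingType) (U V : lmodType C) (f : U -> V).
Hypothesis lf : linear f.

Lemma lin0 : f 0 = 0.
Proof. by have := lf (-1) 0 0; rewrite scaler0 addr0 scaleN1r addNr. Qed.
Lemma linD x y : f (x + y) = f x + f y.
Proof. by have := lf 1 x y; rewrite !scale1r. Qed.
Lemma linZ a x : f (a *: x) = a *: f x.
Proof. by have := lf a x 0; rewrite !addr0 lin0 addr0. Qed.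
Lemma linN x : f (- x) = - f x.
Proof. by apply/eqP; rewrite -addr_eq0 -linD addNr lin0. Qed.
Lemma linB x y : f (x - y) = f x - f y.
Proof. by rewrite linD linN. Qed.
Lemma lin_sum I (r : seq I) (P : pred I) (F : I -> U) :
  f (\sum_(i <- r | P i) F i) = \sum_(i <- r | P i) f (F i).
Proof. exact: (big_morph f linD lin0). Qed.
End LinearFacts.

Lemma lin_comp (C : pzRingType) (U V W : lmodType C) (g : V -> W) (f : U -> V) :
  linear g -> linear f -> linear (fun x => g (f x)).
Proof. by move=> lg lf a x y; rewrite lf lg. Qed.

Lemma lin_comb (C : comPzRingType) (U V : lmodType C) (f g : U -> V) a :
  linear f -> linear g -> linear (fun x => a *: f x + g x).
Proof.
move=> lf lg b x y; rewrite lf lg !scalerDr !scalerA (mulrC a b) addrACA.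
by [].
Qed.

Lemma lin_iter (C : pzRingType) (U : lmodType C) (f : U -> U) k :
  linear f -> linear (iter k f).
Proof. by move=> lf; elim: k => [//|k IH] a x y /=; rewrite IH lf. Qed.

(** * The basis of q(oo) and its brackets *)

Section QAlgebra.
Variable C : numClosedFieldType.
Local Notation Vsp := {malg C[(zindex * bool)%type]}.
Local Notation qop := ((Vsp -> Vsp) * (Vsp -> Vsp))%type.

Lemma qgenV (p : bool) (i j : zindex) (v : Vsp) a b :
  ((qgen C p i j).1 v)@_(a, b) = v@_(j, b (+) p) * (i == a)%:R.
Proof.
rewrite mulr_natr mcoeff_qgenV !xpair_eqE; case: p; case: b;
  by rewrite /= ?andbT ?andbF ?mulr0n ?addr0 ?add0r.
Qed.

Lemma qgenW (p : bool) (i j : zindex) (w : Vsp) a b :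
  ((qgen C p i j).2 w)@_(a, b)
  = - (-1) ^+ ((b (+) p) && p) * w@_(i, b (+) p) * (j == a)%:R.
Proof.
rewrite mulr_natr mcoeff_qgenW !xpair_eqE; case: p; case: b;
  by rewrite /= ?andbT ?andbF ?mulr0n ?addr0 ?add0r ?expr0 ?expr1
             ?mulN1r ?opprK ?mul1r ?oppr0 ?add0r ?mulNrn.
Qed.

Lemma mcoeff_lin2 (x y : C) (u v : Vsp) k x' y' :
  u@_k = x' -> v@_k = y' -> (x *: u + y *: v)@_k = x * x' + y * y'.
Proof. by move=> <- <-; rewrite mcoeffD; congr (_ + _); exact: mcoeffZ. Qed.

Lemma qgenVV (p q : bool) (i j k l : zindex) (v : Vsp) a b :
  ((qgen C p i j).1 ((qgen C q k l).1 v))@_(a, b)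
  = v@_(l, b (+) p (+) q) * (k == j)%:R * (i == a)%:R.
Proof.
apply: etrans (qgenV _ _ _ _ _ _) _.
by congr (_ * _); exact: qgenV.
Qed.

Lemma qgenWW (p q : bool) (i j k l : zindex) (v : Vsp) a b :
  ((qgen C p i j).2 ((qgen C q k l).2 v))@_(a, b)
  = - (-1) ^+ ((b (+) p) && p)
    * (- (-1) ^+ ((b (+) p (+) q) && q) * v@_(k, b (+) p (+) q) * (l == i)%:R)
    * (j == a)%:R.
Proof.
apply: etrans (qgenW _ _ _ _ _ _) _.
by congr (_ * _ * _); exact: qgenW.
Qed.

(** Both sides are compared on the basis vectors of V and of W; on W the signs
    are those forced by the pairing. *)
Lemma q_bracket_qgen (p q : bool) (i j k l : zindex) :
  qbracket p q (qgen C p i j) (qgen C q k l)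
  = (j == k)%:R *: qgen C (p (+) q) i l
    + (- (-1) ^+ (p && q) * (l == i)%:R) *: qgen C (p (+) q) k j.
Proof.
have scl (V : lmodType C) (c : C) (x y : V) : x - c *: y = 1 *: x + (- c) *: y.
  by rewrite scale1r scaleNr.
congr pair; apply/funext => v; apply/malgP => -[a b].
  have E1 := mcoeff_lin2 1 (- (-1) ^+ (p && q))
    (qgenVV p q i j k l v a b) (qgenVV q p k l i j v a b).
  have E2 := mcoeff_lin2 (j == k)%:R (- (-1) ^+ (p && q) * (l == i)%:R)
    (qgenV (p (+) q) i l v a b) (qgenV (p (+) q) k j v a b).
  rewrite -scl in E1; refine (etrans E1 (etrans _ (esym E2))) => {E1 E2}.
  rewrite (addbC p q) !addbA [b (+) p (+) q]addbAC (eq_sym k j) (eq_sym l i).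
  by case: (j == k); case: (i == l); rewrite /=; ring.
have E1 := mcoeff_lin2 1 (- (-1) ^+ (p && q))
  (qgenWW p q i j k l v a b) (qgenWW q p k l i j v a b).
have E2 := mcoeff_lin2 (j == k)%:R (- (-1) ^+ (p && q) * (l == i)%:R)
  (qgenW (p (+) q) i l v a b) (qgenW (p (+) q) k j v a b).
rewrite -scl in E1; refine (etrans E1 (etrans _ (esym E2))) => {E1 E2}.
rewrite (addbC p q) !addbA [b (+) p (+) q]addbAC.
move: ((l == i)%:R : C) ((j == k)%:R : C) => c1 c2.
by case: (p); case: (q); case: (b); rewrite /= ?expr0 ?expr1; ring.
Qed.

Lemma finite_rank_lin (U : lmodType C) (f g : U -> U) a :
  finite_rank f -> finite_rank g -> finite_rank (fun u => a *: f u + g u).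
Proof.
move=> [s fs] [t gt]; exists (s ++ t) => u.
have sub1 w : lspan [set` s] w -> lspan [set` s ++ t] w.
  elim=> [|b x y xs _ IH]; first exact: lspan_0.
  by apply: lspan_add IH; rewrite /= mem_cat; apply/orP; left.
have add x y : lspan [set` s ++ t] x -> lspan [set` s ++ t] y ->
    lspan [set` s ++ t] (a *: x + y).
  move=> xs ys; elim: xs => [|b x1 x2 x1s _ IH]; first by rewrite scaler0 add0r.
  by rewrite scalerDr -addrA scalerA; exact: lspan_add.
apply: add; first exact/sub1/fs.
elim: (gt u) => [|b x y xs _ IH]; first exact: lspan_0.
by apply: lspan_add IH; rewrite /= mem_cat; apply/orP; right.
Qed.

Lemma Vpar_lin p (u v : Vsp) a : Vpar p u -> Vpar p v -> Vpar p (a *: u + v).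
Proof.
move=> up vp k.
have E := mcoeff_lin2 a 1 (erefl u@_k) (erefl v@_k).
rewrite scale1r in E; rewrite E /= mul1r.
have [->|/up//] := eqVneq u@_k 0.
by rewrite mulr0 add0r => /vp.
Qed.

Lemma PopV_lin : linear (Pop C).1.
Proof.
move=> a u v; apply/malgP => -[k q].
have E x y := mcoeff_lin2 a 1 (erefl x@_(k, ~~ q)) (erefl y@_(k, ~~ q)).
have E1 := mcoeff_lin2 a 1 (mcoeff_PopV u k q) (mcoeff_PopV v k q).
have E2 := E u v; rewrite scale1r in E1; rewrite scale1r in E2.
refine (etrans (mcoeff_PopV _ k q) (etrans _ (esym E1))).
by case: (q) E2 => /= ->; rewrite !mul1r // opprD mulrN.
Qed.

Lemma PopW_lin : linear (Pop C).2.
Proof.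
move=> a u v; apply/malgP => -[k q].
have E2 := mcoeff_lin2 a 1 (erefl u@_(k, ~~ q)) (erefl v@_(k, ~~ q)).
have E1 := mcoeff_lin2 a 1 (mcoeff_PopW u k q) (mcoeff_PopW v k q).
rewrite scale1r in E1; rewrite scale1r in E2.
by refine (etrans (mcoeff_PopW _ k q) (etrans _ (esym E1))); exact: E2.
Qed.

Lemma q_commP p (X : qop) : qbracket p true X (Pop C) = 0 <->
  (forall v, X.1 ((Pop C).1 v) = (-1) ^+ p *: (Pop C).1 (X.1 v)) /\
  (forall v, X.2 ((Pop C).2 v) = (-1) ^+ p *: (Pop C).2 (X.2 v)).
Proof.
rewrite /qbracket andbT; split=> [E|[E1 E2]].
  split=> v; apply: subr0_eq.
    exact: (congr1 (fun Y : qop => Y.1 v) E).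
  exact: (congr1 (fun Y : qop => Y.2 v) E).
have L (U : zmodType) (x y : U) : x = y -> x - y = 0 by move->; rewrite subrr.
by congr pair; apply/funext => v; [exact: (L _ _ _ (E1 v))|exact: (L _ _ _ (E2 v))].
Qed.

Lemma q_homog_lin p (X Y : qop) a :
  q_homog p X -> q_homog p Y -> q_homog p (a *: X + Y).
Proof.
move=> [[X1 X2] [FX1 FX2] [PX1 PX2] AX BX] [[Y1 Y2] [FY1 FY2] [PY1 PY2] AY BY].
split.
- by split; apply: lin_comb.
- by split; apply: finite_rank_lin.
- split=> r v vr; apply: Vpar_lin; [exact: PX1|exact: PY1|exact: PX2|exact: PY2].
- move=> r w v wr.
  have E1 : pairing (a *: X.2 w + Y.2 w) v
      = a * pairing (X.2 w) v + pairing (Y.2 w) v := pairing_is_linearl v a _ _.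
  have E2 : pairing w (a *: X.1 v + Y.1 v)
      = a * pairing w (X.1 v) + pairing w (Y.1 v) := pairing_is_linearr w a _ _.
  refine (etrans E1 (etrans _ (congr1 _ (esym E2)))).
  by rewrite (AX r) // (AY r) //; ring.
- apply/q_commP; move/q_commP: BX => [BX1 BX2]; move/q_commP: BY => [BY1 BY2].
  have comb (U : lmodType C) (f g P : U -> U) b v : linear P ->
      f (P v) = b *: P (f v) -> g (P v) = b *: P (g v) ->
      a *: f (P v) + g (P v) = b *: P (a *: f v + g v).
    by move=> lP -> ->; rewrite lP scalerDr !scalerA mulrC.
  split=> v; first exact: (comb _ _ _ _ _ _ PopV_lin (BX1 v) (BY1 v)).
  exact: (comb _ _ _ _ _ _ PopW_lin (BX2 v) (BY2 v)).
Qed.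

Lemma Vsp_lin_ext (f : Vsp -> Vsp) : linear f -> (forall k, f << k >> = 0) ->
  forall v, f v = 0.
Proof.
move=> lf f0 v; rewrite (monalgE v) (lin_sum lf) big1 // => k _.
have -> : << v@_k *g k >> = v@_k *: << k >> :> Vsp.
  apply/malgP => k'; apply: esym; apply: etrans (mcoeffZ _ _ _) _.
  by rewrite !mcoeffU mulr_natr.
by rewrite (linZ lf) f0 scaler0.
Qed.

(** Commuting with P extends the vanishing from the e_j to the \bar e_j, and
    the pairing transports it from V to W. *)
Lemma q_homog_eq0 p (X : qop) :
  q_homog p X -> (forall j, X.1 (vbas C j false) = 0) -> X = 0.
Proof.
move=> [[X1 X2] _ _ AX /q_commP[BX _]] X0.
have X1E v : X.1 v = 0.
  apply: Vsp_lin_ext X1 _ v => -[j [|]]; last exact: X0.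
  have -> : << (j, true) >> = (Pop C).1 (vbas C j false).
    apply/malgP => -[k q]; apply: esym; apply: etrans (mcoeff_PopV _ _ _) _.
    by rewrite /vbas !mcoeffU !xpair_eqE; case: q; rewrite ?andbF ?andbT ?oppr0.
  by apply: etrans (BX _) _; rewrite X0 (lin0 PopV_lin) scaler0.
have X2E w : X.2 w = 0.
  apply: Vsp_lin_ext X2 _ w => k; apply/malgP => k'; rewrite mcoeff0.
  have wr : @Wpar C k.2 << k >>.
    by move=> k1; have := mcoeffU k (1 : C) k1 => /= ->; case: (k =P k1) => [->|_]; rewrite ?eqxx.
  have := AX k.2 << k >> (vbas C k'.1 k'.2) wr.
  rewrite X1E pairing_vbas -surjective_pairing => ->.
  have -> : pairing << k >> (0 : Vsp) = 0.
    by rewrite /pairing big1_fset // => k1 _ _; rewrite mcoeff0 mulr0.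
  by rewrite mulr0.
by rewrite [X]surjective_pairing; congr pair; apply/funext.
Qed.

Lemma q_homog0 p : @q_homog C p 0.
Proof.
pose i := ZIndex (isT : (1 : int) != 0).
have E (U : lmodType C) (x : U) : -1 *: x + x = 0 by rewrite scaleN1r addNr.
have := q_homog_lin (-1) (qgen_homog C p i i) (qgen_homog C p i i).
by rewrite E.
Qed.

Lemma q_oo_homog p (X : qop) : q_homog p X -> q_oo X.
Proof.
case: p => hX.
  by exists 0, X; split; [exact: q_homog0|exact: hX|exact: (esym (add0r X))].
by exists X, 0; split; [exact: hX|exact: q_homog0|exact: (esym (addr0 X))].
Qed.

Lemma q_oo_lin (X Y : qop) a : q_oo X -> q_oo Y -> q_oo (a *: X + Y).
Proof.
move=> [X0 [X1 [hX0 hX1 ->]]] [Y0 [Y1 [hY0 hY1 ->]]].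
have E (U : lmodType C) (x0 x1 y0 y1 : U) :
    a *: (x0 + x1) + (y0 + y1) = (a *: x0 + y0) + (a *: x1 + y1).
  by rewrite scalerDr addrACA.
exists (a *: X0 + Y0), (a *: X1 + Y1).
by split; [exact: q_homog_lin|exact: q_homog_lin|exact: E].
Qed.

Lemma q_oo0 : @q_oo C 0.
Proof. exact: q_oo_homog (q_homog0 false). Qed.

Lemma q_oo_qgen p i j : q_oo (qgen C p i j).
Proof. exact: q_oo_homog (qgen_homog C p i j). Qed.

Lemma q_oo_lspan (G : set qop) X : (forall Y, G Y -> q_oo Y) -> lspan G X -> q_oo X.
Proof.
move=> GY; elim=> [|a u v Gu _ IH]; first exact: q_oo0.
by apply: q_oo_lin IH; exact: GY.
Qed.

Lemma mcoeff_sum1 (r : seq (zindex * zindex)) p (c : zindex * zindex -> C) v k :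
  ((\sum_(x <- r) c x *: qgen C p x.1 x.2).1 v)@_k
  = \sum_(x <- r) c x * ((qgen C p x.1 x.2).1 v)@_k.
Proof.
elim: r => [|x r IH]; first by rewrite !big_nil; exact: mcoeff0.
rewrite !big_cons.
have := mcoeff_lin2 (c x) 1 (erefl ((qgen C p x.1 x.2).1 v)@_k) IH.
by rewrite scale1r mul1r => E; exact: E.
Qed.

Lemma q_homog_sum (r : seq (zindex * zindex)) p (c : zindex * zindex -> C) :
  q_homog p (\sum_(x <- r) c x *: qgen C p x.1 x.2).
Proof.
elim: r => [|x r IH]; first by rewrite big_nil; exact: q_homog0.
by rewrite big_cons; apply: q_homog_lin IH; exact: qgen_homog.
Qed.

Lemma finite_rank_supp (f : Vsp -> Vsp) : finite_rank f ->
  exists D : seq (zindex * bool), forall u k, k \notin D -> (f u)@_k = 0.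
Proof.
move=> [s fs]; exists (flatten [seq enum_fset (msupp v) | v <- s]) => u k kD.
elim: (fs u) => [|a x y xs _ IH]; first exact: mcoeff0.
have x0 : x@_k = 0.
  apply: mcoeff_outdom; apply: contra kD => kx.
  by apply/flattenP; exists (enum_fset (msupp x)) => //; exact: map_f.
have := mcoeff_lin2 a 1 x0 IH; rewrite scale1r => ->.
by rewrite !mulr0 addr0.
Qed.

(** The adjunction between the two components makes the matrix of a
    homogeneous element finite in both directions, so that it is a finite
    combination of the [qgen p i j]. *)
Lemma q_homog_span p (X : qop) : q_homog p X ->
  exists (r : seq (zindex * zindex)) c, X = \sum_(x <- r) c x *: qgen C p x.1 x.2.
Proof.
move=> hX; have [_ [/finite_rank_supp[D1 F1] /finite_rank_supp[D2 F2]] [P1 _] AX _] := hX.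
(* Only rows in I and columns in J occur: finiteness of the rank on V bounds the
   rows, and on W, through the pairing, the columns. *)
pose c (x : zindex * zindex) := (X.1 (vbas C x.2 false))@_(x.1, p).
pose I := undup [seq k.1 | k <- D1]; pose J := undup [seq k.1 | k <- D2].
pose r := [seq (i, j) | i <- I, j <- J].
have ur : uniq r by apply: allpairs_uniq; rewrite ?undup_uniq // => -[? ?] [].
exists r, c; apply: subr0_eq.
have hZ := q_homog_lin (-1) (q_homog_sum r p c) hX.
rewrite scaleN1r addrC in hZ; apply: (q_homog_eq0 hZ) => j0.
apply/malgP => -[a b]; rewrite mcoeff0.
have E := mcoeff_lin2 1 (-1) (erefl (X.1 (vbas C j0 false))@_(a, b))
  (mcoeff_sum1 r p c (vbas C j0 false) (a, b)).
rewrite scale1r scaleN1r in E; apply: (etrans E); rewrite mul1r mulN1r.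
apply/eqP; rewrite subr_eq0; apply/eqP.
have coef x : ((qgen C p x.1 x.2).1 (vbas C j0 false))@_(a, b)
    = ((x == (a, j0)) && (b == p))%:R.
  apply: (etrans (qgenV _ _ _ _ _ _)).
  have -> := mcoeffU (j0, false) (1 : C) (x.2, b (+) p).
  rewrite xpair_eqE [x]surjective_pairing xpair_eqE /= -natrM mulnb.
  congr (nat_of_bool _)%:R; rewrite (eq_sym j0) andbC.
  by case: (_ == a); case: (_ == j0); case: (b); case: (p).
under eq_bigr do rewrite coef.
have [-> | bp] := eqVneq b p; last first.
  rewrite big1 => [|x _]; last by rewrite andbF mulr0.
  have [//|/(P1 false (vbas C j0 false))] := eqVneq (X.1 (vbas C j0 false))@_(a, b) 0.
  have par0 : Vpar false (vbas C j0 false).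
    move=> k1; have := mcoeffU (j0, false) (1 : C) k1 => /= ->.
    by case: (_ =P k1) => [<-|_]; rewrite ?eqxx.
  by move=> /(_ par0) /=; rewrite addbF => /eqP; rewrite (negbTE bp).
under eq_bigr do rewrite andbT.
have [ar|ar] := boolP ((a, j0) \in r).
  rewrite (bigD1_seq (a, j0)) //= eqxx mulr1 big1 ?addr0 // => x /negbTE ->.
  by rewrite mulr0.
rewrite big1_seq => [|x /= xr]; last first.
  case: (x =P (a, j0)) => [xE|_]; last by rewrite mulr0.
  by rewrite xE (negbTE ar) in xr.
have [aI|aI] := boolP (a \in I); last first.
  apply: F1; apply: contra aI => aD; rewrite mem_undup.
  by apply/mapP; exists (a, p).
have jJ : j0 \notin J.
  by apply: contra ar => jJ; apply/allpairsP; exists (a, j0).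
have wp : @Wpar C p (wbas C a p).
  move=> k1; have := mcoeffU (a, p) (1 : C) k1 => /= ->.
  by case: (_ =P k1) => [<-|_]; rewrite ?eqxx.
have := AX p (wbas C a p) (vbas C j0 false) wp.
rewrite pairing_wbas pairing_vbas F2; last first.
  by apply: contra jJ => jD; rewrite mem_undup; apply/mapP; exists (j0, false).
move/esym/eqP; rewrite mulf_eq0 oppr_eq0 signr_eq0 /= => /eqP.
by [].
Qed.

End QAlgebra.

(** * Parities *)

Section Grading.
Variables (C : fieldType) (U : lmodType C) (par : bool -> set U).
Hypothesis G : is_grading par.

Lemma grading_exists v : exists w : U * U,
  [/\ par false w.1, par true w.2 & v = w.1 + w.2].
Proof. by case: G => _ /(_ v)[u0 [u1 ?]] _; exists (u0, u1). Qed.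

Definition gpart (p : bool) (v : U) : U :=
  let w := projT1 (cid (grading_exists v)) in if p then w.2 else w.1.

Lemma gpart_par p v : par p (gpart p v).
Proof. by rewrite /gpart; case: cid => -[w1 w2] [/= ? ? _]; case: p. Qed.

Lemma gpart_sum v : v = gpart false v + gpart true v.
Proof. by rewrite /gpart; case: cid => -[w1 w2] [/= ? ? ?]. Qed.

Lemma par_lin p a u v : par p u -> par p v -> par p (a *: u + v).
Proof. by case: G => /(_ p)[_ +] _ _; apply. Qed.

Lemma par0 p : par p 0.
Proof. by case: G => /(_ p)[]. Qed.

Lemma parB p u v : par p u -> par p v -> par p (u - v).
Proof. by move=> up vp; rewrite addrC -scaleN1r; exact: par_lin. Qed.

Lemma parD p u v : par p u -> par p v -> par p (u + v).
Proof. by move=> up vp; rewrite -[u]scale1r; exact: par_lin. Qed.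

Lemma parZ p a u : par p u -> par p (a *: u).
Proof. by move=> up; rewrite -[_ *: _]addr0; apply: par_lin => //; exact: par0. Qed.

Lemma parN p u : par p u -> par p (- u).
Proof. by move=> up; rewrite -scaleN1r; exact: parZ. Qed.

Lemma par_eq0 p v : par p v -> par (~~ p) v -> v = 0.
Proof. by case: G => _ _ H; case: p => /= *; exact: H. Qed.

Lemma gpart_uniq u0 u1 : par false u0 -> par true u1 ->
  gpart false (u0 + u1) = u0 /\ gpart true (u0 + u1) = u1.
Proof.
move=> p0 p1; have E := gpart_sum (u0 + u1).
have q0 := gpart_par false (u0 + u1); have q1 := gpart_par true (u0 + u1).
move: E q0 q1; move: (gpart false _) (gpart true _) => w0 w1 E q0 q1.
have E2 : w0 - u0 = u1 - w1.
  by apply/eqP; rewrite subr_eq addrAC eq_sym subr_eq addrC E addrC.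
have Z : w0 - u0 = 0.
  apply: (@par_eq0 false); first exact: parB.
  by rewrite E2; exact: parB.
by split; apply/eqP; [rewrite -subr_eq0 Z|rewrite eq_sym -subr_eq0 -E2 Z].
Qed.

Lemma gpart_id p v : par p v -> gpart p v = v.
Proof.
case: p => vp.
  by have [_ +] := gpart_uniq (par0 false) vp; rewrite add0r.
by have [+ _] := gpart_uniq vp (par0 true); rewrite addr0.
Qed.

Lemma gpart_0 p v : par p v -> gpart (~~ p) v = 0.
Proof.
case: p => vp /=.
  by have [+ _] := gpart_uniq (par0 false) vp; rewrite add0r.
by have [_ +] := gpart_uniq vp (par0 true); rewrite addr0.
Qed.

Lemma gpart_lin p : linear (gpart p).
Proof.
move=> a u v.
have -> : a *: u + v = (a *: gpart false u + gpart false v)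
                     + (a *: gpart true u + gpart true v).
  by rewrite addrACA -scalerDr -!gpart_sum.
have [] := gpart_uniq (par_lin a (gpart_par false u) (gpart_par false v))
                      (par_lin a (gpart_par true u) (gpart_par true v)).
by case: p.
Qed.

Definition gsign (v : U) : U := gpart false v - gpart true v.

Lemma gsign_lin : linear gsign.
Proof.
by move=> a u v; rewrite /gsign !gpart_lin scalerBr opprD addrACA.
Qed.

Lemma gsign_par p v : par p v -> gsign v = (-1) ^+ p *: v.
Proof.
move=> vp; rewrite /gsign; case: p vp => vp.
  by rewrite (gpart_id vp) (gpart_0 vp) sub0r scaleN1r.
by rewrite (gpart_id vp) (gpart_0 vp) subr0 scale1r.
Qed.

End Grading.

(** * The enumeration of the indices *)

Section Index.

(** The position of an index in the enumeration 1, -1, 2, -2, ... for which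
    [I_n] is the set of the first [n] indices. *)
Definition rk (i : zindex) : nat :=
  if 0 < zval i then (`|zval i|.-1).*2 else (`|zval i|.-1).*2.+1.

Lemma unrk_subproof s :
  (if odd s then - (s./2.+1)%:Z else (s./2.+1)%:Z) != 0 :> int.
Proof. by case: odd; rewrite ?oppr_eq0. Qed.

Definition unrk (s : nat) : zindex := ZIndex (unrk_subproof s).

Lemma unrkK : cancel unrk rk.
Proof.
by move=> s; rewrite /rk /=; case: ifP; case: ifP; lia.
Qed.

Lemma rkK : cancel rk unrk.
Proof.
move=> [z z0]; apply: val_inj; rewrite /= /rk /=.
by case: ifP; case: ifP; lia.
Qed.

Lemma rk_inj : injective rk. Proof. exact: can_inj rkK. Qed.
Lemma IsetE n i : Iset n i = (rk i < n)%N :> Prop.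
Proof.
apply/propext; rewrite /Iset /rk /=; case: i => z z0 /=.
by split; case: ifP => z1; lia.
Qed.

Lemma rk_pos i : (0 < zval i) = ~~ odd (rk i).
Proof. by rewrite /rk; case: ifP; rewrite ?oddS odd_double. Qed.

Lemma precE i j : prec i j =
  if odd (rk i) then odd (rk j) && (rk j < rk i)%N
  else odd (rk j) || (rk i < rk j)%N.
Proof.
rewrite /prec; case: i => z z0; case: j => w w0; rewrite /rk /=.
by case: (boolP (0 < z)) => z1; case: (boolP (0 < w)) => w1 /=;
  rewrite ?oddS !odd_double /=; lia.
Qed.

Lemma rk_Ienum n (k : 'I_n) : (rk (Ienum k) < n)%N.
Proof.
suff: Iset n (Ienum k) by rewrite IsetE.
rewrite /Iset /=; by have := ltn_ord k; case: ifP => ?; lia.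
Qed.

Lemma Ienum_inj n : injective (@Ienum n).
Proof.
move=> k l /(congr1 zval) /= E; apply/val_inj => /=; move: E.
by have := ltn_ord k; have := ltn_ord l; case: ifP => ?; case: ifP => ?; lia.
Qed.

Lemma Ienum_onto n i : (rk i < n)%N -> exists k : 'I_n, Ienum k = i.
Proof.
move=> lin.
pose f (k : 'I_n) : 'I_n := Ordinal (rk_Ienum k).
have finj : injective f by move=> k l /(congr1 val) /= /rk_inj/Ienum_inj.
have /codomP[k /(congr1 val) /= kE] := injF_onto finj (Ordinal lin).
by exists k; apply: rk_inj.
Qed.

End Index.

(** * Modules through the action of the basis *)

Local Opaque qgen.

Section Action.
Variable C : numClosedFieldType.
Local Notation Vsp := {malg C[(zindex * bool)%type]}.
Local Notation qop := ((Vsp -> Vsp) * (Vsp -> Vsp))%type.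

Definition gact (M : qmod C) p i j (v : M) : M := qact (qgen C p i j) v.

Lemma gact_lin (M : qmod C) p i j : linear (@gact M p i j).
Proof. exact: (qact_linr (q_oo_qgen C p i j)). Qed.

Lemma gact_par (M : qmod C) p i j r (v : M) :
  qpar r v -> qpar (p (+) r) (gact p i j v).
Proof. exact: qact_par (qgen_homog C p i j). Qed.

Lemma qact0 (M : qmod C) (v : M) : qact (0 : qop) v = 0.
Proof.
have E (U : lmodType C) (x : U) : -1 *: x + x = 0 by rewrite scaleN1r addNr.
by have := qact_linl (-1) v (q_oo0 C) (q_oo0 C); rewrite (E _ 0) (E _ (qact 0 v)).
Qed.

Lemma qact_sum (M : qmod C) (r : seq (zindex * zindex)) p
    (c : zindex * zindex -> C) (v : M) :
  qact (\sum_(x <- r) c x *: qgen C p x.1 x.2) v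
  = \sum_(x <- r) (c x *: gact p x.1 x.2 v : M).
Proof.
elim: r => [|x r IH]; first by rewrite !big_nil; exact: qact0.
rewrite !big_cons -IH; apply: qact_linl; first exact: q_oo_qgen.
exact: q_oo_homog (q_homog_sum r p c).
Qed.

(** The coefficients do not depend on the module, so that homomorphisms and
    submodules can be tested on the operators [gact p i j] alone. *)
Lemma qact_qoo (X : qop) : q_oo X ->
  exists r : bool -> seq (zindex * zindex), exists c : bool -> zindex * zindex -> C,
  forall (M : qmod C) (v : M), qact X v
    = \sum_(x <- r false) (c false x *: gact false x.1 x.2 v : M)
      + \sum_(x <- r true) (c true x *: gact true x.1 x.2 v : M).
Proof.
move=> [X0 [X1 [h0 h1 ->]]].
have [r0 [c0 E0]] := q_homog_span h0; have [r1 [c1 E1]] := q_homog_span h1.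
exists (fun p => if p then r1 else r0), (fun p => if p then c1 else c0) => M v.
have E (U : lmodType C) (x y : U) : 1 *: x + y = x + y by rewrite scale1r.
have := qact_linl 1 v (q_oo_homog h0) (q_oo_homog h1).
rewrite (E _ X0 X1) (E _ (qact X0 v)) => ->.
by rewrite E0 E1; congr (_ + _); exact: qact_sum.
Qed.

Lemma qactZ (M : qmod C) a (X : qop) (v : M) :
  q_oo X -> qact (a *: X) v = a *: qact X v.
Proof.
have E (U : lmodType C) (x : U) : x + 0 = x by rewrite addr0.
move=> hX; have := qact_linl a v hX (q_oo0 C).
by rewrite (E _ (a *: X)) qact0 addr0.
Qed.

Lemma qact_lin2 (M : qmod C) a b (X Y : qop) (v : M) : q_oo X -> q_oo Y ->
  qact (a *: X + b *: Y) v = a *: qact X v + b *: qact Y v.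
Proof.
have E (U : lmodType C) (x : U) : x + 0 = x by rewrite addr0.
move=> hX hY; have hbY := q_oo_lin b hY (q_oo0 C); rewrite (E _ (b *: Y)) in hbY.
by rewrite qact_linl // qactZ.
Qed.

Lemma q_ooD (X Y : qop) : q_oo X -> q_oo Y -> q_oo (X + Y).
Proof.
have E (U : lmodType C) (x y : U) : 1 *: x + y = x + y by rewrite scale1r.
by move=> hX hY; have := q_oo_lin 1 hX hY; rewrite (E _ X Y).
Qed.

Lemma q_ooZ a (X : qop) : q_oo X -> q_oo (a *: X).
Proof.
have E (U : lmodType C) (x : U) : x + 0 = x by rewrite addr0.
by move=> hX; have := q_oo_lin a hX (q_oo0 C); rewrite (E _ (a *: X)).
Qed.

Lemma qactD (M : qmod C) (X Y : qop) (v : M) : q_oo X -> q_oo Y ->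
  qact (X + Y) v = qact X v + qact Y v.
Proof.
have E (U : lmodType C) (x y : U) : 1 *: x + y = x + y by rewrite scale1r.
move=> hX hY; have := qact_linl 1 v hX hY.
by rewrite (E _ X Y) (E _ (qact X v)).
Qed.

Lemma qact_bigsum (M : qmod C) I (r : seq I) (F : I -> qop) (v : M) :
  (forall i, q_oo (F i)) ->
  q_oo (\sum_(i <- r) F i) /\ qact (\sum_(i <- r) F i) v = \sum_(i <- r) qact (F i) v.
Proof.
move=> oF; elim: r => [|i r [o IH]].
  by rewrite !big_nil; split; [exact: q_oo0|exact: qact0].
rewrite !big_cons -IH; split; first exact: q_ooD.
exact: qactD.
Qed.

(** A sign that does not reduce to a power, so that it stays abstract in
    computations. *)
Definition sg (b : bool) : C := if b then -1 else 1.

Lemma sgE (b : bool) : (-1) ^+ b = sg b.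
Proof. by case: b. Qed.

Lemma sg_eq0 b : (sg b == 0) = false.
Proof. by case: b; rewrite /sg ?oppr_eq0 oner_eq0. Qed.

Local Opaque sg.

(** The basic commutation relation; all the relations between root vectors
    below are instances of it. *)
Lemma gact_comm (M : qmod C) p q i j k l (v : M) :
  gact p i j (gact q k l v) = sg (p && q) *: gact q k l (gact p i j v)
    + (if j == k then gact (p (+) q) i l v else 0)
    - (if l == i then sg (p && q) *: gact (p (+) q) k j v else 0).
Proof.
have E1 := qact_bracket v (qgen_homog C p i j) (qgen_homog C q k l).
have E2 := qact_lin2 (j == k)%:R (- (-1) ^+ (p && q) * (l == i)%:R) v
  (q_oo_qgen C (p (+) q) i l) (q_oo_qgen C (p (+) q) k j).
have := etrans (esym E2) (etrans (congr1 (fun X => qact X v)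
          (esym (q_bracket_qgen C p q i j k l))) E1).
rewrite (sgE (p && q)) => E.
have -> : (if j == k then gact (p (+) q) i l v else 0)
    = (j == k)%:R *: gact (p (+) q) i l v.
  by case: (j == k); rewrite ?scale1r ?scale0r.
have -> : (if l == i then sg (p && q) *: gact (p (+) q) k j v else 0)
    = (sg (p && q) * (l == i)%:R) *: gact (p (+) q) k j v.
  by case: (l == i); rewrite ?mulr1 ?mulr0 ?scale0r.
rewrite mulNr scaleNr in E.
by rewrite /gact -addrA E addrC subrK.
Qed.

Lemma gact_comm0 (M : qmod C) p q i j k l (v : M) : j != k -> l != i ->
  gact p i j (gact q k l v) = sg (p && q) *: gact q k l (gact p i j v).
Proof.
move=> /negbTE jk /negbTE li.
by rewrite (gact_comm p q i j k l v) jk li addr0 subr0.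
Qed.

Lemma weight_gact (M : qmod C) p i j k (v : M) :
  gact false k k (gact p i j v) = gact p i j (gact false k k v)
    + (if k == i then gact p i j v else 0) - (if k == j then gact p i j v else 0).
Proof.
have s1 (x : M) : sg (false && p) *: x = x by exact: scale1r.
have eq3 (a b c a' b' c' : M) : a = a' -> b = b' -> c = c' -> a + b - c = a' + b' - c'.
  by move=> -> -> ->.
refine (etrans (gact_comm false p k k i j v) (eq3 _ _ _ _ _ _ (s1 _) _ _)).
  by case: (k =P i) => [->|].
by rewrite eq_sym; case: (k =P j) => [->|_ //]; exact: s1.
Qed.

Lemma qhom_gact (M N : qmod C) (f : M -> N) : linear f ->
  (forall p v, qpar p v -> qpar p (f v)) ->
  (forall p i j v, f (gact p i j v) = gact p i j (f v)) -> is_qhom f.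
Proof.
move=> lf pf gf; split=> // X v /qact_qoo[r [c E]].
rewrite (E M v) (E N (f v)) (linD lf).
by congr (_ + _); rewrite (lin_sum lf); apply: eq_bigr => x _; rewrite (linZ lf) gf.
Qed.

Lemma qhomE (M N : qmod C) (f : M -> N) : is_qhom f ->
  forall p i j v, f (gact p i j v) = gact p i j (f v).
Proof. by case=> _ _ E p i j v; rewrite /gact E //; exact: q_oo_qgen. Qed.

Lemma subspaceD (U : lmodType C) (N : set U) u v :
  is_subspace N -> N u -> N v -> N (u + v).
Proof. by case=> _ H Nu Nv; rewrite -[u]scale1r; exact: H. Qed.

Lemma subspaceZ (U : lmodType C) (N : set U) a v : is_subspace N -> N v -> N (a *: v).
Proof. by case=> N0 H Nv; rewrite -[_ *: _]addr0; exact: H. Qed.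

Lemma subspaceB (U : lmodType C) (N : set U) u v :
  is_subspace N -> N u -> N v -> N (u - v).
Proof. by move=> sN Nu Nv; apply: subspaceD => //; rewrite -scaleN1r; exact: subspaceZ. Qed.

Lemma subspace_sum (U : lmodType C) (N : set U) I (r : seq I) (F : I -> U) :
  is_subspace N -> (forall i, N (F i)) -> N (\sum_(i <- r) F i).
Proof.
move=> sN NF; elim: r => [|i r IH]; first by rewrite big_nil; case: sN.
by rewrite big_cons; exact: subspaceD.
Qed.

Definition hpart (M : qmod C) (p : bool) : M -> M := gpart (qpar_grading M) p.
Definition hsign (M : qmod C) : M -> M := gsign (qpar_grading M).

Lemma submod_gact (M : qmod C) (N : set M) : is_subspace N ->
  (forall p v, N v -> N (hpart p v)) ->
  (forall p i j v, N v -> N (gact p i j v)) -> is_submod N.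
Proof.
move=> sN pN gN; split=> // [v Nv|X v /qact_qoo[r [c E]] Nv].
  exists (hpart false v), (hpart true v).
  by split; [split; [exact: gpart_par|exact: pN]|
    split; [exact: gpart_par|exact: pN]|exact: gpart_sum].
by rewrite (E M v); apply: subspaceD => //; apply: subspace_sum => // x;
  apply: subspaceZ => //; exact: gN.
Qed.

Lemma submod_subspace (M : qmod C) (N : set M) : is_submod N -> is_subspace N.
Proof. by case. Qed.

Lemma submodE (M : qmod C) (N : set M) : is_submod N ->
  forall p i j v, N v -> N (gact p i j v).
Proof. by case=> _ _ H p i j v; apply: H; exact: q_oo_qgen. Qed.

Lemma submod_hpart (M : qmod C) (N : set M) : is_submod N ->
  forall p v, N v -> N (hpart p v).
Proof.
case=> _ H _ p v /H[v0 [v1 [[p0 N0] [p1 N1] ->]]].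
have [E0 E1] := gpart_uniq (qpar_grading M) p0 p1.
by rewrite /hpart; case: p; rewrite ?E0 ?E1.
Qed.

Lemma hpart_hom (M N : qmod C) (f : M -> N) : linear f ->
  (forall p v, qpar p v -> qpar p (f v)) ->
  forall p v, hpart p (f v) = f (hpart p v).
Proof.
move=> lf pf p v; rewrite {1}[v](gpart_sum (qpar_grading M)) (linD lf).
have p0 := pf _ _ (gpart_par (qpar_grading M) false v).
have p1 := pf _ _ (gpart_par (qpar_grading M) true v).
have [E0 E1] := gpart_uniq (qpar_grading N) p0 p1.
by rewrite /hpart; case: p; rewrite ?E0 ?E1.
Qed.

Lemma hsign_hom (M N : qmod C) (f : M -> N) : linear f ->
  (forall p v, qpar p v -> qpar p (f v)) ->
  forall v, hsign (f v) = f (hsign v).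
Proof.
move=> lf pf v; rewrite /hsign /gsign (linB lf).
by have := hpart_hom lf pf; rewrite /hpart => E; rewrite !E.
Qed.

(** The invariants of the centralizer c_n. *)
Definition killed (M : qmod C) n (v : M) : Prop :=
  forall p i j, (n <= rk i)%N -> (n <= rk j)%N -> gact p i j v = 0.

Lemma IsetN n i : (~ Iset n i) = (n <= rk i)%N.
Proof.
by rewrite IsetE; apply/propext; rewrite [X in _ <-> is_true X]leqNgt;
  split=> /negP.
Qed.

Lemma killedP (M : qmod C) n (v : M) :
  killed n v <-> forall X, c_ n X -> qact X v = 0.
Proof.
split=> [kv X|H p i j ni nj]; last first.
  apply: H.
  have E (U : lmodType C) (x : U) : 1 *: x + 0 = x by rewrite addr0 scale1r.
  rewrite -[qgen _ _ _ _]E; apply: lspan_add; last exact: lspan_0.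
  by exists p, i, j; rewrite !IsetN.
elim=> [|a Y Z [p [i [j [ni nj ->]]]] cZ IH]; first exact: qact0.
rewrite IsetN in ni; rewrite IsetN in nj.
rewrite qact_linl ?IH ?[qact _ _]kv ?scaler0 ?addr0 //; first exact: q_oo_qgen.
by apply: q_oo_lspan cZ => _ [? [? [? [_ _ ->]]]]; exact: q_oo_qgen.
Qed.

Lemma killed_leq (M : qmod C) m n (v : M) : (m <= n)%N -> killed m v -> killed n v.
Proof. by move=> mn kv p i j ni nj; apply: kv; exact: leq_trans mn _. Qed.

Lemma killed_lin (M : qmod C) n a (u v : M) :
  killed n u -> killed n v -> killed n (a *: u + v).
Proof. by move=> ku kv p i j ni nj; rewrite gact_lin ku // kv // scaler0 addr0. Qed.

(** The large annihilator condition, tested on the basis of q(oo). *)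
Definition LA (M : qmod C) : Prop := forall v : M, exists n, killed n v.

Lemma LAP (M : qmod C) : large_annihilator M <-> LA M.
Proof.
split=> H v; have [n] := H v.
  by case=> _ /killedP ?; exists n.
by move=> kv; exists n.+1; split=> //; apply/killedP; exact: killed_leq kv.
Qed.

End Action.

(** * The Euler operator *)

Section Euler.
Variable C : numClosedFieldType.

(** The partial sums of the Euler operator, along 1, -1, 2, -2, ... *)
Definition heul (M : qmod C) n (v : M) : M :=
  \sum_(s < n) gact false (unrk s) (unrk s) v.

(** The infinite sum of all the even weight operators: on a vector killed by
    c_n only the first n terms count, and the choice of n is immaterial. *)
Definition euler (M : qmod C) (v : M) : M := heul (xget 0 [set n | killed n v]) v.

Lemma heul_lin (M : qmod C) n : linear (@heul M n).
Proof.
move=> a u v; rewrite /heul scaler_sumr -big_split.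
by apply: eq_bigr => s _; exact: gact_lin.
Qed.

Lemma heul_leq (M : qmod C) m n (v : M) : (m <= n)%N -> killed m v ->
  heul n v = heul m v.
Proof.
move=> /subnK <- kv; elim: (n - m)%N => [//|k IH].
rewrite addSn /heul big_ord_recr /= -/(heul _ v) IH kv ?addr0 //;
  by rewrite unrkK leq_addl.
Qed.

Lemma eulerE (M : qmod C) n (v : M) : killed n v -> euler v = heul n v.
Proof.
move=> kn; have km := xgetPex 0 (ex_intro (fun n => killed n v) n kn).
rewrite /euler; set m := xget _ _ in km *.
have [mn|/ltnW nm] := leqP m n; first by rewrite (heul_leq mn km).
by rewrite (heul_leq nm kn).
Qed.

Lemma killed2 (M : qmod C) : LA M -> forall u v : M,
  exists n, killed n u /\ killed n v.
Proof.
move=> la u v; have [m km] := la u; have [n kn] := la v.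
exists (maxn m n); split; first exact: killed_leq (leq_maxl _ _) km.
exact: killed_leq (leq_maxr _ _) kn.
Qed.

Lemma euler_lin (M : qmod C) : LA M -> linear (@euler M).
Proof.
move=> la a u v; have [n [ku kv]] := killed2 la u v.
by rewrite (eulerE ku) (eulerE kv) (eulerE (killed_lin a ku kv)) heul_lin.
Qed.

(** The difference of the two weights of [gact p i j] cancels in the sum. *)
Lemma heul_gact (M : qmod C) n p i j (v : M) : (rk i < n)%N -> (rk j < n)%N ->
  heul n (gact p i j v) = gact p i j (heul n v).
Proof.
move=> ni nj.
have one k (w : M) : (rk k < n)%N ->
    \sum_(s < n) (if unrk s == k then w else 0) = w.
  move=> nk; rewrite (bigD1 (Ordinal nk)) //= rkK eqxx big1 ?addr0 // => s sk.
  case: eqP => // E; case/eqP: sk; apply: val_inj; rewrite /= -E.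
  by rewrite unrkK.
have sum3 (a b c : 'I_n -> M) :
    \sum_(s < n) (a s + b s - c s) = \sum_s a s + \sum_s b s - \sum_s c s.
  by rewrite sumrB big_split.
refine (etrans (eq_bigr _ (fun (s : 'I_n) _ => weight_gact p i j (unrk s) v)) _).
refine (etrans (sum3 _ _ _) _); rewrite (one i) // (one j) // addrK.
exact: esym (lin_sum (@gact_lin _ _ _ _ _) _ _ _).
Qed.

Lemma euler_gact (M : qmod C) : LA M -> forall p i j (v : M),
  euler (gact p i j v) = gact p i j (euler v).
Proof.
move=> la p i j v; have [n [kn kv]] := killed2 la (gact p i j v) v.
pose m := maxn n (maxn (rk i) (rk j)).+1.
have nm : (n <= m)%N by exact: leq_maxl.
rewrite (eulerE (killed_leq nm kn)) (eulerE (killed_leq nm kv)).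
by rewrite heul_gact //; rewrite /m; lia.
Qed.

Lemma qpar_sum (M : qmod C) p I (r : seq I) (F : I -> M) :
  (forall i, qpar p (F i)) -> qpar p (\sum_(i <- r) F i).
Proof.
move=> pF; elim: r => [|i r IH].
  rewrite big_nil; exact: par0 (qpar_grading M) p.
rewrite big_cons; exact: (parD (qpar_grading M) (pF i) IH).
Qed.

Lemma euler_par (M : qmod C) p (v : M) : qpar p v -> qpar p (euler v).
Proof.
move=> pv; apply: qpar_sum => s.
exact: (gact_par false (unrk s) (unrk s) pv).
Qed.

Lemma euler_qhom (M : qmod C) : LA M -> is_qhom (@euler M).
Proof.
move=> la; apply: qhom_gact; [exact: euler_lin|exact: euler_par|exact: euler_gact].
Qed.

Lemma killed_hom (M N : qmod C) (f : M -> N) n v : is_qhom f ->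
  killed n v -> killed n (f v).
Proof.
move=> hf kv p i j ni nj; rewrite -(qhomE hf) kv //.
by case: hf => lf _ _; exact: lin0 lf.
Qed.

(** One truncation serves on both sides, as f maps vectors killed by c_n to vectors
    killed by c_n. *)
Lemma euler_hom (M N : qmod C) (f : M -> N) : is_qhom f -> LA M -> forall v,
  euler (f v) = f (euler v).
Proof.
move=> hf la v; have [n kv] := la v.
rewrite (eulerE kv) (eulerE (killed_hom hf kv)) /heul.
have [lf _ _] := hf; rewrite (lin_sum lf).
by apply: eq_bigr => s _; rewrite (qhomE hf).
Qed.

End Euler.

(** * Submodules as modules *)

Section Submodule.
Variable C : numClosedFieldType.

Definition sub_pred (M : qmod C) (N : set M) (H : is_submod N) : {pred M} :=
  fun v => `[< N v >].

Record subq_t (M : qmod C) (N : set M) (H : is_submod N) : Type :=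
  SubQ { subq_val : M; subq_mem : subq_val \in sub_pred H }.

Section Instances.
Variables (M : qmod C) (N : set M) (H : is_submod N).

Lemma sub_pred_closed : submod_closed (sub_pred H).
Proof.
have [[N0 Nl] _ _] := H; split; first by apply/asboolP.
by move=> a u v /asboolP Nu /asboolP Nv; apply/asboolP; exact: Nl.
Qed.

HB.instance Definition _ := [isSub of subq_t H for @subq_val M N H].
HB.instance Definition _ := [Choice of subq_t H by <:].
HB.instance Definition _ := GRing.isSubmodClosed.Build C M (sub_pred H) sub_pred_closed.
HB.instance Definition _ := [SubChoice_isSubZmodule of subq_t H by <:].
HB.instance Definition _ := [SubZmodule_isSubLmodule of subq_t H by <:].

Definition subq_inj (x : subq_t H) : M := subq_val x.

Lemma subq_inj_lin : linear subq_inj.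
Proof. exact: (@linearP _ _ _ _ (val : subq_t H -> M)). Qed.

Lemma subq_injP (x : subq_t H) : N (subq_inj x).
Proof. by have /asboolP := subq_mem x. Qed.

Definition subq_make v (Nv : N v) : subq_t H :=
  SubQ (asboolT Nv : v \in sub_pred H).

Lemma subq_makeK v (Nv : N v) : subq_inj (subq_make Nv) = v.
Proof. by []. Qed.

Lemma subq_inj_inj : injective subq_inj.
Proof. exact: val_inj. Qed.

Definition subq_par p : set (subq_t H) := [set x | qpar p (subq_inj x)].

Lemma subq_par_grading : is_grading subq_par.
Proof.
have lv := subq_inj_lin; split.
- move=> p; split=> [|a u v pu pv].
    by change (qpar p (subq_inj 0)); rewrite (lin0 lv); exact: par0 (qpar_grading M) p.
  change (qpar p (subq_inj (a *: u + v))); rewrite lv.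
  exact: (par_lin (qpar_grading M) a pu pv).
- move=> x; have Nx := subq_injP x.
  have N0 := submod_hpart H false Nx; have N1 := submod_hpart H true Nx.
  exists (subq_make N0), (subq_make N1); split.
  - exact: (gpart_par (qpar_grading M) false).
  - exact: (gpart_par (qpar_grading M) true).
  - apply: subq_inj_inj; rewrite (linD lv) !subq_makeK; exact: gpart_sum.
- move=> x p0 p1; apply: subq_inj_inj; rewrite (lin0 lv).
  exact: (par_eq0 (qpar_grading M) (p := false) p0 p1).
Qed.

(** The submodule carries the action of every operator that happens to preserve
    N, so that brackets need no separate treatment. *)
Definition stable X := forall v, N v -> N (qact X v).

Lemma stable_oo X : q_oo X -> stable X.
Proof. by move=> hX v; case: H => _ _; apply. Qed.

Lemma subq_actP X v : N v -> N (if `[< stable X >] then qact X v else 0).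
Proof.
move=> Nv; case: asboolP => [st|_]; first exact: st.
by case: H => -[].
Qed.

Definition subq_act X (x : subq_t H) : subq_t H :=
  subq_make (subq_actP X (subq_injP x)).

Lemma subq_act_stable X x : stable X -> subq_inj (subq_act X x) = qact X (subq_inj x).
Proof. by move=> hX; rewrite /subq_act subq_makeK; case: asboolP. Qed.

Lemma subq_actE X x : q_oo X -> subq_inj (subq_act X x) = qact X (subq_inj x).
Proof. by move=> /stable_oo; exact: subq_act_stable. Qed.

Lemma subq_act_linl a X Y v : q_oo X -> q_oo Y ->
  subq_act (a *: X + Y) v = a *: subq_act X v + subq_act Y v.
Proof.
move=> hX hY; apply: subq_inj_inj.
by rewrite subq_inj_lin !subq_actE ?qact_linl //; exact: q_oo_lin.
Qed.

Lemma subq_act_linr X : q_oo X -> linear (subq_act X).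
Proof.
move=> hX a u v; apply: subq_inj_inj.
by rewrite subq_inj_lin !subq_actE // subq_inj_lin (qact_linr hX).
Qed.

Lemma subq_act_par p r X v : q_homog p X -> subq_par r v ->
  subq_par (p (+) r) (subq_act X v).
Proof.
move=> hX pv; change (qpar (p (+) r) (subq_inj (subq_act X v))).
rewrite subq_actE; last exact: q_oo_homog hX.
exact: (qact_par hX pv).
Qed.

Lemma subq_act_bracket p r X Y v : q_homog p X -> q_homog r Y ->
  subq_act (qbracket p r X Y) v
    = subq_act X (subq_act Y v) - (-1) ^+ (p && r) *: subq_act Y (subq_act X v).
Proof.
move=> hX hY; have oX := q_oo_homog hX; have oY := q_oo_homog hY.
apply: subq_inj_inj; rewrite subq_act_stable.
  rewrite (qact_bracket _ hX hY) (linB subq_inj_lin) (linZ subq_inj_lin).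
  by rewrite !subq_actE.
move=> w Nw; rewrite (qact_bracket _ hX hY).
have sN : is_subspace N by case: H.
apply: subspaceB => //; last apply: subspaceZ => //.
  by do 2!apply: stable_oo => //.
by do 2!apply: stable_oo => //.
Qed.

Definition submodule : qmod C :=
  QMod subq_par_grading subq_act_linl subq_act_linr subq_act_par subq_act_bracket.

Lemma subq_qhom : is_qhom (subq_inj : submodule -> M).
Proof.
split; [exact subq_inj_lin|by []|].
by move=> X v hX; exact (subq_actE v hX).
Qed.

End Instances.
End Submodule.

(** * The points of Q(n) *)

Section Points.
Variables (C : numClosedFieldType) (A : salg C).

Definition apart p : A -> A := gpart (spar_grading A) p.

Lemma apart_lin p : linear (apart p). Proof. exact: gpart_lin. Qed.
Lemma apart_sum x : x = apart false x + apart true x.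
Proof. exact: gpart_sum. Qed.
Lemma apart_par p x : spar p (apart p x). Proof. exact: gpart_par. Qed.
Lemma apart_id p x : spar p x -> apart p x = x. Proof. exact: gpart_id. Qed.
Lemma apart_0 p x : spar p x -> apart (~~ p) x = 0. Proof. exact: gpart_0. Qed.

Lemma apartM x y :
  (apart false (x * y) = apart false x * apart false y + apart true x * apart true y)
  /\ (apart true (x * y) = apart false x * apart true y + apart true x * apart false y).
Proof.
have E : x * y = (apart false x * apart false y + apart true x * apart true y)
    + (apart false x * apart true y + apart true x * apart false y).
  rewrite {1}[x]apart_sum {1}[y]apart_sum mulrDl !mulrDr.
  by rewrite [X in _ + X]addrC addrACA.
have G := spar_grading A.
have P p q u v : spar p u -> spar q v -> spar (p (+) q) (u * v) by exact: spar_M.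
rewrite E; apply: gpart_uniq; apply: (parD G).
- exact: P (apart_par false x) (apart_par false y).
- exact: P (apart_par true x) (apart_par true y).
- exact: P (apart_par false x) (apart_par true y).
- exact: P (apart_par true x) (apart_par false y).
Qed.

Lemma apart1 : apart false 1 = 1 /\ apart true 1 = 0.
Proof. by split; [exact: apart_id (spar_1 A)|exact: apart_0 (spar_1 A)]. Qed.

Section Size.
Variables (m n : nat).
(** Even and odd part of a matrix, and multiplication by the imaginary unit. *)
Definition EV (G : 'M[A]_(m, n)) := map_mx (apart false) G.
Definition OD (G : 'M[A]_(m, n)) := map_mx (apart true) G.
Definition JJ (G : 'M[A]_(m, n)) := map_mx (fun x : A => 'i *: x) G.

Lemma EVD : {morph EV : G H / G + H}.
Proof. by move=> G H; apply/matrixP => i j; rewrite !mxE (linD (apart_lin _)). Qed.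
Lemma ODD : {morph OD : G H / G + H}.
Proof. by move=> G H; apply/matrixP => i j; rewrite !mxE (linD (apart_lin _)). Qed.
Lemma EVN : {morph EV : G / - G}.
Proof. by move=> G; apply/matrixP => i j; rewrite !mxE (linN (apart_lin _)). Qed.
Lemma ODN : {morph OD : G / - G}.
Proof. by move=> G; apply/matrixP => i j; rewrite !mxE (linN (apart_lin _)). Qed.
Lemma JJD : {morph JJ : G H / G + H}.
Proof. by move=> G H; apply/matrixP => i j; rewrite !mxE scalerDr. Qed.
Lemma JJN : {morph JJ : G / - G}.
Proof. by move=> G; apply/matrixP => i j; rewrite !mxE scalerN. Qed.
Lemma JJK G : JJ (JJ G) = - G.
Proof. by apply/matrixP => i j; rewrite !mxE scalerA -expr2 sqrCi scaleN1r. Qed.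
Lemma JJ0 : JJ 0 = 0. Proof. by apply/matrixP => i j; rewrite !mxE scaler0. Qed.
Lemma EV_OD G : G = EV G + OD G.
Proof. by apply/matrixP => i j; rewrite !mxE -apart_sum. Qed.

Lemma EV_even (G : 'M[A]_(m, n)) : (forall i j, spar false (G i j)) ->
  EV G = G /\ OD G = 0.
Proof.
move=> pG; split; apply/matrixP => i j; rewrite !mxE; first exact: apart_id.
exact: apart_0 (pG i j).
Qed.

Lemma OD_odd (G : 'M[A]_(m, n)) : (forall i j, spar true (G i j)) ->
  EV G = 0 /\ OD G = G.
Proof.
move=> pG; split; apply/matrixP => i j; rewrite !mxE; last exact: apart_id.
exact: apart_0 (pG i j).
Qed.

Lemma spar_JJ p (G : 'M[A]_(m, n)) : (forall i j, spar p (G i j)) ->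
  forall i j, spar p (JJ G i j).
Proof. by move=> pG i j; rewrite mxE; exact: parZ (spar_grading A) _ _ _ (pG i j). Qed.

Lemma spar_EV G i j : spar false (EV G i j). Proof. by rewrite mxE; exact: apart_par. Qed.
Lemma spar_OD G i j : spar true (OD G i j). Proof. by rewrite mxE; exact: apart_par. Qed.
End Size.

Lemma EV_JJ m n (G : 'M[A]_(m, n)) : EV (JJ G) = JJ (EV G).
Proof. by apply/matrixP => i j; rewrite !mxE (linZ (apart_lin _)). Qed.
Lemma OD_JJ m n (G : 'M[A]_(m, n)) : OD (JJ G) = JJ (OD G).
Proof. by apply/matrixP => i j; rewrite !mxE (linZ (apart_lin _)). Qed.

Lemma EV_mul m n p (G : 'M[A]_(m, n)) (H : 'M[A]_(n, p)) :
  EV (G *m H) = EV G *m EV H + OD G *m OD H.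
Proof.
apply/matrixP => i j; rewrite !mxE (lin_sum (apart_lin _)) -big_split.
by apply: eq_bigr => k _; rewrite !mxE; have [-> _] := apartM (G i k) (H k j).
Qed.

Lemma OD_mul m n p (G : 'M[A]_(m, n)) (H : 'M[A]_(n, p)) :
  OD (G *m H) = EV G *m OD H + OD G *m EV H.
Proof.
apply/matrixP => i j; rewrite !mxE (lin_sum (apart_lin _)) -big_split.
by apply: eq_bigr => k _; rewrite !mxE; have [_ ->] := apartM (G i k) (H k j).
Qed.

Lemma JJ_mull m n p (G : 'M[A]_(m, n)) (H : 'M[A]_(n, p)) :
  JJ G *m H = JJ (G *m H).
Proof.
apply/matrixP => i j; rewrite !mxE scaler_sumr.
by apply: eq_bigr => k _; rewrite !mxE scalerAl.
Qed.

Lemma JJ_mulr m n p (G : 'M[A]_(m, n)) (H : 'M[A]_(n, p)) :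
  G *m JJ H = JJ (G *m H).
Proof.
apply/matrixP => i j; rewrite !mxE scaler_sumr.
by apply: eq_bigr => k _; rewrite !mxE scalerAr.
Qed.

Lemma OD0 m n : OD (0 : 'M[A]_(m, n)) = 0.
Proof. by apply/matrixP => i j; rewrite !mxE; exact: (lin0 (apart_lin true)). Qed.

Lemma EV1 n : EV (1%:M : 'M[A]_n) = 1%:M.
Proof.
apply/matrixP => i j; rewrite !mxE; case: (i == j) => /=; first by case: apart1.
by rewrite mulr0n; exact: (lin0 (apart_lin false)).
Qed.

Lemma OD1 n : OD (1%:M : 'M[A]_n) = 0.
Proof.
apply/matrixP => i j; rewrite !mxE; case: (i == j) => /=; first by case: apart1.
by rewrite mulr0n; exact: (lin0 (apart_lin true)).
Qed.

(** A point of Q(n) is a matrix (a, -c; c, a) with a even and c odd.  Sending it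
    to a + i c is multiplicative, because (i c)(i c') = - c c'; it identifies
    Q(n)(A) with the invertible n x n matrices over the ring A. *)
Definition Theta n (G : 'M[A]_n) : 'M[A]_(n + n) :=
  block_mx (EV G) (JJ (OD G)) (- JJ (OD G)) (EV G).

Definition Phi n (g : 'M[A]_(n + n)) : 'M[A]_n := ulsubmx g + JJ (dlsubmx g).

Definition invpair n (G H : 'M[A]_n) := G *m H = 1%:M /\ H *m G = 1%:M.

Lemma ThetaK n : cancel (@Theta n) (@Phi n).
Proof.
move=> G; rewrite /Phi block_mxKul block_mxKdl JJN JJK opprK.
by rewrite -EV_OD.
Qed.

Lemma Theta_mul n (G H : 'M[A]_n) : Theta (G *m H) = Theta G *m Theta H.
Proof.
rewrite /Theta mulmx_block EV_mul OD_mul.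
rewrite !(mulNmx, mulmxN) !JJ_mull !JJ_mulr JJK opprK JJD opprD.
by rewrite (addrC (OD G *m OD H)) (addrC (- JJ (OD G *m EV H))).
Qed.

Lemma Theta1 n : Theta (1%:M : 'M[A]_n) = 1%:M.
Proof. by rewrite /Theta EV1 OD1 JJ0 oppr0 -scalar_mx_block. Qed.

Lemma Pmx_commE n (a b c d : 'M[A]_n) :
  block_mx a b c d *m Pmx A n = Pmx A n *m block_mx a b c d <-> b = - c /\ d = a.
Proof.
have -> : Pmx A n = block_mx (0 : 'M[A]_n) (- 1%:M) 1%:M 0 by [].
rewrite !mulmx_block !(mul0mx, mulmx0, mulmxN, mulNmx, mulmx1, mul1mx, add0r, addr0).
by split=> [/eq_block_mx[-> _ -> _]|[-> ->]].
Qed.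

Lemma Q_points_Theta n (G H : 'M[A]_n) : invpair G H -> Q_points (Theta G).
Proof.
move=> [GH HG]; rewrite /Q_points /= /Theta.
rewrite block_mxKul block_mxKdr block_mxKur block_mxKdl; split.
- by move=> i j; split; exact: spar_EV.
- move=> i j; have := spar_JJ (spar_OD G) i j => h; split=> //.
  by rewrite mxE; exact: parN (spar_grading A) _ _ h.
- by apply/Pmx_commE; rewrite opprK.
- exists (Theta H); rewrite -[block_mx _ _ _ _]/(Theta G).
  by rewrite -!Theta_mul GH HG Theta1.
Qed.

Lemma Q_pointsE n (g : 'M[A]_(n + n)) : Q_points g -> Theta (Phi g) = g.
Proof.
move=> [pad pbc]; rewrite -{1 2}[g]submxK => /Pmx_commE[E1 E2] _.
have [Ea Oa] := EV_even (fun i j => (pad i j).1).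
have [Ec Oc] := OD_odd (spar_JJ (fun i j => (pbc i j).2)).
rewrite -[RHS]submxK E1 E2 /Phi /Theta EVD ODD Ea Oa Ec Oc.
by rewrite addr0 add0r JJK opprK.
Qed.

Lemma Phi_mul n (g h : 'M[A]_(n + n)) : Q_points g -> Q_points h ->
  Phi (g *m h) = Phi g *m Phi h.
Proof.
by move=> /Q_pointsE{1}<- /Q_pointsE{1}<-; rewrite -Theta_mul ThetaK.
Qed.

(** The four blocks of an inverse of g need not be known to have the right
    parities: a left and a right inverse of a + i c are read off from the parts
    of the right parity. *)
Lemma Q_points_inv n (g : 'M[A]_(n + n)) : Q_points g -> exists H, invpair (Phi g) H.
Proof.
move=> qg; have gE := Q_pointsE qg; have [_ _ _ [h [gh hg]]] := qg.
pose a := EV (Phi g); pose c := OD (Phi g).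
pose a' := ulsubmx h; pose b' := ursubmx h; pose c' := dlsubmx h; pose d' := drsubmx h.
have hE : h = block_mx a' b' c' d' by rewrite submxK.
have PE : Phi g = a + c by rewrite -EV_OD.
have [Ea Oa] : EV a = a /\ OD a = 0 by exact: EV_even (spar_EV _).
have [Ec Oc] : EV c = 0 /\ OD c = c by exact: OD_odd (spar_OD _).
have {}gh : Theta (Phi g) *m h = 1%:M by rewrite gE.
have {}hg : h *m Theta (Phi g) = 1%:M by rewrite gE.
move: gh hg; rewrite hE /Theta -/a -/c !mulmx_block (scalar_mx_block n n).
move=> /eq_block_mx[gh1 _ gh3 _] /eq_block_mx[hg1 hg2 _ _].
have right : Phi g *m (EV a' + JJ (OD c')) = 1%:M.
  have := congr1 (@EV n n) gh1; have := congr1 (@OD n n) gh3.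
  rewrite mulNmx EVD ODD ODN !JJ_mull EV_JJ OD_JJ !EV_mul !OD_mul EV1 OD0.
  rewrite Ea Oa Ec Oc !mul0mx !addr0 !add0r => E3 <-.
  rewrite PE mulmxDl !mulmxDr !JJ_mulr.
  have -> : a *m OD c' = JJ (c *m EV a').
    by apply/eqP; rewrite -subr_eq0 addrC E3.
  by rewrite JJK addrA subrK.
have left : (EV a' - JJ (OD b')) *m Phi g = 1%:M.
  have := congr1 (@EV n n) hg1; have := congr1 (@OD n n) hg2.
  rewrite mulmxN EVD ODD EVN !JJ_mulr EV_JJ OD_JJ !EV_mul !OD_mul EV1 OD0.
  rewrite Ea Oa Ec Oc !mulmx0 !addr0 !add0r => E3 <-.
  rewrite PE mulmxDr !mulmxDl !mulNmx !JJ_mull.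
  have -> : OD b' *m a = - JJ (EV a' *m c).
    by apply/eqP; rewrite -addr_eq0 addrC E3.
  by rewrite JJN JJK opprK addrA subrK.
exists (EV a' + JJ (OD c')); split=> //.
suff <- : EV a' - JJ (OD b') = EV a' + JJ (OD c') by [].
by rewrite -[LHS]mulmx1 -right mulmxA left mul1mx.
Qed.

End Points.

(** * Representations of Q(n) on bilinear maps *)

Section Bilinear.
Variables (C : numClosedFieldType) (A : salg C) (M U : lmodType C).
Implicit Types b : M -> A -> U.

Lemma bil_shift b a : is_bilinear b -> is_bilinear (fun m x => b m (x * a)).
Proof.
move=> [b1 b2]; split=> [x|m] c u v; first exact: b1.
by rewrite mulrDl -scalerAl b2.
Qed.

Lemma tens_eq_shift (s t : seq (M * A)) b a : is_bilinear b -> tens_eq s t ->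
  \sum_(x <- s) b x.1 (x.2 * a) = \sum_(x <- t) b x.1 (x.2 * a).
Proof. by move=> hb st; exact: st _ _ (bil_shift a hb). Qed.

Lemma bil_precomp b (f : M -> M) : linear f -> is_bilinear b ->
  is_bilinear (fun m => b (f m)).
Proof. by move=> lf [b1 b2]; split=> [x|m] c u v; rewrite ?lf; [exact: b1|exact: b2]. Qed.

Lemma lin_bigsum (V : lmodType C) I (r : seq I) (F : I -> V -> U) :
  (forall i, linear (F i)) -> linear (fun v => \sum_(i <- r) F i v).
Proof.
move=> lF a u v; elim: r => [|i r IH]; first by rewrite !big_nil scaler0 addr0.
by rewrite !big_cons lF IH scalerDr addrACA.
Qed.
End Bilinear.

Section Representation.
Variables (C : numClosedFieldType) (M : qmod C) (n : nat).
Variable rho : forall A : salg C, 'M[A]_(n + n) -> M -> seq (M * A).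
Hypothesis Hrep : Q_rep rho.

Section OverA.
Variables (A : salg C) (U : lmodType C).
Implicit Types (b : M -> A -> U) (G H : 'M[A]_n).

(** The transpose of the action of a point, on bilinear maps out of M x A:
    equality in the tensor product becomes equality of functions. *)
Definition Ract G b : M -> A -> U :=
  fun m a => \sum_(y <- rho (Theta G) m) b y.1 (y.2 * a).

Lemma Ract_bil G H b : invpair G H -> is_bilinear b -> is_bilinear (Ract G b).
Proof.
move=> GH hb; have qG := Q_points_Theta GH; split=> [x|m].
  move=> c u v; rewrite /Ract.
  have [_ H2 _ _ _] := Hrep.
  rewrite (tens_eq_shift x hb (H2 A _ c u v qG)) big_cat big_map /=.
  rewrite scaler_sumr; congr (_ + _); apply: eq_bigr => y _.
  by have [b1 _] := hb; rewrite (linZ (b1 _)).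
apply: lin_bigsum => y c u v; rewrite mulrDr -scalerAr.
by have [_ b2] := hb; exact: b2.
Qed.

Lemma Ract1 b : is_bilinear b -> Ract 1%:M b = b.
Proof.
move=> hb; apply/funext => m; apply/funext => a; rewrite /Ract Theta1.
have [_ _ H3 _ _] := Hrep.
by rewrite (tens_eq_shift a hb (H3 A m)) big_seq1 /= mul1r.
Qed.

Lemma Ract_mul G G' H H' b : invpair G G' -> invpair H H' -> is_bilinear b ->
  Ract (G *m H) b = Ract H (Ract G b).
Proof.
move=> GG HH hb; apply/funext => m; apply/funext => a; rewrite /Ract Theta_mul.
have [_ _ _ H4 _] := Hrep.
have qG := Q_points_Theta GG; have qH := Q_points_Theta HH.
rewrite (tens_eq_shift a hb (H4 A _ _ m qG qH)) big_allpairs_dep /=.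
by apply: eq_bigr => x _; apply: eq_bigr => y _; rewrite mulrA.
Qed.

End OverA.

Lemma Theta_map (A B : salg C) (f : {lrmorphism A -> B}) (G : 'M[A]_n) :
  (forall p a, spar p a -> spar p (f a)) -> Theta (map_mx f G) = map_mx f (Theta G).
Proof.
move=> pf; have fp p x : apart p (f x) = f (apart p x).
  have p0 := pf _ _ (apart_par false x); have p1 := pf _ _ (apart_par true x).
  have [E0 E1] := gpart_uniq (spar_grading B) p0 p1.
  rewrite {1}[x]apart_sum rmorphD /=.
  by case: p; rewrite /apart ?E0 ?E1.
rewrite /Theta map_block_mx; congr block_mx; apply/matrixP => i j;
  by rewrite !mxE ?fp ?raddfN /= ?linearZ ?fp.
Qed.

Lemma Ract_natural (A B : salg C) (f : {lrmorphism A -> B}) (U : lmodType C)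
    (G G' : 'M[A]_n) (b : M -> B -> U) :
  (forall p a, spar p a -> spar p (f a)) -> invpair G G' -> is_bilinear b ->
  forall m a, Ract (map_mx f G) b m a
    = \sum_(y <- rho (Theta G) m) b y.1 (f y.2 * a).
Proof.
move=> pf GG hb m a; rewrite /Ract (Theta_map G pf).
have [_ _ _ _ H5] := Hrep.
by rewrite (tens_eq_shift a hb (H5 A B f _ m pf (Q_points_Theta GG))) big_map.
Qed.

Hypothesis Hlift : Q_lifts rho.

(** The matrix that corresponds to the infinitesimal point 1 + X (x) a. *)
Definition infpt (A : salg C) (p : bool) (x : 'M[C]_n) (a : A) : 'M[A]_n :=
  let X := map_mx (fun c => c *: a) x in 1%:M + (if p then JJ X else X).

Lemma Theta_infpt (A : salg C) p (x : 'M[C]_n) (a : A) : spar p a ->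
  Theta (infpt p x a) = infinitesimal_point p x a.
Proof.
move=> pa; have pX i j : spar p (map_mx (fun c => c *: a) x i j).
  by rewrite mxE; exact: (parZ (spar_grading A) _ pa).
have -> : infinitesimal_point p x a
    = let X := map_mx (fun c => c *: a) x in
      if p then block_mx 1%:M (- X) X 1%:M else block_mx (1%:M + X) 0 0 (1%:M + X).
  by case: (p); congr block_mx; apply/matrixP => i j; rewrite !mxE.
rewrite /Theta /infpt EVD ODD EV1 OD1.
case: p pa pX => /= pa pX.
  have [E O] := OD_odd (spar_JJ pX).
  by rewrite E O addr0 add0r JJK opprK.
have [E O] := EV_even pX.
by rewrite E O addr0 JJ0 oppr0.
Qed.

Lemma qact_gelt p (x : 'M[C]_n) (v : M) : qact (g_elt p x) v
  = \sum_(i < n) \sum_(j < n) x i j *: gact p (Ienum i) (Ienum j) v.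
Proof.
have qZ i j : q_oo (x i j *: qgen C p (Ienum i) (Ienum j)).
  exact/q_ooZ/q_oo_qgen.
have o1 i := (qact_bigsum (index_enum 'I_n) v (qZ i)).1.
have s1 i := (qact_bigsum (index_enum 'I_n) v (qZ i)).2.
rewrite /g_elt (qact_bigsum _ v o1).2; apply: eq_bigr => i _; rewrite s1.
by apply: eq_bigr => j _; exact: qactZ (q_oo_qgen _ _ _ _).
Qed.

Lemma infpt_inv (A : salg C) p (x : 'M[C]_n) (a : A) : a * a = 0 ->
  invpair (infpt p x a) (infpt p x (- a)).
Proof.
move=> aa; rewrite /infpt; set X := map_mx _ x; set X' := map_mx _ x.
have -> : X' = - X by apply/matrixP => i j; rewrite !mxE scalerN.
have XX : X *m X = 0.
  apply/matrixP => i j; rewrite !mxE big1 // => k _.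
  by rewrite !mxE -scalerAl -scalerAr aa !scaler0.
have inv Y : Y *m Y = 0 -> invpair (1%:M + Y) (1%:M - Y).
  move=> YY; split; first by rewrite mulmxDl mul1mx mulmxDr mulmx1 mulmxN YY subr0 subrK.
  by rewrite mulmxDl mul1mx mulNmx mulmxDr mulmx1 YY addr0 addrK.
case: p; rewrite ?JJN; apply: inv => //.
by rewrite JJ_mull JJ_mulr XX !JJ0.
Qed.

(** The sign in the differential of an odd element is absorbed by the parity
    operator of M, which makes the formula valid on all vectors. *)
Lemma Ract_lift (A : salg C) (U : lmodType C) p (x : 'M[C]_n) (a : A)
    (b : M -> A -> U) m c : spar p a -> a * a = 0 -> is_bilinear b ->
  Ract (infpt p x a) b m c
  = b m c + b (qact (g_elt p x) (if p then hsign m else m)) (a * c).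
Proof.
move=> pa aa hb.
have lQ : linear (fun v : M => qact (g_elt p x) v).
  move=> d u v; rewrite !qact_gelt.
  have lin2 : linear (fun v : M => \sum_(i < n) \sum_(j < n)
      (x i j *: gact p (Ienum i) (Ienum j) v : M)).
    apply: lin_bigsum => i; apply: lin_bigsum => j d' u' v'.
    by rewrite gact_lin scalerDr !scalerA mulrC.
  exact: lin2.
have hom r v : qpar r v -> Ract (infpt p x a) b v c
    = b v c + b (qact (g_elt p x) (if p then hsign v else v)) (a * c).
  move=> pv; rewrite /Ract (Theta_infpt x pa).
  rewrite (tens_eq_shift c hb (Hlift x pa aa pv)) !big_cons big_nil /= addr0 mul1r.
  have -> : hsign v = (-1) ^+ r *: v by exact: gsign_par.
  case: (p) lQ => lQ; last by rewrite scale1r.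
  by congr (_ + b _ _); exact: esym (linZ lQ _ _).
have [B1 _] := Ract_bil (infpt_inv p x aa) hb.
have [b1 _] := hb.
have lS : linear (fun v => b v c
    + b (qact (g_elt p x) (if p then hsign v else v)) (a * c)).
  have lH : linear (fun v : M => qact (g_elt p x) (if p then hsign v else v)).
    case: (p) lQ => lQ; last exact: lQ.
    exact: lin_comp lQ (gsign_lin (qpar_grading M)).
  have lD (V W : lmodType C) (f g : V -> W) : linear f -> linear g ->
      linear (fun v => f v + g v).
    by move=> lf lg d u v; rewrite lf lg scalerDr addrACA.
  apply: lD; first exact: b1.
  exact: lin_comp (b1 _) lH.
have := gpart_sum (qpar_grading M) m.
move: (gpart_par (qpar_grading M) false m) (gpart_par (qpar_grading M) true m).
move: (gpart _ _ _) (gpart _ _ _) => m0 m1 p0 p1 ->.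
by rewrite (linD (B1 c)) (linD lS) (hom _ _ p0) (hom _ _ p1).
Qed.

End Representation.

(** * Dual numbers *)

Section DualNumbers.
Variable C : numClosedFieldType.

(** The dual numbers over the polynomials in one variable: the ring over which
    the group law of a one-parameter subgroup is differentiated at its generic
    point. *)
Definition dualp : Type := ({poly C} * {poly C})%type.
HB.instance Definition _ := GRing.Lmodule.copy dualp ({poly C} * {poly C})%type.

Definition dmul (u v : dualp) : dualp := (u.1 * v.1, u.1 * v.2 + u.2 * v.1).
Definition dual1 : dualp := (1, 0).

Lemma dmulA : associative dmul.
Proof. by move=> [a b] [c d] [e f]; rewrite /dmul /=; congr pair; ring. Qed.
Lemma dmulC : commutative dmul.
Proof. by move=> [a b] [c d]; rewrite /dmul /=; congr pair; ring. Qed.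
Lemma dmul1 : left_id dual1 dmul.
Proof. by move=> [a b]; rewrite /dmul /= !mul1r mul0r addr0. Qed.
Lemma dmulr1 : right_id dual1 dmul.
Proof. by move=> x; rewrite dmulC dmul1. Qed.
Lemma dmulDl : left_distributive dmul +%R.
Proof.
move=> [a b] [c d] [e f].
have E (x y x' y' : {poly C}) : ((x, y) : dualp) + (x', y') = (x + x', y + y') by [].
by rewrite /dmul !E /=; congr pair; ring.
Qed.
Lemma dmulDr : right_distributive dmul +%R.
Proof. by move=> x y z; rewrite !(dmulC x) dmulDl. Qed.
Lemma dual1_neq0 : dual1 != 0 :> dualp.
Proof. by apply/eqP => -[]/eqP; rewrite oner_eq0. Qed.

HB.instance Definition _ :=
  GRing.Zmodule_isNzRing.Build dualp dmulA dmul1 dmulr1 dmulDl dmulDr dual1_neq0.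

Lemma dscalerAl (a : C) (u v : dualp) : a *: (u * v) = (a *: u : dualp) * v.
Proof.
case: u v => [x y] [z w].
have E1 : a *: (x * z) = (a *: x) * z by exact: scalerAl.
have E2 : a *: (x * w + y * z) = (a *: x) * w + (a *: y) * z.
  by rewrite scalerDr -!scalerAl.
change ((a *: (x * z), a *: (x * w + y * z)) = (a *: x * z, a *: x * w + a *: y * z)).
by rewrite E1 E2.
Qed.
HB.instance Definition _ := GRing.Lmodule_isLalgebra.Build C dualp dscalerAl.
Lemma dscalerAr (a : C) (u v : dualp) : a *: (u * v) = u * (a *: v : dualp).
Proof.
have E : commutative (@GRing.mul dualp) := dmulC.
by rewrite (E u v) (E u (a *: v)); exact: dscalerAl.
Qed.
HB.instance Definition _ := GRing.Lalgebra_isAlgebra.Build C dualp dscalerAr.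

End DualNumbers.

Section EvenAlgebra.
Variables (C : numClosedFieldType) (A : algType C).
Hypothesis mulC : commutative (@GRing.mul A).

Definition even_par (p : bool) : set A := if p then [set 0] else setT.

Lemma even_par_grading : is_grading even_par.
Proof.
split=> [[]|u|u _ //]; rewrite /even_par /=.
- by split=> // a u v -> ->; rewrite /= scaler0 addr0.
- by split.
- by exists u, 0; split; rewrite ?addr0.
Qed.

Lemma even_par1 : even_par false 1. Proof. by []. Qed.

Lemma even_parM p r a b : even_par p a -> even_par r b -> even_par (p (+) r) (a * b).
Proof.
by case: p; case: r => //= pa rb; rewrite /even_par /= ?pa ?rb ?mul0r ?mulr0.
Qed.

Lemma even_parC p r a b : even_par p a -> even_par r b ->
  a * b = (-1) ^+ (p && r) *: (b * a).
Proof.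
case: p; case: r => /=; rewrite ?scale1r => pa rb; rewrite mulC //.
by rewrite pa mulr0 scaler0.
Qed.

Definition even_salg : salg C := SAlg even_par_grading even_par1 even_parM even_parC.

End EvenAlgebra.

Section HornerAlg.
Variables (C : numClosedFieldType).

Lemma horner_algE (A : algType C) (x : A) (p : {poly C}) K : (size p <= K)%N ->
  horner_alg x p = \sum_(k < K) p`_k *: x ^+ k.
Proof.
move=> pK; rewrite {1}(_ : p = \sum_(k < K) p`_k *: 'X^k); last first.
  apply/polyP => i; rewrite -poly_def coef_poly; case: ltnP => // Ki.
  by rewrite nth_default // (leq_trans pK).
rewrite rmorph_sum; apply: eq_bigr => k _ /=.
by rewrite -mul_polyC rmorphM /= horner_algC rmorphXn /= horner_algX mulr_algl.
Qed.

(** Evaluation at x, as a morphism of algebras over C. *)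
Definition heval (A : algType C) (x : A) : {poly C} -> A := horner_alg x.

Lemma heval_scalable (A : algType C) (x : A) : scalable (heval x).
Proof.
by move=> c p; rewrite /heval -mul_polyC rmorphM /= horner_algC mulr_algl.
Qed.

HB.instance Definition _ (A : algType C) (x : A) :=
  GRing.RMorphism.copy (heval x) (horner_alg x).
HB.instance Definition _ (A : algType C) (x : A) :=
  GRing.isScalable.Build C {poly C} A *:%R (heval x) (heval_scalable x).

(** In the dual numbers: t + epsilon, t and epsilon. *)
Definition Xeps : dualp C := ('X, 1).
Definition Xdual : dualp C := ('X, 0).
Definition eps : dualp C := (0, 1).

Lemma horner_Xeps (p : {poly C}) : horner_alg Xeps p = (p, p^`()) :> dualp C.
Proof.
elim/poly_ind: p => [|p c IH]; first by rewrite rmorph0 deriv0.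
rewrite rmorphD rmorphM /= IH horner_algX horner_algC derivD derivM derivX derivC.
have -> : c%:A = (c%:P, 0) :> dualp C.
  by congr pair => /=; rewrite ?scaler0 // alg_polyC.
have mE (a b d e : {poly C}) : ((a, b) : dualp C) * (d, e) = (a * d, a * e + b * d) by [].
have aE (a b d e : {poly C}) : ((a, b) : dualp C) + (d, e) = (a + d, b + e) by [].
by rewrite mE aE; congr pair; ring.
Qed.

Lemma horner_Xdual (p : {poly C}) : horner_alg Xdual p = (p, 0) :> dualp C.
Proof.
elim/poly_ind: p => [|p c IH]; first by rewrite rmorph0.
rewrite rmorphD rmorphM /= IH horner_algX horner_algC.
have -> : c%:A = (c%:P, 0) :> dualp C.
  by congr pair => /=; rewrite ?scaler0 // alg_polyC.
have mE (a b d e : {poly C}) : ((a, b) : dualp C) * (d, e) = (a * d, a * e + b * d) by [].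
have aE (a b d e : {poly C}) : ((a, b) : dualp C) + (d, e) = (a + d, b + e) by [].
by rewrite mE aE; congr pair; ring.
Qed.

End HornerAlg.

(** * Root subgroups act by exponentials *)

Section Elementary.
Variables (C : numClosedFieldType) (n : nat) (i j : 'I_n).
Hypothesis ij : i != j.

Definition elem (A : salg C) (x : A) : 'M[A]_n := 1%:M + x *: delta_mx i j.

Lemma elem_mul (A : salg C) (x y : A) : elem x *m elem y = elem (x + y).
Proof.
rewrite /elem mulmxDl mul1mx mulmxDr mulmx1 -scalemxAl.
have -> : delta_mx i j *m (y *: delta_mx i j) = 0 :> 'M[A]_n.
  apply/matrixP => k l; rewrite !mxE big1 // => r _; rewrite !mxE.
  have [->|_] := eqVneq r j; last by rewrite andbF mul0r.
  by rewrite (eq_sym j i) (negbTE ij) /= mulr0 mulr0.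
by rewrite scaler0 addr0 -addrA [y *: _ + _]addrC -scalerDl.
Qed.

Lemma elem0 (A : salg C) : elem (0 : A) = 1%:M.
Proof. by rewrite /elem scale0r addr0. Qed.

Lemma elem_inv (A : salg C) (x : A) : invpair (elem x) (elem (- x)).
Proof. by split; rewrite elem_mul ?subrr ?addNr elem0. Qed.

Lemma elem_map (A B : salg C) (f : {lrmorphism A -> B}) (x : A) :
  map_mx f (elem x) = elem (f x).
Proof.
apply/matrixP => k l; rewrite !mxE rmorphD rmorphM /=.
by case: (_ == _); case: (_ && _); rewrite ?rmorph1 ?rmorph0.
Qed.

Lemma infpt_elem_even (A : salg C) (x : A) : infpt false (delta_mx i j) x = elem x.
Proof.
apply/matrixP => k l; rewrite !mxE; congr (_ + _).
by case: (_ && _); rewrite ?scale1r ?scale0r ?mulr1 ?mulr0.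
Qed.

Lemma infpt_elem_odd (A : salg C) (x : A) :
  infpt true (delta_mx i j) (- 'i *: x) = elem x.
Proof.
apply/matrixP => k l; rewrite !mxE; congr (_ + _).
case: (_ && _); last by rewrite scale0r scaler0 mulr0.
by rewrite scale1r scalerA mulrN -expr2 sqrCi opprK scale1r mulr1.
Qed.

Definition poly_salg : salg C := even_salg (@mulrC {poly C}).
Definition dual_salg : salg C := even_salg (@dmulC C : commutative (@GRing.mul (dualp C))).

Variables (M : qmod C).
Variable rho : forall A : salg C, 'M[A]_(n + n) -> M -> seq (M * A).
Hypothesis (Hrep : Q_rep rho) (Hlift : Q_lifts rho).

Local Notation X := (gact false (Ienum i) (Ienum j)).

Lemma qact_delta p (m : M) :
  qact (g_elt p (delta_mx i j)) m = gact p (Ienum i) (Ienum j) m.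
Proof.
apply: etrans (qact_gelt _ _ _) _.
have sum_delta (V : lmodType C) (g : 'I_n -> 'I_n -> V) :
    \sum_(k < n) \sum_(l < n) (delta_mx i j : 'M[C]_n) k l *: g k l = g i j.
  rewrite (bigD1 i) //= (bigD1 j) //= mxE !eqxx scale1r.
  rewrite big1 => [|l lj]; last by rewrite mxE (negbTE lj) andbF scale0r.
  rewrite big1 ?addr0 // => k ki; rewrite big1 // => l _.
  by rewrite mxE (negbTE ki) scale0r.
exact: sum_delta.
Qed.

(** The image of m under the generic point 1 + t E_ij, of which every even point
    1 + x E_ij is a specialization. *)
Definition gen_pt (m : M) : seq (M * {poly C}) :=
  rho (Theta (elem ('X : poly_salg))) m.

Definition gen_coef k (m : M) : M := \sum_(y <- gen_pt m) (y.2)`_k *: y.1.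

Definition gen_bound (m : M) : nat := \max_(y <- gen_pt m) size y.2.

Definition horner_lr (A : salg C) (x : A) : {lrmorphism poly_salg -> A} :=
  (heval x : {lrmorphism {poly C} -> A}).

Lemma horner_par (A : salg C) (x : A) : spar false x -> forall p (a : poly_salg),
  spar p a -> spar p (horner_lr x a).
Proof.
move=> px [|] a /=.
  by move=> ->; rewrite rmorph0; exact: par0 (spar_grading A) true.
move=> _; elim/poly_ind: (a : {poly C}) => [|q c IH].
  by rewrite rmorph0; exact: par0 (spar_grading A) false.
rewrite rmorphD rmorphM /= /heval horner_algX horner_algC.
apply: (parD (spar_grading A)); first exact: (spar_M IH px).
exact: (parZ (spar_grading A) _ (spar_1 A)).
Qed.

Lemma Ract_gen (A : salg C) (x : A) (U : lmodType C) (b : M -> A -> U) m a :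
  spar false x -> is_bilinear b -> Ract rho (elem x) b m a
  = \sum_(y <- gen_pt m) b y.1 (horner_alg x y.2 * a).
Proof.
move=> px hb.
have -> : elem x = map_mx (horner_lr x) (elem ('X : poly_salg)).
  have := elem_map (horner_lr x) ('X : poly_salg).
  by rewrite /horner_lr /= /heval horner_algX.
exact: (Ract_natural Hrep (horner_par px) (elem_inv _) hb).
Qed.

Lemma gen_boundP m K (y : M * {poly C}) : (gen_bound m <= K)%N -> y \in gen_pt m ->
  (size y.2 <= K)%N.
Proof.
move=> mK ym; apply: leq_trans mK; rewrite /gen_bound.
exact: (leq_bigmax_seq (F := fun y : M * {poly C} => size y.2)).
Qed.

Lemma Ract_coef (A : salg C) (x : A) (U : lmodType C) (b : M -> A -> U) m a K :
  (gen_bound m <= K)%N -> spar false x -> is_bilinear b ->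
  Ract rho (elem x) b m a = \sum_(k < K) b (gen_coef k m) (x ^+ k * a).
Proof.
move=> mK px hb; rewrite (Ract_gen _ _ px hb).
have [b1 b2] := hb.
have -> : \sum_(k < K) b (gen_coef k m) (x ^+ k * a)
    = \sum_(k < K) \sum_(y <- gen_pt m) (y.2)`_k *: b y.1 (x ^+ k * a).
  apply: eq_bigr => k _; rewrite (lin_sum (b1 _)).
  by apply: eq_bigr => y _; rewrite (linZ (b1 _)).
rewrite exchange_big /=; apply: eq_big_seq => y ym.
rewrite (horner_algE _ (gen_boundP mK ym)) mulr_suml (lin_sum (b2 _)).
by apply: eq_bigr => k _; rewrite -scalerAl (linZ (b2 _)).
Qed.

Lemma gen_coef0 m : gen_coef 0 m = m.
Proof.
pose b (m : M) (f : poly_salg) : M := (f : {poly C})`_0 *: m.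
have hb : is_bilinear b.
  split=> [f|u] c v w; rewrite /b; first by rewrite scalerDr !scalerA mulrC.
  by rewrite coefD coefZ scalerDl scalerA.
have p0 : spar false (0 : poly_salg) by [].
have := Ract_coef 1 (leqnSn (gen_bound m)) p0 hb.
rewrite elem0 (Ract1 Hrep hb) big_ord_recl big1 => [|k _].
  by rewrite /b addr0 expr0 mul1r coef1 !scale1r.
by rewrite /b exprS mul0r mul0r coef0 scale0r.
Qed.

(** The group law at 1 + (t + epsilon) E_ij = (1 + epsilon E_ij)(1 + t E_ij):
    the coefficient of epsilon is the derivative of the orbit of m, and it is
    the action of the root vector on that orbit. *)
Lemma gen_coefS k m : k.+1%:R *: gen_coef k.+1 m = X (gen_coef k m).
Proof.
pose b (m : M) (d : dual_salg) : M := (d : dualp C).2`_k *: m.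
have hb : is_bilinear b.
  split=> [d|u] c v w; rewrite /b; first by rewrite scalerDr !scalerA mulrC.
  have -> : (c *: v + w : dual_salg).2 = c *: (v : dualp C).2 + (w : dualp C).2 by [].
  by rewrite coefD coefZ scalerDl scalerA.
have pe : spar false (eps C : dual_salg) by [].
have ee : (eps C : dual_salg) * eps C = 0.
  by congr pair => /=; ring.
have E1 := Ract_gen m 1 (x := Xeps C : dual_salg) I hb.
have Esum : elem (Xeps C : dual_salg) = elem (eps C : dual_salg) *m elem (Xdual C : dual_salg).
  rewrite elem_mul; congr elem; congr pair => /=; ring.
rewrite Esum (Ract_mul Hrep (elem_inv _) (elem_inv _) hb) in E1.
have hb' := Ract_bil Hrep (elem_inv (eps C : dual_salg)) hb.
rewrite (Ract_gen m 1 (x := Xdual C : dual_salg) I hb') in E1.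
have {}E1 : \sum_(y <- gen_pt m) (y.2)`_k *: X y.1
    = \sum_(y <- gen_pt m) ((y.2)^`())`_k *: y.1.
  transitivity (\sum_(y <- gen_pt m)
      Ract rho (elem (eps C : dual_salg)) b y.1 (heval (Xdual C : dual_salg) y.2 * 1)).
    apply: eq_bigr => y _; rewrite -infpt_elem_even (Ract_lift Hrep Hlift _ _ _ pe ee hb).
    rewrite qact_delta mulr1 /b.
    have -> : heval (Xdual C : dual_salg) y.2 = (y.2, 0) :> dualp C by exact: horner_Xdual.
    have -> : ((eps C : dual_salg) * ((y.2, 0) : dualp C) : dualp C) = (0, y.2).
      by congr pair => /=; ring.
    by rewrite /= coef0 scale0r add0r.
  rewrite E1; apply: eq_bigr => y _; rewrite mulr1 /b.
  exact: (congr1 (fun d : dualp C => d.2`_k *: y.1) (horner_Xeps y.2)).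
rewrite /gen_coef (lin_sum (@gact_lin _ _ _ _ _)).
transitivity (\sum_(y <- gen_pt m) (y.2)`_k *: X y.1); last first.
  by apply: eq_bigr => y _; rewrite (linZ (@gact_lin _ _ _ _ _)).
rewrite E1 scaler_sumr; apply: eq_bigr => y _.
by rewrite coef_deriv scalerA mulr_natl.
Qed.

Lemma gen_coefE k m : gen_coef k m = (k`!)%:R^-1 *: iter k X m.
Proof.
elim: k => [|k IH]; first by rewrite gen_coef0 fact0 invr1 scale1r.
have k0 : k.+1%:R != 0 :> C by rewrite pnatr_eq0.
apply: (scalerI k0); rewrite gen_coefS IH (linZ (@gact_lin _ _ _ _ _)) scalerA.
by rewrite factS natrM invfM mulrA divff // mul1r.
Qed.

(** The orbit of m under the one-parameter subgroup is a polynomial, and its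
    coefficients are the divided powers of the root vector. *)
Lemma gen_nilp m : iter (gen_bound m) X m = 0.
Proof.
have := gen_coefE (gen_bound m) m.
rewrite /gen_coef big1_seq => [|y /= ym]; last first.
  by rewrite nth_default ?scale0r // (gen_boundP (leqnn _) ym).
move=> /esym E; have f0 : (gen_bound m)`!%:R != 0 :> C.
  by rewrite pnatr_eq0 -lt0n fact_gt0.
by rewrite -[LHS](scalerKV f0) E scaler0.
Qed.

Lemma Ract_exp (A : salg C) (x : A) m : spar false x -> exists K,
  iter K X m = 0 /\ forall (U : lmodType C) (b : M -> A -> U) a, is_bilinear b ->
  Ract rho (elem x) b m a = \sum_(k < K) b ((k`!)%:R^-1 *: iter k X m) (x ^+ k * a).
Proof.
move=> px; exists (gen_bound m); split=> [|U b a hb]; first exact: gen_nilp.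
rewrite (Ract_coef a (leqnn _) px hb).
by apply: eq_bigr => k _; rewrite gen_coefE.
Qed.

(** An odd x has square zero, so that 1 + x E_ij is an infinitesimal point. *)
Lemma Ract_odd (A : salg C) (x : A) (U : lmodType C) (b : M -> A -> U) m a :
  spar true x -> is_bilinear b -> Ract rho (elem x) b m a
  = b m a + b (gact true (Ienum i) (Ienum j) (hsign m)) (- 'i *: x * a).
Proof.
move=> px hb; rewrite -infpt_elem_odd.
have px' : spar true (- 'i *: x) by exact: (parZ (spar_grading A) _ px).
have xx : x * x = 0.
  have : x * x + x * x = 0.
    by rewrite {2}(sparC px px) /= expr1 scaleN1r subrr.
  by rewrite -mulr2n -scaler_nat => /eqP; rewrite scaler_eq0 pnatr_eq0 => /eqP.
rewrite (Ract_lift Hrep Hlift _ _ _ px' _ hb) ?qact_delta //.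
by rewrite -scalerAl -scalerAr xx !scaler0.
Qed.

End Elementary.

Section LocalNilpotence.
Variables (C : numClosedFieldType).

Definition loc_nilp (M : qmod C) : Prop := forall i j (m : M), i != j ->
  exists K, iter K (gact false i j) m = 0.

Lemma integrable_loc_nilp (M : qmod C) : integrable M -> loc_nilp M.
Proof.
move=> iM i j m ij; pose n := (maxn (rk i) (rk j)).+1.
have [rho [Hrep Hlift]] := iM n (ltn0Sn _).
have [k kE] : exists k : 'I_n, Ienum k = i by apply: Ienum_onto; rewrite ltnS leq_maxl.
have [l lE] : exists l : 'I_n, Ienum l = j by apply: Ienum_onto; rewrite ltnS leq_maxr.
have kl : k != l by apply: contra ij => /eqP kl; rewrite -kE -lE kl.
have := gen_nilp kl Hrep Hlift m; rewrite kE lE => E.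
by exists (gen_bound k l rho m).
Qed.

Lemma iter_eq0 (U : lmodType C) (f : U -> U) K k m : linear f -> (K <= k)%N ->
  iter K f m = 0 -> iter k f m = 0.
Proof.
by move=> lf /subnK <- E; rewrite iterD E; exact: lin0 (lin_iter _ lf).
Qed.

End LocalNilpotence.

(** * The exponentials without reference to n *)

Section ElementaryOperators.
Variables (C : numClosedFieldType) (M : qmod C) (A : salg C).
Hypothesis nM : loc_nilp M.

Definition nilorder i j (m : M) : nat := xget 0 [set K | iter K (gact false i j) m = 0].

Section OverU.
Variable U : lmodType C.
Implicit Types b : M -> A -> U.

(** The exponential of x times the root vector. *)
Definition expo i j (x : A) b : M -> A -> U := fun m a =>
  \sum_(k < nilorder i j m) b ((k`!)%:R^-1 *: iter k (gact false i j) m) (x ^+ k * a).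

Lemma expoE i j x b m a K : is_bilinear b -> iter K (gact false i j) m = 0 ->
  expo i j x b m a
  = \sum_(k < K) b ((k`!)%:R^-1 *: iter k (gact false i j) m) (x ^+ k * a).
Proof.
move=> [b1 b2] K0.
pose F k := b ((k`!)%:R^-1 *: iter k (gact false i j) m) (x ^+ k * a).
have trunc L L' : (L <= L')%N -> iter L (gact false i j) m = 0 ->
    \sum_(k < L') F k = \sum_(k < L) F k.
  move=> LL L0; rewrite -(big_mkord predT F) (big_cat_nat (leq0n L) LL) //=.
  rewrite big_mkord [X in _ + X](_ : _ = 0) ?addr0 //.
  rewrite big_nat_cond big1 // => k /andP[/andP[Lk _] _].
  rewrite /F (iter_eq0 (@gact_lin _ _ _ _ _) Lk L0) scaler0.
  exact: lin0 (b1 _).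
have m0 : iter (nilorder i j m) (gact false i j) m = 0.
  exact: (xgetPex 0 (ex_intro (fun K => iter K (gact false i j) m = 0) K K0)).
rewrite /expo -/F; have [le|/ltnW le] := leqP K (nilorder i j m).
  exact: trunc.
exact: esym (trunc _ _ le m0).
Qed.

Definition oddo i j (x : A) b : M -> A -> U := fun m a =>
  b m a + b (gact true i j (hsign m)) (- 'i *: x * a).

(** The action of 1 + x E_ij, defined through the root vectors only: the even
    part of x acts by an exponential, the odd part to first order. *)
Definition eop i j (x : A) b := oddo i j (apart true x) (expo i j (apart false x) b).

(** A word is a list of elementary matrices 1 + x E_ij; the operators compose in
    the reverse order, as they act on bilinear maps. *)
Definition wop (w : seq (zindex * zindex * A)) b : M -> A -> U :=
  foldl (fun b e => eop e.1.1 e.1.2 e.2 b) b w.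

End OverU.

Section InLevel.
Variables (n : nat) (rho : forall A : salg C, 'M[A]_(n + n) -> M -> seq (M * A)).
Hypothesis (Hrep : Q_rep rho) (Hlift : Q_lifts rho).

Definition Emx (i j : zindex) : 'M[A]_n :=
  \matrix_(k, l) ((Ienum k == i) && (Ienum l == j))%:R.

Definition wmat (w : seq (zindex * zindex * A)) : 'M[A]_n :=
  foldr (fun e G => (1%:M + e.2 *: Emx e.1.1 e.1.2) *m G) 1%:M w.

Definition wgood (w : seq (zindex * zindex * A)) : Prop := forall e, e \in w ->
  [/\ e.1.1 != e.1.2, (rk e.1.1 < n)%N & (rk e.1.2 < n)%N].

Lemma Emx_Ienum (k l : 'I_n) : Emx (Ienum k) (Ienum l) = delta_mx k l.
Proof.
by apply/matrixP => r s; rewrite !mxE !(inj_eq (@Ienum_inj n)).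
Qed.

Lemma Ract_letter (U : lmodType C) (b : M -> A -> U) i j x :
  i != j -> (rk i < n)%N -> (rk j < n)%N -> is_bilinear b ->
  Ract rho (1%:M + x *: Emx i j) b = eop i j x b /\ is_bilinear (eop i j x b)
  /\ invpair (1%:M + x *: Emx i j) (1%:M + - x *: Emx i j).
Proof.
move=> ij /Ienum_onto[k kE] /Ienum_onto[l lE] hb.
have kl : k != l by apply: contra ij => /eqP kl; rewrite -kE -lE kl.
rewrite -kE -lE Emx_Ienum -/(elem k l x) -/(elem k l (- x)).
have pe := apart_par false x; have po := apart_par true x.
have xE : elem k l x = elem k l (apart false x) *m elem k l (apart true x).
  by rewrite elem_mul // -apart_sum.
have ev (b' : M -> A -> U) : is_bilinear b' ->
    Ract rho (elem k l (apart false x)) b' = expo (Ienum k) (Ienum l) (apart false x) b'.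
  move=> hb'; apply/funext => m; apply/funext => a.
  have [K [K0 KE]] := Ract_exp kl Hrep Hlift m pe.
  by rewrite KE // (expoE _ _ hb' K0).
have hev := Ract_bil Hrep (elem_inv kl (apart false x)) hb.
have hb2 := Ract_bil Hrep (elem_inv kl (apart true x)) hev.
have E : Ract rho (elem k l x) b = eop (Ienum k) (Ienum l) x b.
  rewrite xE (Ract_mul Hrep (elem_inv kl _) (elem_inv kl _) hb).
  apply/funext => m; apply/funext => a.
  by rewrite (Ract_odd k l Hrep Hlift m a po hev) ev.
split=> //; split; last exact: elem_inv.
by rewrite -E; exact: (Ract_bil Hrep (elem_inv kl x) hb).
Qed.

Lemma invpair_mul (G G' H H' : 'M[A]_n) : invpair G G' -> invpair H H' ->
  invpair (G *m H) (H' *m G').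
Proof.
move=> [G1 G2] [H1 H2]; split.
  by rewrite mulmxA -(mulmxA G) H1 mulmx1.
by rewrite mulmxA -(mulmxA H') G2 mulmx1.
Qed.

Lemma Ract_word (U : lmodType C) (b : M -> A -> U) w : wgood w -> is_bilinear b ->
  Ract rho (wmat w) b = wop w b /\ is_bilinear (wop w b)
  /\ exists H, invpair (wmat w) H.
Proof.
elim: w b => [|e w IH] b gw hb /=.
  split; first exact: Ract1.
  by split=> //; exists 1%:M; split; rewrite mulmx1.
have [e1 e2 e3] := gw e (mem_head _ _).
have [E [he inve]] := Ract_letter e.2 e1 e2 e3 hb.
have gw' : wgood w by move=> f fw; apply: gw; rewrite in_cons fw orbT.
have [E' [hw [H invw]]] := IH _ gw' he.
split; first by rewrite (Ract_mul Hrep inve invw hb) E.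
by split=> //; exists (H *m (1%:M + - e.2 *: Emx e.1.1 e.1.2)); exact: invpair_mul.
Qed.

Lemma wmat_cat w w' : wmat (w ++ w') = wmat w *m wmat w'.
Proof. by elim: w => [|e w IH] /=; rewrite ?mul1mx // IH mulmxA. Qed.

End InLevel.

Lemma wop_cat (U : lmodType C) (b : M -> A -> U) w w' :
  wop (w ++ w') b = wop w' (wop w b).
Proof. by rewrite /wop foldl_cat. Qed.

Section OverU2.
Variable U : lmodType C.
Implicit Types b : M -> A -> U.

Lemma expo_bil i j x b : i != j -> is_bilinear b -> is_bilinear (expo i j x b).
Proof.
move=> ij hb; have [b1 b2] := hb; have lX := @gact_lin C M false i j.
split=> [a|m].
  move=> c u v; have [K Ku] := nM u ij; have [L Lv] := nM v ij.
  have Ku' := iter_eq0 lX (leq_maxl K L) Ku; have Lv' := iter_eq0 lX (leq_maxr K L) Lv.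
  have Kuv : iter (maxn K L) (gact false i j) (c *: u + v) = 0.
    by rewrite (lin_iter _ lX) Ku' Lv' scaler0 addr0.
  rewrite (expoE x a hb Ku') (expoE x a hb Lv') (expoE x a hb Kuv).
  rewrite scaler_sumr -big_split; apply: eq_bigr => k _.
  by rewrite (lin_iter _ lX) scalerDr scalerA mulrC -scalerA; exact: b1.
rewrite /expo; apply: lin_bigsum => k c u v.
by rewrite mulrDr -scalerAr; exact: b2.
Qed.

Lemma oddo_bil i j x b : is_bilinear b -> is_bilinear (oddo i j x b).
Proof.
have lD (V W : lmodType C) (f g : V -> W) : linear f -> linear g ->
    linear (fun v => f v + g v).
  by move=> lf lg d u v; rewrite lf lg scalerDr addrACA.
move=> [b1 b2]; split=> [a|m]; apply: lD => //.
  apply: (lin_comp (b1 _)); apply: lin_comp (gsign_lin (qpar_grading M)).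
  exact: gact_lin.
by apply: (lin_comp (b2 _)) => c u v; rewrite mulrDr -scalerAr.
Qed.

Lemma eop_bil i j x b : i != j -> is_bilinear b -> is_bilinear (eop i j x b).
Proof. by move=> ij hb; apply: oddo_bil; exact: expo_bil. Qed.

Definition offdiag (w : seq (zindex * zindex * A)) : Prop :=
  forall e, e \in w -> e.1.1 != e.1.2.

Lemma wop_bil w b : offdiag w -> is_bilinear b -> is_bilinear (wop w b).
Proof.
elim: w b => [//|e w IH] b ow hb; apply: IH; last first.
  by apply: eop_bil => //; exact: ow (mem_head _ _).
by move=> f fw; apply: ow; rewrite in_cons fw orbT.
Qed.

(** The operators of words are made of root vectors, so that no relation between
    endomorphisms and points of Q(n) is used. *)
Lemma wop_comm w b (phi : M -> M) m a : is_qhom phi -> offdiag w -> is_bilinear b ->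
  wop w b (phi m) a = wop w (fun m => b (phi m)) m a.
Proof.
move=> hphi; have [lp pp _] := hphi.
elim: w b => [//|e w IH] b ow hb /=.
have ow' : offdiag w by move=> f fw; apply: ow; rewrite in_cons fw orbT.
have ij := ow _ (mem_head _ _).
rewrite IH //; last exact: eop_bil.
congr (wop _ _ _ _); apply/funext => m'; apply/funext => a'.
have hb' := bil_precomp lp hb; rewrite /eop /oddo.
have iterE k i j (v : M) : iter k (gact false i j) (phi v) = phi (iter k (gact false i j) v).
  by elim: k => [//|k IHk] /=; rewrite IHk (qhomE hphi).
have ex (v : M) x (c : A) : expo e.1.1 e.1.2 x b (phi v) c
    = expo e.1.1 e.1.2 x (fun m => b (phi m)) v c.
  have [K K0] := nM v ij.
  have K0' : iter K (gact false e.1.1 e.1.2) (phi v) = 0.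
    by rewrite iterE K0 (lin0 lp).
  rewrite (expoE _ _ hb K0') (expoE _ _ hb' K0); apply: eq_bigr => k _.
  by rewrite iterE (linZ lp).
by rewrite !ex (hsign_hom lp pp) -(qhomE hphi) ex.
Qed.

Lemma wop_shift w b c m a :
  wop w (fun m a => b m (a * c)) m a = wop w b m (a * c).
Proof.
elim: w b m a => [//|e w IH] b m a /=; rewrite -IH.
congr (wop _ _ _ _); apply/funext => m'; apply/funext => a'.
have ex x m0 a0 : expo e.1.1 e.1.2 x (fun m a => b m (a * c)) m0 a0
    = expo e.1.1 e.1.2 x b m0 (a0 * c).
  by apply: eq_bigr => k _; rewrite mulrA.
by rewrite /eop /oddo !ex mulrA.
Qed.

Lemma killed_hsign n (m : M) : killed n m -> killed n (hsign m).
Proof.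
move=> km p i j ni nj.
have E := km p i j ni nj.
rewrite [m](gpart_sum (qpar_grading M)) (linD (@gact_lin _ _ _ _ _)) in E.
have p0 := gact_par p i j (gpart_par (qpar_grading M) false m).
have p1 := gact_par p i j (gpart_par (qpar_grading M) true m).
rewrite /hsign /gsign (linB (@gact_lin _ _ _ _ _)).
set u := gact p i j (gpart _ false m) in E p0 *.
set v := gact p i j (gpart _ true m) in E p1 *.
have uE : u = - v by apply/eqP; rewrite -addr_eq0 E.
have v0 : v = 0.
  apply: (par_eq0 (qpar_grading M) p1); move: (parN (qpar_grading M) p0).
  by rewrite uE opprK addbF addbT negbK.
by rewrite uE v0 oppr0 addr0.
Qed.

(** Root vectors outside I_s kill m, so that each exponential reduces to its
    constant term. *)
Lemma wop_killed w b s m a : (forall e, e \in w ->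
    [/\ e.1.1 != e.1.2, (s <= rk e.1.1)%N & (s <= rk e.1.2)%N]) ->
  killed s m -> is_bilinear b -> wop w b m a = b m a.
Proof.
move=> + km; elim: w b => [//|e w IH] b ow hb /=.
have [ij si sj] := ow _ (mem_head _ _).
rewrite IH; [|by move=> f fw; apply: ow; rewrite in_cons fw orbT|exact: eop_bil].
have K1 : iter 1 (gact false e.1.1 e.1.2) m = 0 by exact: km.
have hb' := expo_bil (apart false e.2) ij hb.
rewrite /eop /oddo (expoE _ _ hb K1) big_ord1 /= fact0 invr1 scale1r expr0 mul1r.
by rewrite (killed_hsign km) // (lin0 (hb'.1 _)) addr0.
Qed.

End OverU2.

End ElementaryOperators.

(** * Whitehead's lemma *)

Section Whitehead.
Variables (C : numClosedFieldType) (A : salg C) (N n : nat).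
Implicit Types (s t : 'I_n -> zindex) (g h B : 'M[A]_n).

(** The selection matrix of the positions s among the first N indices. *)
Definition Smx s : 'M[A]_(n, N) := \matrix_(k, l) (s k == Ienum l)%:R.
Definition Stmx s : 'M[A]_(N, n) := \matrix_(l, k) (s k == Ienum l)%:R.

Lemma mx_shift k (G H : 'M[A]_k) :
  (H - 1%:M) + ((G - 1%:M) + (G - 1%:M) *m (H - 1%:M)) = G *m H - 1%:M.
Proof.
rewrite mulmxBr mulmx1 mulmxBl mul1mx [X in _ + X]addrC subrK.
by rewrite addrC addrA subrK.
Qed.

Definition level s := forall k, (rk (s k) < N)%N.
Definition disj s t := forall k l, s k != t l.

Lemma disj_sym s t : disj s t -> disj t s.
Proof. by move=> d k l; rewrite eq_sym. Qed.

Lemma Smx_Stmx s : injective s -> level s -> Smx s *m Stmx s = 1%:M.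
Proof.
move=> si sN; apply/matrixP => k k'; rewrite !mxE.
have [l lE] := Ienum_onto (sN k).
rewrite (bigD1 l) //= !mxE lE eqxx mul1r big1 ?addr0 => [|l' ll'].
  by rewrite eq_sym (inj_eq si).
rewrite !mxE -lE (inj_eq (@Ienum_inj N)) (eq_sym l).
by rewrite (negbTE ll') mul0r.
Qed.

Lemma Smx_Stmx0 s t : disj s t -> Smx s *m Stmx t = 0.
Proof.
move=> st; apply/matrixP => k k'; rewrite !mxE big1 // => l _; rewrite !mxE.
case: (s k =P Ienum l) => [<-|_]; last by rewrite mul0r.
by rewrite eq_sym (negbTE (st _ _)) mulr0.
Qed.

Definition inc s t B : 'M[A]_N := Stmx s *m B *m Smx t.

Lemma inc_mul s t t' s' B B' : inc s t B *m inc t' s' B'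
  = Stmx s *m (B *m (Smx t *m Stmx t') *m B') *m Smx s'.
Proof. by rewrite /inc !mulmxA. Qed.

Lemma inc_mul1 s t s' B B' : injective t -> level t ->
  inc s t B *m inc t s' B' = inc s s' (B *m B').
Proof. by move=> ti tN; rewrite inc_mul Smx_Stmx // mulmx1. Qed.

Lemma inc_mul0 s t t' s' B B' : disj t t' -> inc s t B *m inc t' s' B' = 0.
Proof. by move=> tt; rewrite inc_mul Smx_Stmx0 // mulmx0 mul0mx mulmx0 mul0mx. Qed.

Lemma incD s t : {morph inc s t : B B' / B + B'}.
Proof. by move=> B B'; rewrite /inc mulmxDr mulmxDl. Qed.

Lemma incN s t : {morph inc s t : B / - B}.
Proof. by move=> B; rewrite /inc mulmxN mulNmx. Qed.

(** The matrix g placed at the positions s, with the identity elsewhere. *)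
Definition jmx s g : 'M[A]_N := 1%:M + inc s s (g - 1%:M).

Lemma jmx_mul s g h : injective s -> level s -> jmx s (g *m h) = jmx s g *m jmx s h.
Proof.
move=> si sN; rewrite /jmx mulmxDl mul1mx mulmxDr mulmx1 inc_mul1 //.
rewrite -!addrA -!incD.
by rewrite mx_shift.
Qed.

Lemma jmx_comm s t g h : disj s t -> jmx s g *m jmx t h = jmx t h *m jmx s g.
Proof.
move=> st; rewrite /jmx.
have := inc_mul0 s t (g - 1%:M) (h - 1%:M) st.
have := inc_mul0 t s (h - 1%:M) (g - 1%:M) (disj_sym st).
move: (inc s s _) (inc t t _) => x y yx xy.
rewrite !mulmxDl !mul1mx !mulmxDr !mulmx1 xy yx !addr0.
by rewrite addrAC.
Qed.

Lemma jmx1 s : jmx s 1%:M = 1%:M.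
Proof. by rewrite /jmx subrr /inc mulmx0 mul0mx addr0. Qed.

Lemma jmx_inv s g h : injective s -> level s -> invpair g h ->
  invpair (jmx s g) (jmx s h).
Proof. by move=> si sN [gh hg]; split; rewrite -jmx_mul // ?gh ?hg jmx1. Qed.

Section Pair.
Variables s t : 'I_n -> zindex.
Hypothesis (si : injective s) (ti : injective t) (sN : level s) (tN : level t).
Hypothesis st : disj s t.

(** A square matrix of size 2n placed at the positions s and t. *)
Definition Psi (Z : 'M[A]_(n + n)) : 'M[A]_N :=
  1%:M + row_mx (Stmx s) (Stmx t) *m (Z - 1%:M) *m col_mx (Smx s) (Smx t).

Lemma Psi_mul Z Z' : Psi (Z *m Z') = Psi Z *m Psi Z'.
Proof.
have TT : col_mx (Smx s) (Smx t) *m row_mx (Stmx s) (Stmx t) = 1%:M.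
  rewrite mul_col_row !Smx_Stmx // Smx_Stmx0 // Smx_Stmx0 ?scalar_mx_block //.
  exact: disj_sym.
rewrite /Psi; move: (col_mx _ _) (row_mx _ _) TT => T T' TT.
rewrite mulmxDl mul1mx mulmxDr mulmx1 -!addrA; congr (_ + _).
have -> : T' *m (Z - 1%:M) *m T *m (T' *m (Z' - 1%:M) *m T)
    = T' *m ((Z - 1%:M) *m (Z' - 1%:M)) *m T.
  by rewrite -!mulmxA (mulmxA T T') TT mul1mx !mulmxA.
by rewrite -!mulmxDl -!mulmxDr mx_shift.
Qed.

Lemma Psi_block a b c d : Psi (block_mx a b c d)
  = 1%:M + (inc s s (a - 1%:M) + inc t s c + (inc s t b + inc t t (d - 1%:M))).
Proof.
rewrite /Psi (scalar_mx_block n n) opp_block_mx add_block_mx !oppr0 !addr0.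
by rewrite mul_row_block mul_row_col !mulmxDl.
Qed.

(** The elementary matrices at the positions (s, t) with entries those of B; they
    commute, and their product is 1 + B placed there. *)
Definition bword (s t : 'I_n -> zindex) B : seq (zindex * zindex * A) :=
  [seq (s k, t l, B k l) | k <- enum 'I_n, l <- enum 'I_n].

(** Whitehead's decomposition of diag(g, g') for g' the inverse of g: the first
    three factors give (0, g; - g', 0), the last three (0, - 1; 1, 0). *)
Definition whword g g' : seq (zindex * zindex * A) :=
  bword s t g ++ bword t s (- g') ++ bword s t g
  ++ bword s t (- 1%:M) ++ bword t s 1%:M ++ bword s t (- 1%:M).

End Pair.

Lemma wmat_sum (w : seq (zindex * zindex * A)) :
  (forall e f, e \in w -> f \in w -> e.1.2 != f.1.1) ->
  wmat N w = 1%:M + \sum_(e <- w) e.2 *: Emx A N e.1.1 e.1.2.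
Proof.
elim: w => [|e w IH] dw; first by rewrite big_nil addr0.
have dw' : forall f f', f \in w -> f' \in w -> f.1.2 != f'.1.1.
  by move=> f f' fw fw'; apply: dw; rewrite in_cons ?fw ?fw' orbT.
rewrite /= IH // big_cons.
have Z : e.2 *: Emx A N e.1.1 e.1.2 *m (\sum_(f <- w) f.2 *: Emx A N f.1.1 f.1.2) = 0.
  rewrite mulmx_sumr big1_seq // => f /= fw; rewrite -scalemxAl.
  have -> : Emx A N e.1.1 e.1.2 *m (f.2 *: Emx A N f.1.1 f.1.2) = 0.
    apply/matrixP => k l; rewrite !mxE big1 // => r _; rewrite !mxE.
    case: (Ienum r =P e.1.2) => [->|_]; last by rewrite andbF mul0r.
    by rewrite (negbTE (dw e f _ _)) ?mem_head ?in_cons ?fw ?orbT //= mulr0 mulr0.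
  by rewrite scaler0.
rewrite mulmxDl mul1mx mulmxDr mulmx1 Z addr0 -addrA; congr (_ + _).
exact: addrC.
Qed.

Lemma wmat_bword s t B : disj s t -> wmat N (bword s t B) = 1%:M + inc s t B.
Proof.
move=> st; rewrite wmat_sum => [|e f /allpairsP[[k l] [_ _ ->]] /allpairsP[[k' l'] [_ _ ->]]]; last first.
  by rewrite /= eq_sym.
congr (_ + _); rewrite big_allpairs_dep /= big_enum.
apply/matrixP => r r'; rewrite summxE /inc -mulmxA !mxE.
apply: eq_bigr => k _; rewrite big_enum summxE !mxE mulr_sumr.
apply: eq_bigr => l _; rewrite !mxE /= ![_ == Ienum _]eq_sym.
case: (Ienum r == s k) => /=; last by rewrite mul0r mulr0.
by rewrite mul1r.
Qed.

Lemma whitehead_block g g' : invpair g g' ->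
  let u b := block_mx 1%:M b 0 1%:M : 'M[A]_(n + n) in
  let l b := block_mx 1%:M 0 b 1%:M : 'M[A]_(n + n) in
  u g *m (l (- g') *m (u g *m (u (- 1%:M) *m (l 1%:M *m u (- 1%:M)))))
  = block_mx g 0 0 g'.
Proof.
move=> [gg g'g] u l.
have E1 : u g *m l (- g') = block_mx 0 g (- g') 1%:M.
  by rewrite /u /l mulmx_block !(mul1mx, mul0mx, mulmx1, mulmx0) !(add0r, addr0) mulmxN gg subrr.
have E2 : block_mx 0 g (- g') 1%:M *m u g = block_mx 0 g (- g') 0.
  rewrite /u mulmx_block !(mul1mx, mul0mx, mulmx1, mulmx0) !(add0r, addr0) mulNmx g'g addNr.
  by [].
have E3 : u (- 1%:M) *m l 1%:M = block_mx 0 (- 1%:M) 1%:M 1%:M.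
  by rewrite /u /l mulmx_block !(mul1mx, mul0mx, mulmx1, mulmx0) !(add0r, addr0) subrr.
have E4 : block_mx 0 (- 1%:M) 1%:M 1%:M *m u (- 1%:M) = block_mx 0 (- 1%:M) 1%:M 0.
  by rewrite /u mulmx_block !(mul1mx, mul0mx, mulmx1, mulmx0) !(add0r, addr0) addNr.
rewrite (mulmxA (u (- 1%:M))) E3 E4 (mulmxA (u g)) E1 mulmxA E2.
by rewrite mulmx_block !(mul0mx, mulmx0, mulmx1, addr0, add0r, mulmxN, opprK).
Qed.

Lemma whword_wmat s t g g' : injective s -> injective t -> level s -> level t ->
  disj s t -> invpair g g' -> wmat N (whword s t g g') = jmx s g *m jmx t g'.
Proof.
move=> si ti sN tN st gg; have ts := disj_sym st.
have low b : 1%:M + inc t s b = Psi s t (block_mx 1%:M 0 b 1%:M).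
  by rewrite Psi_block !subrr /inc !mulmx0 !mul0mx !addr0 add0r.
have up b : 1%:M + inc s t b = Psi s t (block_mx 1%:M b 0 1%:M).
  by rewrite Psi_block !subrr /inc !mulmx0 !mul0mx !addr0 !add0r.
rewrite /whword !wmat_cat !wmat_bword // !low !up -!Psi_mul //.
rewrite (whitehead_block gg) Psi_block /jmx.
have := inc_mul0 s t (g - 1%:M) (g' - 1%:M) st.
have i0 s' t' : inc s' t' 0 = 0 by rewrite /inc mulmx0 mul0mx.
rewrite !i0; move: (inc s s _) (inc t t _) => x y xy.
by rewrite mulmxDl mul1mx mulmxDr mulmx1 xy !addr0 add0r -addrA [y + x]addrC.
Qed.

Lemma whword_letter (P : zindex -> Prop) s t g g' e : disj s t ->
  (forall k, P (s k)) -> (forall k, P (t k)) -> e \in whword s t g g' ->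
  [/\ e.1.1 != e.1.2, P e.1.1 & P e.1.2].
Proof.
move=> st sP tP; rewrite /whword !mem_cat.
have bg s' t' B : disj s' t' -> (forall k, P (s' k)) -> (forall k, P (t' k)) ->
    e \in bword s' t' B -> [/\ e.1.1 != e.1.2, P e.1.1 & P e.1.2].
  move=> st' s'P t'P /allpairsP[[k l] [_ _ ->]].
  by split; [exact: st'|exact: s'P|exact: t'P].
have ts := disj_sym st.
by do ?case/orP; apply: bg.
Qed.

End Whitehead.

Local Opaque whword.

(** * The stabilized action *)

Section StableAction.
Variables (C : numClosedFieldType) (M : qmod C) (n : nat).
Hypotheses (iM : integrable M) (laM : LA M).

Let nM : loc_nilp M := integrable_loc_nilp iM.

(** A chosen representation of Q(N + 1) that integrates the action; those for
    different N are not assumed to be compatible. *)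
Definition rhoN N : forall A : salg C, 'M[A]_(N.+1 + N.+1) -> M -> seq (M * A) :=
  projT1 (cid (iM (ltn0Sn N))).

Lemma rhoN_rep N : Q_rep (@rhoN N).
Proof. by rewrite /rhoN; case: cid => ? []. Qed.

Lemma rhoN_lift N : Q_lifts (@rhoN N).
Proof. by rewrite /rhoN; case: cid => ? []. Qed.

(** The n indices after the first m ones. *)
Definition tau m (k : 'I_n) : zindex := unrk (m + k).

Lemma tau_inj m : injective (tau m).
Proof. by move=> k l /(congr1 rk); rewrite !unrkK => /addnI /val_inj. Qed.

Lemma tau_level N m : (m + n <= N)%N -> level N (tau m).
Proof. by move=> mN k; rewrite unrkK; have := ltn_ord k; lia. Qed.

Lemma tau_ge m k : (m <= rk (tau m k))%N.
Proof. by rewrite unrkK leq_addr. Qed.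

Lemma tau_disj m m' : (m + n <= m')%N -> disj (tau m) (tau m').
Proof.
move=> mm k l; apply/eqP => /(congr1 rk); rewrite !unrkK.
by have := ltn_ord k; lia.
Qed.

Lemma Ienum_level N : (n <= N)%N -> level N (@Ienum n).
Proof. by move=> nN k; exact: leq_trans (rk_Ienum k) nN. Qed.

Lemma Ienum_disj m : (n <= m)%N -> disj (@Ienum n) (tau m).
Proof.
move=> nm k l; apply/eqP => E; have := rk_Ienum k.
by rewrite E unrkK; lia.
Qed.

Section OverA.
Variables (A : salg C) (U : lmodType C).
Implicit Types (b : M -> A -> U) (g h : 'M[A]_n).

(** The relations between elementary matrices at one level hold for the
    operators, whose definition does not involve the level. *)
Lemma wop_eq N (w w' : seq (zindex * zindex * A)) b : wgood N.+1 w -> wgood N.+1 w' ->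
  wmat N.+1 w = wmat N.+1 w' -> is_bilinear b -> wop w b = wop w' b.
Proof.
move=> gw gw' E hb.
have [<- _] := Ract_word (@rhoN_rep N) (@rhoN_lift N) gw hb.
have [<- _] := Ract_word (@rhoN_rep N) (@rhoN_lift N) gw' hb.
by rewrite E.
Qed.

Lemma wgood_cat N (w w' : seq (zindex * zindex * A)) :
  wgood N w -> wgood N w' -> wgood N (w ++ w').
Proof. by move=> gw gw' e; rewrite mem_cat => /orP[/gw|/gw']. Qed.

Lemma wgood_whword N (s t : 'I_n -> zindex) g h : disj s t -> level N s -> level N t ->
  wgood N (whword s t g h).
Proof.
move=> st sN tN e.
exact: (@whword_letter _ _ _ (fun i => (rk i < N)%N) s t g h e st sN tN).
Qed.

(** The action of g through diag(g, g') with g' at the positions m, ..., m + n. *)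
Definition Wop m g g' b := wop (whword (@Ienum n) (tau m) g g') b.

Lemma Wop_bil m g g' b : (n <= m)%N -> is_bilinear b -> is_bilinear (Wop m g g' b).
Proof.
move=> nm hb; apply: wop_bil => // e ew.
by have [] := whword_letter (P := fun=> True) (Ienum_disj nm) (fun=> I) (fun=> I) ew.
Qed.

Lemma wop_outer s m m' g g' b v a : killed s v -> (s <= m)%N -> (m + n <= m')%N ->
  is_bilinear b -> wop (whword (tau m) (tau m') g g') b v a = b v a.
Proof.
move=> kv sm mm hb; apply: (wop_killed nM a _ kv hb) => e ew.
apply: (whword_letter (P := fun i => (s <= rk i)%N) (tau_disj mm) _ _ ew) => k.
  exact: leq_trans sm (tau_ge _ _).
by apply: leq_trans (tau_ge _ _); lia.
Qed.

(** The quotient of the two matrices is diag(g, g') placed beyond m, which fixes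
    v. *)
Lemma Wop_indep_step s m m' g g' b v a : killed s v -> (n <= s)%N -> (s <= m)%N ->
  (m + n <= m')%N -> invpair g g' -> is_bilinear b ->
  Wop m' g g' b v a = Wop m g g' b v a.
Proof.
move=> kv ns sm mm gg hb; have [gg1 gg2] := gg.
have nm : (n <= m)%N by lia. have nm' : (n <= m')%N by lia.
rewrite -[RHS](wop_outer g g' a kv sm mm (Wop_bil g g' nm hb)) /Wop -wop_cat.
have L0 : level (m' + n).+1 (@Ienum n) by apply: Ienum_level; lia.
have L1 : level (m' + n).+1 (tau m) by apply: tau_level; lia.
have L2 : level (m' + n).+1 (tau m') by apply: tau_level; lia.
have D1 := Ienum_disj nm; have D2 := Ienum_disj nm'; have D3 := tau_disj mm.
rewrite (@wop_eq (m' + n) _ (whword (@Ienum n) (tau m) g g' ++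
  whword (tau m) (tau m') g g')) //.
- exact: wgood_whword.
- by apply: wgood_cat; exact: wgood_whword.
rewrite wmat_cat !whword_wmat //; try exact: tau_inj; try exact: Ienum_inj.
rewrite mulmxA -(mulmxA (jmx _ _ g)) -jmx_mul //; last exact: tau_inj.
by rewrite gg2 jmx1 mulmx1.
Qed.

Lemma Wop_indep s m m' g g' b v a : killed s v -> (n <= s)%N -> (s <= m)%N ->
  (s <= m')%N -> invpair g g' -> is_bilinear b ->
  Wop m' g g' b v a = Wop m g g' b v a.
Proof.
move=> kv ns sm sm' gg hb; pose M' := (maxn m m' + n)%N.
have E1 : Wop M' g g' b v a = Wop m g g' b v a.
  by apply: (Wop_indep_step _ kv) => //; rewrite /M' leq_add2r leq_maxl.
rewrite -E1; apply/esym.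
by apply: (Wop_indep_step _ kv) => //; rewrite /M' leq_add2r leq_maxr.
Qed.

(** Up to matrices placed beyond m, which fix v, the diagonal matrices with
    blocks g and g' multiply: the correction is the product of the three
    matrices of this form for h g, h' and g', whose blocks at the positions m
    turn g' h' into h' g' and whose blocks further out cancel. *)
Lemma Wop_mul s m g g' h h' b v a : killed s v -> (n <= s)%N -> (s <= m)%N ->
  invpair g g' -> invpair h h' -> is_bilinear b ->
  Wop m (g *m h) (h' *m g') b v a = Wop m h h' (Wop m g g' b) v a.
Proof.
move=> kv ns sm gg hh hb; have [gg1 gg2] := gg; have [hh1 hh2] := hh.
have nm : (n <= m)%N by lia.
set m' := (m + n)%N; have mm : (m + n <= m')%N by [].
have gh := invpair_mul gg hh; have hg := invpair_mul hh gg.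
have sym (x x' : 'M[A]_n) : invpair x x' -> invpair x' x by case.
pose D x x' := whword (tau m) (tau m') x x' : seq (zindex * zindex * A).
have fixD x x' (c : M -> A -> U) : is_bilinear c -> wop (D x x') c v a = c v a.
  by by move=> hc; rewrite /D (wop_outer x x' a kv sm mm hc).
have D3 := tau_disj mm.
have bilD x x' (c : M -> A -> U) : is_bilinear c -> is_bilinear (wop (D x x') c).
  move=> hc; apply: wop_bil => // e ew.
  by have [] := whword_letter (P := fun=> True) D3 (fun=> I) (fun=> I) ew.
pose c := Wop m h h' (Wop m g g' b).
have hc : is_bilinear c by do 2!apply: Wop_bil => //.
rewrite -/c -(fixD (h *m g) (g' *m h') c hc).
rewrite -(fixD h' h _ (bilD _ _ _ hc)) -(fixD g' g _ (bilD _ _ _ (bilD _ _ _ hc))).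
rewrite /c /Wop -!wop_cat.
have L0 : level (m' + n).+1 (@Ienum n) by apply: Ienum_level; lia.
have L1 : level (m' + n).+1 (tau m) by apply: tau_level; lia.
have L2 : level (m' + n).+1 (tau m') by apply: tau_level; lia.
have D1 := Ienum_disj nm.
apply: (congr1 (fun F => F v a)); apply: (@wop_eq (m' + n)) => //.
- exact: wgood_whword.
- by do 4!(apply: wgood_cat; first exact: wgood_whword); exact: wgood_whword.
have ti k := @tau_inj k; have i0 := @Ienum_inj n.
have E (x x' : 'M[A]_n) (xx : invpair x x') := whword_wmat i0 (ti m) L0 L1 D1 xx.
have E' (x x' : 'M[A]_n) (xx : invpair x x') := whword_wmat (ti m) (ti m') L1 L2 D3 xx.
have cat2 (w w' : seq (zindex * zindex * A)) G G' : wmat (m' + n).+1 w = G -> wmat (m' + n).+1 w' = G' ->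
    wmat (m' + n).+1 (w ++ w') = G *m G'.
  by move=> <- <-; exact: wmat_cat.
rewrite E //; apply: esym.
refine (etrans (cat2 _ _ _ _ (E _ _ gg) (cat2 _ _ _ _ (E _ _ hh)
  (cat2 _ _ _ _ (E' _ _ hg) (cat2 _ _ _ _ (E' _ _ (sym _ _ hh)) (E' _ _ (sym _ _ gg)))))) _).
have jm := fun x y : 'M[A]_n => jmx_mul x y (ti m) L1.
have X5 : jmx (m' + n).+1 (tau m) g' *m jmx (m' + n).+1 (tau m) h' *m jmx (m' + n).+1 (tau m) (h *m g)
    *m jmx (m' + n).+1 (tau m) h' *m jmx (m' + n).+1 (tau m) g' = jmx (m' + n).+1 (tau m) (h' *m g').
  rewrite -!jm; congr (jmx _ _ _).
  by rewrite -!mulmxA (mulmxA h' h) hh2 mul1mx !mulmxA gg2 mul1mx.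
have Y3 : jmx (m' + n).+1 (tau m') (g' *m h') *m jmx (m' + n).+1 (tau m') h *m jmx (m' + n).+1 (tau m') g = 1%:M.
  rewrite -!(jmx_mul _ _ (ti m') L2) -mulmxA; have [_ ->] := hg.
  exact: jmx1.
have A2 := jmx_mul g h i0 L0.
have c1 := jmx_comm (m' + n).+1 h g' D1.
have c2 := jmx_comm (m' + n).+1 h' (g' *m h') D3.
have c3 := jmx_comm (m' + n).+1 g' (g' *m h') D3.
have c4 := jmx_comm (m' + n).+1 g' h D3.
rewrite A2 -X5 -[RHS]mulmx1 -Y3.
have shuffle k (z z' x1 x2 x3 x4 x5 y1 y2 y3 : 'M[A]_k) : z' *m x1 = x1 *m z' ->
    x4 *m y1 = y1 *m x4 -> x5 *m y1 = y1 *m x5 -> x5 *m y2 = y2 *m x5 ->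
    (z *m x1) *m ((z' *m x2) *m ((x3 *m y1) *m ((x4 *m y2) *m (x5 *m y3))))
    = (z *m z') *m (x1 *m x2 *m x3 *m x4 *m x5) *m (y1 *m y2 *m y3).
  move=> e1 e2 e3 e4; rewrite -!mulmxA; congr (_ *m _).
  rewrite [RHS]mulmxA e1 -!mulmxA; do 4!congr (_ *m _).
  rewrite (mulmxA y1) -e2 -!mulmxA; congr (_ *m _).
  by rewrite (mulmxA y2) -e4 -!mulmxA (mulmxA y1) -e3 -!mulmxA.
by apply: shuffle.
Qed.

End OverA.
End StableAction.

(** * Direct summands of integrable modules *)

Section PickSums.
Variables (C : comNzRingType) (V : lmodType C) (n N : nat) (f : 'I_n -> 'I_N).

Lemma pick_sum (y : 'I_n -> C) (G : 'I_N -> V) :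
  \sum_r (\sum_l y l * (f l == r)%:R) *: G r = \sum_l y l *: G (f l).
Proof.
transitivity (\sum_r \sum_l (y l * (f l == r)%:R) *: G r).
  by apply: eq_bigr => r _; rewrite scaler_suml.
rewrite exchange_big; apply: eq_bigr => l _ /=.
rewrite (bigD1 (f l)) //= eqxx mulr1 big1 ?addr0 // => r rl.
by rewrite eq_sym (negbTE rl) mulr0 scale0r.
Qed.

Lemma pick_sum2 (x : 'M[C]_n) (F : 'I_N -> 'I_N -> V) :
  \sum_r \sum_s (\sum_l (\sum_k (f k == r)%:R * x k l) * (f l == s)%:R) *: F r s
  = \sum_k \sum_l x k l *: F (f k) (f l).
Proof.
under eq_bigr do rewrite pick_sum.
rewrite exchange_big [RHS]exchange_big; apply: eq_bigr => l _ /=.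
by under eq_bigr do [under eq_bigr do rewrite mulrC]; rewrite pick_sum.
Qed.
End PickSums.

Definition incC (C : numClosedFieldType) N n (s : 'I_n -> zindex) (x : 'M[C]_n) : 'M[C]_N :=
  (\matrix_(r, k) (s k == Ienum r)%:R) *m x *m (\matrix_(k, r) (s k == Ienum r)%:R).

Lemma qact_incC (C : numClosedFieldType) (M : qmod C) N n p (s : 'I_n -> zindex)
    (x : 'M[C]_n) (w : M) : level N s ->
  qact (g_elt p (incC N s x)) w
  = \sum_(k < n) \sum_(l < n) x k l *: gact p (s k) (s l) w.
Proof.
move=> sN; apply: etrans (qact_gelt _ _ _) _.
have /fin_all_exists[f fE] k : exists r : 'I_N, Ienum r = s k by exact: Ienum_onto.
pose F (r r' : 'I_N) : M := gact p (Ienum r) (Ienum r') w.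
have E r r' : incC N s x r r'
    = \sum_l (\sum_k (f k == r)%:R * x k l) * (f l == r')%:R.
  rewrite !mxE; apply: eq_bigr => l _; rewrite !mxE -fE (inj_eq (@Ienum_inj N)).
  by congr (_ * _); apply: eq_bigr => k _; rewrite !mxE -fE (inj_eq (@Ienum_inj N)).
refine (etrans _ (etrans (pick_sum2 f x F) _)).
  by apply: eq_bigr => r _; apply: eq_bigr => r' _; rewrite E.
by apply: eq_bigr => k _; apply: eq_bigr => l _; rewrite /F !fE.
Qed.

Lemma qact_geltB (C : numClosedFieldType) (M : qmod C) N p (X Y : 'M[C]_N) (w : M) :
  qact (g_elt p (X - Y)) w = qact (g_elt p X) w - qact (g_elt p Y) w.
Proof.
have E (V : lmodType C) (g : 'I_N -> 'I_N -> V) :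
    \sum_r \sum_s (X - Y) r s *: g r s
    = \sum_r \sum_s X r s *: g r s - \sum_r \sum_s Y r s *: g r s.
  rewrite -sumrB; apply: eq_bigr => r _; rewrite -sumrB; apply: eq_bigr => s _.
  by rewrite !mxE scalerBl.
refine (etrans (qact_gelt p (X - Y) w) (etrans (E _ _) _)).
exact: esym (congr2 (fun a b => a - b) (qact_gelt p X w) (qact_gelt p Y w)).
Qed.

Lemma q_oo_gelt (C : numClosedFieldType) N p (x : 'M[C]_N) : q_oo (g_elt p x).
Proof.
have qZ i j : q_oo (x i j *: qgen C p (Ienum i) (Ienum j)).
  exact/q_ooZ/q_oo_qgen.
have sum I (r : seq I) (F : I -> _) : (forall i, @q_oo C (F i)) -> q_oo (\sum_(i <- r) F i).
  move=> oF; elim: r => [|i r IH]; first by rewrite big_nil; exact: q_oo0.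
  by rewrite big_cons; exact: q_ooD.
by apply: (sum) => i; apply: (sum) => j; exact: qZ.
Qed.

Lemma inc_scale (C : numClosedFieldType) (A : salg C) N n (s : 'I_n -> zindex)
    (x : 'M[C]_n) (a : A) :
  inc N s s (map_mx (fun c => c *: a) x) = map_mx (fun c => c *: a) (incC N s x).
Proof.
apply/matrixP => r r'; rewrite !mxE scaler_suml; apply: eq_bigr => l _.
rewrite !mxE.
transitivity ((\sum_k ((s k == Ienum r)%:R * x k l)) *: a * (s l == Ienum r')%:R).
  congr (_ * _); rewrite scaler_suml; apply: eq_bigr => k _; rewrite !mxE.
  by case: (_ == _); rewrite ?mul1r ?mul0r ?scale0r.
under [in RHS]eq_bigr do rewrite !mxE.
by case: (s l == _); rewrite ?mulr1 ?mulr0 ?scale0r.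
Qed.

Section Retract.
Variables (C : numClosedFieldType) (M D : qmod C) (n : nat).
Hypotheses (iM : integrable M) (laM : LA M).
Variables (inj : D -> M) (prj : M -> D).
Hypotheses (hinj : is_qhom inj) (hprj : is_qhom prj) (injK : cancel inj prj).

Let nM : loc_nilp M := integrable_loc_nilp iM.

Definition sv (v : M) : nat := maxn n (xget 0 [set s | killed s v]).

Lemma killed_sv v : killed (sv v) v.
Proof.
have [s ks] := laM v; apply: killed_leq (leq_maxr _ _) _.
exact: (xgetPex 0 (ex_intro (fun s => killed s v) s ks)).
Qed.

Lemma n_sv v : (n <= sv v)%N. Proof. exact: leq_maxl. Qed.

Section OverA.
Variable A : salg C.

Definition ginv (g : 'M[A]_(n + n)) : 'M[A]_n := xget 0 [set H | invpair (Phi g) H].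

Lemma ginvP g : Q_points g -> invpair (Phi g) (ginv g).
Proof. by move=> /Q_points_inv ex; exact: (xgetPex 0 ex). Qed.

Lemma invpair_uniq (G H H' : 'M[A]_n) : invpair G H -> invpair G H' -> H = H'.
Proof. by move=> [_ HG] [GH' _]; rewrite -[H]mulmx1 -GH' mulmxA HG mul1mx. Qed.

(** A point g will act on v as diag(g, 1, g^-1), with g^-1 beyond the indices
    that matter for v. *)
Definition Wmx m (G H : 'M[A]_n) : 'M[A]_((m + n).+1) :=
  jmx _ (@Ienum n) G *m jmx _ (tau m) H.

Definition rhoP (g : 'M[A]_(n + n)) (v : M) : seq (M * A) :=
  rhoN iM (Theta (Wmx (sv v) (Phi g) (ginv g))) v.

Lemma Wmx_levels m : (n <= m)%N ->
  [/\ level (m + n).+1 (@Ienum n), level (m + n).+1 (@tau n m) & disj (@Ienum n) (tau m)].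
Proof.
move=> nm; split; [apply: Ienum_level|apply: tau_level|exact: Ienum_disj]; lia.
Qed.

Lemma Wmx_inv m G H : (n <= m)%N -> invpair G H -> invpair (Wmx m G H) (Wmx m H G).
Proof.
move=> nm GH; have [L0 L1 D1] := Wmx_levels nm.
have HG : invpair H G by case: GH.
have -> : Wmx m H G = jmx _ (tau m) G *m jmx _ (@Ienum n) H by exact: jmx_comm.
apply: invpair_mul; apply: jmx_inv => //; [exact: Ienum_inj|exact: tau_inj].
Qed.

Lemma rhoP_sum (U : lmodType C) (b : M -> A -> U) g v a : Q_points g ->
  is_bilinear b -> \sum_(y <- rhoP g v) b y.1 (y.2 * a)
  = Wop (sv v) (Phi g) (ginv g) b v a.
Proof.
move=> qg hb; have [L0 L1 D1] := Wmx_levels (n_sv v).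
have gw := wgood_whword (g := Phi g) (h := ginv g) D1 L0 L1.
have [E _] := Ract_word (@rhoN_rep _ _ iM (sv v + n)) (@rhoN_lift _ _ iM (sv v + n)) gw hb.
rewrite /Wop -E whword_wmat //; [exact: Ienum_inj|exact: tau_inj|exact: ginvP].
Qed.

Lemma Wop_sv (U : lmodType C) (b : M -> A -> U) (G H : 'M[A]_n) s m v a : killed s v ->
  (n <= s)%N -> (s <= m)%N -> invpair G H -> is_bilinear b ->
  Wop (sv v) G H b v a = Wop m G H b v a.
Proof.
move=> kv ns sm GH hb; have nm := leq_trans ns sm.
have [svs|/ltnW ssv] := leqP (sv v) s.
  rewrite (Wop_indep iM a (@killed_sv v) (n_sv v) (leqnn _) _ GH hb) //.
  exact: leq_trans svs sm.
by rewrite (Wop_indep iM a kv ns sm ssv GH hb).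
Qed.

Definition rhoD (g : 'M[A]_(n + n)) (v : D) : seq (D * A) :=
  [seq (prj y.1, y.2) | y <- rhoP g (inj v)].

Lemma bil_prj (U : lmodType C) (b : D -> A -> U) : is_bilinear b ->
  is_bilinear (fun m => b (prj m)).
Proof.
move=> [b1 b2]; have [lp _ _] := hprj.
by split=> [x|m]; [exact: lin_comp (b1 x) lp|exact: b2].
Qed.

Lemma rhoD_sum (U : lmodType C) (b : D -> A -> U) g v s m : Q_points g ->
  is_bilinear b -> killed s (inj v) -> (n <= s)%N -> (s <= m)%N ->
  \sum_(y <- rhoD g v) b y.1 y.2 = Wop m (Phi g) (ginv g) (fun x => b (prj x)) (inj v) 1.
Proof.
move=> qg hb kv ns sm; have hb' := bil_prj hb.
rewrite -(Wop_sv 1 kv ns sm (ginvP qg) hb') -(rhoP_sum _ _ qg hb') big_map.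
by apply: eq_bigr => y _; rewrite mulr1.
Qed.

Lemma killed_all (r : seq M) : exists s, forall x, x \in r -> killed s x.
Proof.
elim: r => [|x r [s IH]]; first by exists 0%N.
have [k kx] := laM x; exists (maxn k s) => y; rewrite in_cons => /orP[/eqP ->|/IH].
  exact: killed_leq (leq_maxl _ _) kx.
exact: killed_leq (leq_maxr _ _).
Qed.

End OverA.

Lemma rhoD_homog (A : salg C) g p v : Q_points g -> qpar p v ->
  tens_homog p (rhoD (A := A) g v).
Proof.
move=> qg pv; have [_ pi _] := hinj; have [lp pp _] := hprj.
have qW := Q_points_Theta (Wmx_inv (n_sv (inj v)) (ginvP qg)).
have [H1 _ _ _ _] := @rhoN_rep _ _ iM (sv (inj v) + n).
have [t tE th] := H1 A _ p (inj v) qW (pi _ _ pv).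
exists [seq (prj y.1, y.2) | y <- t].
  move=> U b hb; rewrite !big_map; exact: (tE U _ (bil_prj hb)).
by move=> _ /mapP[y yt ->]; have [r [py sy]] := th y yt; exists r; split=> //; exact: pp.
Qed.

Lemma rhoD_linear (A : salg C) g a u v : Q_points g ->
  tens_eq (rhoD (A := A) g (a *: u + v))
          ([seq (a *: x.1, x.2) | x <- rhoD g u] ++ rhoD g v).
Proof.
move=> qg U b hb; have [li _ _] := hinj.
have [s ks] := killed_all [:: inj u; inj v; inj (a *: u + v)].
pose m := maxn n s.
have km w : w \in [:: inj u; inj v; inj (a *: u + v)] -> killed m w.
  by move=> /ks; exact: killed_leq (leq_maxr _ _).
have nm : (n <= m)%N := leq_maxl _ _.
have S w : inj w \in [:: inj u; inj v; inj (a *: u + v)] ->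
    \sum_(y <- rhoD g w) b y.1 y.2 = Wop m (Phi g) (ginv g) (fun x => b (prj x)) (inj w) 1.
  by move=> ww; exact: rhoD_sum qg hb (km _ ww) nm (leqnn _).
rewrite big_cat /= (S (a *: u + v)) ?(S v) ?in_cons ?eqxx ?orbT //.
rewrite [X in _ = X + _]big_map /=.
have [b1 _] := hb; have [W1 _] := Wop_bil iM (Phi g) (ginv g) nm (bil_prj hb).
rewrite li W1; congr (_ + _); rewrite -(S u) ?mem_head // scaler_sumr.
by apply: eq_bigr => y _; rewrite (linZ (b1 _)).
Qed.

Lemma rhoD_one (A : salg C) v : tens_eq (rhoD (A := A) 1%:M v) [:: (v, 1)].
Proof.
move=> U b hb; have P1 : Phi (1%:M : 'M[A]_(n + n)) = 1%:M by rewrite -Theta1 ThetaK.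
have i1 : invpair (1%:M : 'M[A]_n) 1%:M by split; rewrite mulmx1.
have q1 : Q_points (1%:M : 'M[A]_(n + n)) by rewrite -Theta1; exact: Q_points_Theta i1.
have g1 : ginv (1%:M : 'M[A]_(n + n)) = 1%:M.
  by apply: (invpair_uniq (ginvP q1)); rewrite P1.
rewrite big_seq1 /= big_map /rhoP P1 g1.
have -> : Wmx (sv (inj v)) (1%:M : 'M[A]_n) 1%:M = 1%:M by rewrite /Wmx !jmx1 mulmx1.
have [_ _ H3 _ _] := @rhoN_rep _ _ iM (sv (inj v) + n).
by rewrite Theta1 (H3 A (inj v) U _ (bil_prj hb)) big_seq1 /= injK.
Qed.

Lemma Q_points_mul (A : salg C) (g h : 'M[A]_(n + n)) :
  Q_points g -> Q_points h -> Q_points (g *m h).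
Proof.
move=> qg qh; rewrite -(Q_pointsE qg) -(Q_pointsE qh) -Theta_mul.
exact: Q_points_Theta (invpair_mul (ginvP qg) (ginvP qh)).
Qed.

Lemma rhoD_mul (A : salg C) (g h : 'M[A]_(n + n)) v : Q_points g -> Q_points h ->
  tens_eq (rhoD (g *m h) v)
          [seq (y.1, y.2 * x.2) | x <- rhoD h v, y <- rhoD g x.1].
Proof.
move=> qg qh U b hb; have qgh := Q_points_mul qg qh.
have [li pi _] := hinj; have [lp pp _] := hprj.
pose phi x := inj (prj x).
have hphi : is_qhom phi.
  split; [exact: lin_comp li lp|by move=> p x px; apply: pi; exact: pp|].
  have [_ _ ap] := hprj; have [_ _ ai] := hinj.
  by move=> X x hX; rewrite /phi (ap _ _ hX) (ai _ _ hX).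
have [s ks] := killed_all (inj v :: [seq phi y.1 | y <- rhoP h (inj v)]).
pose m := maxn n s; have nm : (n <= m)%N := leq_maxl _ _.
have km w : w \in inj v :: [seq phi y.1 | y <- rhoP h (inj v)] -> killed m w.
  by move=> /ks; exact: killed_leq (leq_maxr _ _).
have kv := km _ (mem_head _ _).
pose bM := fun x => b (prj x); have hbM : is_bilinear bM := bil_prj hb.
rewrite (rhoD_sum qgh hb kv nm (leqnn _)) -/bM (Phi_mul qg qh).
have -> : ginv (g *m h) = ginv h *m ginv g.
  apply: (invpair_uniq (ginvP qgh)); rewrite (Phi_mul qg qh).
  exact: invpair_mul (ginvP qg) (ginvP qh).
rewrite (Wop_mul iM _ kv nm (leqnn _) (ginvP qg) (ginvP qh) hbM).
rewrite big_allpairs_dep /= big_map.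
have hW := Wop_bil iM (Phi g) (ginv g) nm hbM.
rewrite -(Wop_sv 1 kv nm (leqnn _) (ginvP qh) hW) -(rhoP_sum _ _ qh hW).
apply: eq_big_seq => x xr /=; rewrite mulr1.
have kx : killed m (inj (prj x.1)).
  by apply: km; rewrite in_cons; apply/orP; right; apply/mapP; exists x.
have hb2 : is_bilinear (fun d a => b d (a * x.2)) by exact: bil_shift.
rewrite (rhoD_sum qg hb2 kx nm (leqnn _)).
have cm : offdiag (whword (@Ienum n) (tau m) (Phi g) (ginv g)).
  move=> e ew.
  by have [] := whword_letter (P := fun=> True) (Ienum_disj nm) (fun=> I) (fun=> I) ew.
have shift c w : Wop m (Phi g) (ginv g) (fun y => (fun d a => b d (a * x.2)) (prj y)) w c
    = Wop m (Phi g) (ginv g) bM w (c * x.2).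
  exact: wop_shift.
rewrite shift mul1r /Wop (wop_comm nM _ _ hphi cm hbM).
congr (wop _ _ _ _); apply/funext => y; rewrite /bM /phi injK.
by [].
Qed.

Lemma rhoD_natural (A B : salg C) (f : {lrmorphism A -> B}) (g : 'M[A]_(n + n)) v :
  (forall p a, spar p a -> spar p (f a)) -> Q_points g ->
  tens_eq (rhoD (map_mx f g) v) [seq (x.1, f x.2) | x <- rhoD g v].
Proof.
move=> pf qg U b hb.
have fg : map_mx f g = Theta (map_mx f (Phi g)) by rewrite (Theta_map _ pf) (Q_pointsE qg).
have inv_map k (G H : 'M[A]_k) : invpair G H -> invpair (map_mx f G) (map_mx f H).
  by move=> [GH HG]; split; rewrite -map_mxM ?GH ?HG map_mx1.
have if' := inv_map _ _ _ (ginvP qg).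
have Pf : Phi (map_mx f g) = map_mx f (Phi g) by rewrite fg ThetaK.
have qf : Q_points (map_mx f g) by rewrite fg; exact: Q_points_Theta if'.
have gf : ginv (map_mx f g) = map_mx f (ginv g).
  by apply: (invpair_uniq (ginvP qf)); rewrite Pf.
have jf N (s : 'I_n -> zindex) (G : 'M[A]_n) :
    jmx N s (map_mx f G) = map_mx f (jmx N s G).
  rewrite /jmx /inc map_mxD map_mx1 !map_mxM map_mxB map_mx1.
  have -> : map_mx f (Smx A N s) = Smx B N s.
    by apply/matrixP => k l; rewrite !mxE rmorph_nat.
  have -> : map_mx f (Stmx A N s) = Stmx B N s.
    by apply/matrixP => k l; rewrite !mxE rmorph_nat.
  by [].
rewrite big_map [RHS]big_map big_map /rhoP Pf gf /Wmx !jf -map_mxM.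
have iW := Wmx_inv (n_sv (inj v)) (ginvP qg).
have [_ _ _ _ H5] := @rhoN_rep _ _ iM (sv (inj v) + n).
have := H5 A B f _ (inj v) pf (Q_points_Theta iW) U _ (bil_prj hb).
by rewrite (Theta_map _ pf) big_map.
Qed.

Lemma rhoD_rep : Q_rep rhoD.
Proof.
split; [exact: rhoD_homog|exact: rhoD_linear|exact: rhoD_one|exact: rhoD_mul|].
exact: rhoD_natural.
Qed.

Lemma rhoD_lift : Q_lifts rhoD.
Proof.
move=> A p r x a v pa aa pv U b hb.
have TI := Theta_infpt x pa; have qI := Q_points_Theta (infpt_inv p x aa).
have PI : Phi (infinitesimal_point p x a) = infpt p x a by rewrite -TI ThetaK.
have gI : ginv (infinitesimal_point p x a) = infpt p x (- a).
  rewrite -TI; apply: (invpair_uniq (ginvP qI)); rewrite ThetaK.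
  exact: infpt_inv.
have [L0 L1 D1] := Wmx_levels (n_sv (inj v)).
set m := sv (inj v) in L0 L1 D1 *.
(* The differential of g -> diag(g, 1, g^-1) at the identity. *)
pose x' := incC (m + n).+1 (@Ienum n) x - incC (m + n).+1 (tau m) x.
have WE : Wmx m (infpt p x a) (infpt p x (- a)) = infpt p x' a.
  have sub1 (X : 'M[A]_n) : 1%:M + X - 1%:M = X by rewrite addrC addKr.
  rewrite /Wmx /jmx /infpt !sub1 mulmxDl mul1mx mulmxDr mulmx1 inc_mul0 // addr0.
  rewrite -addrA; congr (_ + _).
  have E (X Y : 'M[C]_((m + n).+1)) :
    map_mx (fun c => c *: a) (X - Y) = map_mx (fun c => c *: a) X - map_mx (fun c => c *: a) Y.
    by apply/matrixP => k l; rewrite !mxE scalerBl.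
  have EN (X : 'M[C]_n) : map_mx (fun c => c *: - a) X = - map_mx (fun c => c *: a) X.
    by apply/matrixP => k l; rewrite !mxE scalerN.
  have EJ s (X : 'M[A]_n) : inc (m + n).+1 s s (JJ X) = JJ (inc (m + n).+1 s s X).
    by rewrite /inc JJ_mulr JJ_mull.
  rewrite /x' E EN -!inc_scale addrC.
  by case: (p); rewrite ?JJD ?JJN ?EJ incN ?JJN ?EJ.
rewrite /rhoD big_map /rhoP PI gI -/m WE (Theta_infpt x' pa).
have [_ pi _] := hinj; have [li _ ai] := hinj; have [lp _ ap] := hprj.
rewrite (rhoN_lift iM x' pa aa (pi _ _ pv) (bil_prj hb)) !big_cons !big_nil /= injK.
congr (_ + (b _ _ + _)); rewrite (linZ lp); congr (_ *: _).
have -> : qact (g_elt p x') (inj v) = qact (g_elt p x) (inj v).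
  rewrite /x' qact_geltB.
  have E1 := etrans (qact_incC p x (inj v) L0) (esym (qact_gelt p x (inj v))).
  have E2 : qact (g_elt p (incC (m + n).+1 (tau m) x)) (inj v) = 0.
    apply: etrans (qact_incC p x (inj v) L1) _.
    rewrite big1 // => k _; rewrite big1 // => l _.
    by rewrite killed_sv ?scaler0 //; exact: tau_ge.
  exact: etrans (congr2 (fun a b => a - b) E1 E2) (subr0 _).
by rewrite (ap _ _ (q_oo_gelt p x)) injK.
Qed.

End Retract.

(** The difficulty is that a representation of Q(n) on M is related to the Lie
    superalgebra, hence to the projection onto D, at infinitesimal points only.
    The point diag(g, 1, g^-1) of a larger group is a product of elementary
    matrices, which act by root vectors and hence commute with the projection;
    the large annihilator condition makes the result independent of the place
    of g^-1. *)
Lemma integrable_retract (C : numClosedFieldType) (M D : qmod C) (inj : D -> M)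
    (prj : M -> D) : integrable M -> LA M -> is_qhom inj -> is_qhom prj ->
  cancel inj prj -> integrable D.
Proof.
move=> iM laM hi hp K n n0.
exists (fun A => rhoD (n := n) iM inj prj (A := A)); split.
  exact: rhoD_rep.
exact: rhoD_lift.
Qed.

Lemma sgT (C : numClosedFieldType) : sg C true = -1. Proof. by []. Qed.
Lemma sgF (C : numClosedFieldType) : sg C false = 1. Proof. by []. Qed.
Local Opaque gact sg.

(** * Root vectors and sl(2) *)

Section Sl2.
Variables (C : numClosedFieldType) (U : lmodType C) (e f h : U -> U).
Hypotheses (le : linear e) (lf : linear f).
Hypothesis ef : forall u, e (f u) = f (e u) + h u.
Hypothesis hf : forall u, h (f u) = f (h u) - 2%:R *: f u.

Lemma sl2_hf k u : h (iter k f u) = iter k f (h u) - (2 * k)%:R *: iter k f u.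
Proof.
elim: k => [|k IH]; first by rewrite muln0 scale0r subr0.
rewrite !iterS hf IH (linB lf) (linZ lf) -addrA -opprD -scalerDl -natrD.
by rewrite mulnS addnC.
Qed.

Lemma sl2_ef k u : e u = 0 ->
  e (iter k.+1 f u) = k.+1%:R *: (iter k f (h u - k%:R *: u)).
Proof.
move=> eu; elim: k => [|k IH].
  by rewrite /= ef eu (lin0 lf) add0r scale0r subr0 scale1r.
rewrite iterS ef IH sl2_hf (linZ lf) -iterS.
have lk := lin_iter k.+1 lf; rewrite !(linB lk) !(linZ lk) !scalerBr !scalerA.
set x := iter k.+1 f (h u); set y := iter k.+1 f u.
rewrite addrACA -opprD -{2}[x]scale1r -!scalerDl; congr (_ *: _ - _ *: _).
  by rewrite -[k.+2]addn1 natrD.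
by rewrite -!natrM -natrD; congr (_%:R); lia.
Qed.

Lemma sl2_zero r u : e u = 0 -> h u = 0 -> iter r.+1 f u = 0 -> f u = 0.
Proof.
move=> eu hu; elim: r => [//|r IH] fr; apply: IH.
have := sl2_ef r.+1 eu; rewrite fr (lin0 le) hu sub0r (linN (lin_iter _ lf)).
rewrite (linZ (lin_iter _ lf)) scalerN scalerA => /esym/eqP.
by rewrite oppr_eq0 scaler_eq0 mulf_eq0 !pnatr_eq0 => /eqP.
Qed.

(** If f^(r+1) kills u then so does f^r (h - r), because e f^(r+1) u is a nonzero
    multiple of f^r (h - r) u; induction on r. *)
Lemma sl2_eigen (Q : U -> Prop) r u : (forall c v, Q v -> Q (h v - c *: v)) ->
  (forall v, Q v -> e v = 0) -> Q u -> u != 0 -> iter r f u = 0 ->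
  exists v n, [/\ Q v, v != 0 & h v = n%:R *: v].
Proof.
move=> Qh Qe; elim: r u => [|r IH] u Qu u0 fr; first by case/eqP: u0.
have := sl2_ef r (Qe _ Qu); rewrite fr (lin0 le) => /esym/eqP.
rewrite scaler_eq0 pnatr_eq0 /= => /eqP fr'.
have [E|E] := eqVneq (h u - r%:R *: u) 0.
  by exists u, r; split=> //; apply/eqP; rewrite -subr_eq0 E.
exact: IH (Qh _ _ Qu) E fr'.
Qed.

Lemma sl2_nat r u c : e u = 0 -> u != 0 -> iter r f u = 0 -> h u = c *: u ->
  exists n : nat, c = n%:R.
Proof.
move=> eu u0; elim: r => [|r IH] fr hu; first by case/eqP: u0.
have := sl2_ef r eu; rewrite fr (lin0 le) => /esym/eqP.
rewrite scaler_eq0 pnatr_eq0 /= hu -scalerBl (linZ (lin_iter _ lf)).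
rewrite scaler_eq0 subr_eq0 => /orP[/eqP ->|/eqP E]; [by exists r|exact: IH].
Qed.

End Sl2.

Section RootVectors.
Variables (C : numClosedFieldType) (S : qmod C).
Hypotheses (laS : LA S) (nS : loc_nilp S).

Local Notation X p i j := (@gact C S p i j).
Let lX p i j : linear (X p i j) := @gact_lin C S p i j.

Lemma weight_lo p i j u : i != j ->
  X false i i (X p j i u) = X p j i (X false i i u) - X p j i u.
Proof.
move=> ij; have := weight_gact p j i i u.
by rewrite (ifN_eq _ _ ij) (ifT _ _ (eqxx i)) addr0.
Qed.

Lemma weight_hi p i j u : i != j ->
  X false j j (X p j i u) = X p j i (X false j j u) + X p j i u.
Proof.
move=> ij; have := weight_gact p j i j u.
by rewrite (ifT _ _ (eqxx j)) (ifN_eqC _ _ ij) subr0.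
Qed.

Lemma weight_zero p i j k u : k != i -> k != j ->
  X false k k (X p i j u) = X p i j (X false k k u).
Proof.
move=> ki kj; have := weight_gact p i j k u.
by rewrite (ifN_eq _ _ ki) (ifN_eq _ _ kj) addr0 subr0.
Qed.

Lemma weight_diag p i k u : X false k k (X p i i u) = X p i i (X false k k u).
Proof. by have := weight_gact p i i k u; rewrite addrK. Qed.

Lemma root_bracket p q i j u :
  X p i j (X q j i u) = sg C (p && q) *: X q j i (X p i j u)
    + X (p (+) q) i i u - sg C (p && q) *: X (p (+) q) j j u.
Proof.
by have := gact_comm p q i j j i u; rewrite (ifT _ _ (eqxx j)) (ifT _ _ (eqxx i)).
Qed.

Lemma chain_bracket p q i j k u : k != i ->
  X p i j (X q j k u) = sg C (p && q) *: X q j k (X p i j u) + X (p (+) q) i k u.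
Proof.
move=> ki; have := gact_comm p q i j j k u.
by rewrite (ifT _ _ (eqxx j)) (ifN_eq _ _ ki) subr0.
Qed.

Lemma sg0E b (u : S) : sg C (false && b) *: u = u.
Proof. by rewrite andFb sgF scale1r. Qed.

Lemma sg0Er b (u : S) : sg C (b && false) *: u = u.
Proof. by rewrite andbF sgF scale1r. Qed.

Lemma X_sl2_ef i j u :
  X false i j (X false j i u) = X false j i (X false i j u) + (X false i i u - X false j j u).
Proof. by rewrite (root_bracket false false i j u) !sg0E addrA. Qed.

Lemma X_sl2_hf i j u : i != j ->
  X false i i (X false j i u) - X false j j (X false j i u)
  = X false j i (X false i i u - X false j j u) - 2%:R *: X false j i u.
Proof.
move=> ij; rewrite (weight_lo _ _ ij) (weight_hi _ _ ij) (linB (lX _ _ _)).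
by rewrite scaler_nat mulr2n !opprD -!addrA; congr (_ + _); rewrite addrCA.
Qed.

(** The difference is the weight of a vector that the raising operator of an
    sl(2) kills.  When it vanishes the lowering operator kills the vector, hence
    so do its odd partner and the bracket of the odd root vectors, which is the
    sum of the two weights. *)
Lemma strict_weights i j u (x y : C) : i != j -> u != 0 ->
  (forall p, X p i j u = 0) -> X false i i u = x *: u -> X false j j u = y *: u ->
  exists n : nat, x - y = n%:R /\ (n = 0%N -> x = 0 /\ y = 0).
Proof.
move=> ij u0 eu hi hj; have ji : j != i by rewrite eq_sym.
have [r fr] := nS u ji.
have hu : X false i i u - X false j j u = (x - y) *: u by rewrite hi hj scalerBl.
have ef := X_sl2_ef i j; have hf := fun v => X_sl2_hf v ij.
have [n nE] := sl2_nat (lX _ _ _) (lX _ _ _) ef hf (eu false) u0 fr hu.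
exists n; split=> // n0; rewrite n0 in nE.
have xy : x = y by apply/eqP; rewrite -subr_eq0 nE.
have zero v : X false i j v = 0 -> X false i i v = x *: v -> X false j j v = y *: v ->
    X false j i v = 0.
  move=> ev hiv hjv; have [r' fr'] := nS v ji.
  apply: (sl2_zero (r := r') (lX _ _ _) (lX _ _ _) ef hf) => //.
    by rewrite hiv hjv xy subrr.
  by rewrite iterS fr' (lin0 (lX _ _ _)).
have f0 : X false j i u = 0 by exact: zero.
pose v := X true i i u.
have v0 : X false j i v = 0.
  apply: zero.
  - have := gact_comm false true i j i i u.
    rewrite (ifN_eqC _ _ ij) (ifT _ _ (eqxx i)) !eu (lin0 (lX _ _ _)) scaler0.
    by rewrite addr0 subrr.
  - by rewrite /v weight_diag hi (linZ (lX _ _ _)).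
  - by rewrite /v (weight_zero _ _ ji ji) hj (linZ (lX _ _ _)).
have f1 : X true j i u = 0.
  have := gact_comm false true j i i i u.
  rewrite -/v v0 f0 (lin0 (lX _ _ _)) scaler0 (ifT _ _ (eqxx i)) (ifN_eq _ _ ij).
  by rewrite add0r subr0 => <-.
have := root_bracket true true i j u.
rewrite f1 eu !(lin0 (lX _ _ _)) andbT sgT scaler0 add0r scaleN1r opprK hi hj.
rewrite -scalerDl xy -mulr2n => /esym/eqP.
by rewrite scaler_eq0 (negbTE u0) orbF mulrn_eq0 /= => /eqP.
Qed.

End RootVectors.

Local Opaque gact sg.

(** * Clearing the root vectors of one index after the other *)

Lemma nilp_kernel (C : numClosedFieldType) (U : lmodType C) (f : U -> U) (R : U -> Prop) k v :
  (forall u, R u -> R (f u)) -> R v -> v != 0 -> iter k f v = 0 ->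
  exists u, [/\ R u, u != 0 & f u = 0].
Proof.
move=> Rf; elim: k v => [|k IH] v Rv v0 E; first by case/eqP: v0.
have [fv|fv] := eqVneq (f v) 0; first by exists v.
by apply: (IH (f v)) => //; [exact: Rf|rewrite -iterSr].
Qed.

(** The operators are nilpotent and an operator that kills a vector goes on
    killing it after the others are applied, so they can be treated one by one:
    the last nonzero power of each one is taken. *)
Lemma kill_list (C : numClosedFieldType) (U : lmodType C) (T : eqType) (f : T -> U -> U)
    (ts : seq T) (R : U -> Prop) v :
  (forall t u, t \in ts -> R u -> R (f t u)) ->
  (forall t u, t \in ts -> exists k, iter k (f t) u = 0) ->
  (forall t t' u, t \in ts -> t' \in ts -> f t u = 0 -> f t (f t' u) = 0) ->
  R v -> v != 0 ->
  exists u, [/\ R u, u != 0 & forall t, t \in ts -> f t u = 0].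
Proof.
move=> + + + Rv v0; elim: ts => [|t ts IH] Rf nf cf; first by exists v.
have sub x : x \in ts -> x \in t :: ts by move=> xt; rewrite inE xt orbT.
have tt : t \in t :: ts by exact: mem_head.
have [u [Ru u0 uk]] := IH (fun x w xt => Rf x w (sub x xt))
  (fun x w xt => nf x w (sub x xt))
  (fun x y w xt yt => cf x y w (sub x xt) (sub y yt)).
have [k fk] := nf t u tt.
pose R' w := R w /\ forall x, x \in ts -> f x w = 0.
have R'f w : R' w -> R' (f t w).
  move=> [Rw wk]; split; first exact: Rf.
  by move=> x xs; apply: cf => //; [exact: sub|exact: wk].
have [w [[Rw wk] w0 fw]] := nilp_kernel R'f (conj Ru uk) u0 fk.
exists w; split=> // x; rewrite inE => /orP[/eqP -> //|]; exact: wk.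
Qed.

Section Stage.
Variables (C : numClosedFieldType) (S : qmod C).
Hypotheses (nS : loc_nilp S).

Local Notation X p i j := (@gact C S p i j).
Let lX p i j : linear (X p i j) := @gact_lin C S p i j.

Lemma gact_com0 p q i j k l u : j != k -> l != i -> X p i j u = 0 ->
  X p i j (X q k l u) = 0.
Proof.
move=> jk li e; have := gact_comm0 p q u jk li.
by rewrite e (lin0 (lX _ _ _)) scaler0.
Qed.

(** What has been achieved after s stages. *)
Definition cleared s (v : S) : Prop :=
  forall p i j, prec i j -> (rk i < s)%N || (rk j < s)%N -> X p i j v = 0.

(** For even s the index of rank s precedes all the indices of larger rank, for
    odd s it follows them: these are the positive root vectors between it and
    the later indices.  They supercommute. *)
Definition letter s p (j : zindex) : S -> S :=
  if odd s then X p j (unrk s) else X p (unrk s) j.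

(** The root vectors that move the free end of a letter from j to k. *)
Definition coletter s q k j : S -> S := if odd s then X q k j else X q j k.

Lemma rk_neq i j : (rk i < rk j)%N -> i != j.
Proof. by apply: contraTneq => ->; rewrite ltnn. Qed.

Lemma unrk_neq s j : (s < rk j)%N -> unrk s != j.
Proof. by move=> sj; apply: rk_neq; rewrite unrkK. Qed.

Lemma neq_unrk s j : (s < rk j)%N -> j != unrk s.
Proof. by move=> sj; have := unrk_neq sj; rewrite eq_sym. Qed.

Lemma letter_com0 s p q j k u : (s < rk j)%N -> (s < rk k)%N ->
  letter s p j u = 0 -> letter s p j (letter s q k u) = 0.
Proof.
move=> lj lk; have sj := unrk_neq lj; have sk := unrk_neq lk.
have sj' := neq_unrk lj; have sk' := neq_unrk lk; rewrite /letter; case: (odd s) => /= e.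
  exact: (gact_com0 q sk sj e).
exact: (gact_com0 q sj' sk' e).
Qed.

Lemma letter_comE s p j k u : (s < rk j)%N -> (s < rk k)%N ->
  letter s false j (letter s p k u) = letter s p k (letter s false j u).
Proof.
move=> lj lk; have sj := unrk_neq lj; have sk := unrk_neq lk.
have sj' := neq_unrk lj; have sk' := neq_unrk lk; rewrite /letter; case: (odd s).
  by rewrite (gact_comm0 false p u sk sj) sg0E.
by rewrite (gact_comm0 false p u sj' sk') sg0E.
Qed.

Lemma letter_lin s p j : linear (letter s p j).
Proof. by rewrite /letter; case: (odd s); exact: lX. Qed.

Lemma coletter_lin s p k j : linear (coletter s p k j).
Proof. by rewrite /coletter; case: (odd s); exact: lX. Qed.

Lemma letter_nilp s p j u : (s < rk j)%N -> exists k, iter k (letter s p j) u = 0.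
Proof.
move=> sj; have sj0 := unrk_neq sj; case: p; last first.
  have js := neq_unrk sj.
  by rewrite /letter; case: (odd s); [exact: (nS u js)|exact: (nS u sj0)].
exists 2%N; rewrite /= /letter.
have sq i k (w : S) : i != k -> X true i k (X true i k w) = 0.
  move=> ik; have ki : k != i by rewrite eq_sym.
  have := gact_comm0 true true w ki ki; rewrite andbT sgT scaleN1r => /eqP.
  by rewrite -addr_eq0 -mulr2n -scaler_nat scaler_eq0 pnatr_eq0 => /eqP.
have js := neq_unrk sj.
by case: (odd s); [exact: (sq _ _ u js)|exact: (sq _ _ u sj0)].
Qed.

Lemma coletter_letter s q k j u : (s < rk k)%N ->
  coletter s q k j (letter s false j u)
  = letter s false j (coletter s q k j u) + sg C (~~ odd s) *: letter s q k u.
Proof.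
move=> /unrk_neq sk; rewrite /coletter /letter; case: (odd s) => /=.
  by rewrite (chain_bracket q false j u sk) addbF sg0Er sgF scale1r.
have := gact_comm q false j k (unrk s) j u.
by rewrite (ifN_eqC _ _ sk) (ifT _ _ (eqxx j)) addbF addr0 !sg0Er sgT scaleN1r.
Qed.

Lemma coletter_iter s q k j u m : (s < rk k)%N -> (s < rk j)%N ->
  coletter s q k j u = 0 ->
  coletter s q k j (iter m.+1 (letter s false j) u)
  = (sg C (~~ odd s) * m.+1%:R) *: letter s q k (iter m (letter s false j) u).
Proof.
move=> sk sj zu; elim: m => [|m IH].
  by rewrite coletter_letter // zu (lin0 (letter_lin _ _ _)) add0r mulr1.
rewrite iterS coletter_letter // IH (linZ (letter_lin _ _ _)) letter_comE //.
by rewrite -iterS -scalerDl -[m.+2]addn1 natrD mulrDr mulr1.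
Qed.

Lemma letter_coletter s p q k k' j u : k' != j -> (s < rk k)%N ->
  letter s q k' (coletter s p k j u) = sg C (q && p) *: coletter s p k j (letter s q k' u).
Proof.
move=> kj lk; have sk := unrk_neq lk; have ks := neq_unrk lk.
have jk : j != k' by rewrite eq_sym.
rewrite /coletter /letter; case: (odd s) => /=.
  exact: (gact_comm0 q p u sk jk).
exact: (gact_comm0 q p u kj ks).
Qed.

Definition word s (w : seq (bool * zindex)) (v : S) : S :=
  foldl (fun u x => letter s x.1 x.2 u) v w.

Lemma word_lin s w : linear (word s w).
Proof.
rewrite /word; elim: w => [//|x w IH] a u v /=.
by rewrite letter_lin IH.
Qed.

Lemma word_coletter s p k j w : (s < rk k)%N -> (forall x, x \in w -> x.2 != j) ->
  exists b, forall u, word s w (coletter s p k j u) = sg C b *: coletter s p k j (word s w u).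
Proof.
move=> sk; elim: w => [|x w IH] wj; first by exists false => u; rewrite sgF scale1r.
have [|b E] := IH; first by move=> y yw; apply: wj; rewrite inE yw orbT.
have xj : x.2 != j by apply: wj; exact: mem_head.
exists (b (+) (x.1 && p)) => u /=.
have := letter_coletter p x.1 u xj sk => ->.
rewrite (linZ (word_lin _ _)) E scalerA; congr (_ *: _).
rewrite mulrC; case: b {E}; case: (x.1 && p); rewrite ?sgT ?sgF //=;
  by rewrite ?mulN1r ?mulr1 ?mulrN1 ?opprK.
Qed.

(** Let Y be the letter to the index M.  Bracketing Y^r v = 0 with root vectors
    that kill v moves the ends of the r factors one after the other from M to
    the far indices. *)
Lemma word_kill s M r v w : (s < M)%N -> killed M v ->
  iter r (letter s false (unrk M)) v = 0 ->
  (forall x, x \in w -> (M < rk x.2)%N) -> (size w <= r)%N ->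
  word s w (iter (r - size w) (letter s false (unrk M)) v) = 0.
Proof.
move=> sM kv fr; elim: w => [|x w IH] wM sw; first by rewrite subn0.
have {}IH : word s w (iter (r - size w) (letter s false (unrk M)) v) = 0.
  by apply: IH; [move=> y yw; apply: wM; rewrite inE yw orbT|exact: ltnW].
have xM : (M < rk x.2)%N by apply: wM; exact: mem_head.
have sx : (s < rk x.2)%N := ltn_trans sM xM.
have sM' : (s < rk (unrk M))%N by rewrite unrkK.
have [|b E] := @word_coletter s x.1 x.2 (unrk M) w sx.
  move=> y yw; apply/negP => /eqP Ey.
  have := wM y; rewrite inE yw orbT Ey unrkK ltnn => /(_ isT); done.
have zv : coletter s x.1 x.2 (unrk M) v = 0.
  by rewrite /coletter; case: (odd s); apply: kv; rewrite ?unrkK // ltnW.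
have := E (iter (r - size w) (letter s false (unrk M)) v).
rewrite IH (lin0 (coletter_lin _ _ _ _)) scaler0 /=.
have -> : (r - size w = (r - (size w).+1).+1)%N by move: sw => /=; lia.
rewrite (coletter_iter _ sx sM' zv) (linZ (word_lin _ _)) => /eqP.
rewrite scaler_eq0 mulf_eq0 pnatr_eq0 orbF => /orP[|/eqP //].
by case: (odd s); rewrite ?sgT ?sgF ?oppr_eq0 oner_eq0.
Qed.

(** The bracket of a letter with a positive root vector through an earlier index
    is again a positive root vector through that index. *)
Lemma cleared_letter s p j v : (s < rk j)%N -> cleared s v -> cleared s (letter s p j v).
Proof.
move=> sj cv q i k; rewrite precE => ik mk.
have K0 (b : bool) (w : S) : (b -> w = 0) -> (if b then w else 0) = 0.
  by case: b => // /(_ isT).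
have Z r i' k' : (if odd (rk i') then odd (rk k') && (rk k' < rk i')
    else odd (rk k') || (rk i' < rk k'))%N ->
    (rk i' < s)%N || (rk k' < s)%N -> X r i' k' v = 0.
  by rewrite -precE; exact: cv.
rewrite /letter; have [os|es] := boolP (odd s).
  have := gact_comm q p i k j (unrk s) v.
  rewrite (Z q i k ik mk) (lin0 (lX _ _ _)) scaler0 add0r => ->.
  rewrite K0 => [|/eqP kj]; last first.
    by apply: Z; rewrite unrkK; move: ik mk; rewrite kj; case: (odd (rk i)); lia.
  rewrite K0 ?subr0 // => /eqP si.
  rewrite Z ?scaler0 //; move: ik mk; rewrite -si unrkK os; first by case: (odd (rk j)); lia.
  by lia.
have := gact_comm q p i k (unrk s) j v.
rewrite (Z q i k ik mk) (lin0 (lX _ _ _)) scaler0 add0r => ->.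
rewrite K0 => [|/eqP ks]; last first.
  apply: Z; move: ik mk; rewrite ks unrkK (negbTE es) /=; last by lia.
  by case: (odd (rk i)) => //=; lia.
rewrite K0 ?subr0 // => /eqP ji.
rewrite Z ?scaler0 // ?unrkK ?(negbTE es); move: ik mk; rewrite -ji; last by lia.
by case: (odd (rk j)); case: (odd (rk k)) => //=; lia.
Qed.

Lemma cleared_succ s v : cleared s v -> (forall p j, (s < rk j)%N -> letter s p j v = 0) ->
  cleared s.+1 v.
Proof.
move=> cv lv p i j ij mk.
have [lo|hi] := boolP ((rk i < s)%N || (rk j < s)%N); first exact: cv.
have si : (s <= rk i)%N by lia.
have sj : (s <= rk j)%N by lia.
move: ij; rewrite precE; have [E ij|ri] := eqVneq (rk i) s.
  have lj : (s < rk j)%N.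
    rewrite ltn_neqAle sj andbT; apply/negP => /eqP Ej.
    by move: ij; rewrite E -Ej ltnn; case: (odd s).
  have iE : unrk s = i by rewrite -E rkK.
  have := lv p j lj; rewrite /letter iE; move: ij; rewrite E; case: (odd s) => [|_ //].
  by move=> /andP[_]; lia.
have E : rk j = s by lia.
have li : (s < rk i)%N by lia.
have jE : unrk s = j by rewrite -E rkK.
move=> ij; have os : odd s.
  by move: ij; rewrite E; case: (odd s) => //; case: (odd (rk i)) => //=; lia.
by have := lv p i li; rewrite /letter jE os.
Qed.

(** A nonzero product of letters of maximal length is killed by all letters. *)
Lemma far_letters s M (R : S -> Prop) n v : (s < M)%N ->
  (forall p j u, (s < rk j)%N -> R u -> R (letter s p j u)) ->
  (forall w, (forall x, x \in w -> (M < rk x.2)%N) -> size w = n -> word s w v = 0) ->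
  R v -> v != 0 ->
  exists u, [/\ R u, u != 0 & forall p j, (M < rk j)%N -> letter s p j u = 0].
Proof.
move=> sM RL; elim: n v => [|n IH] v wv Rv v0.
  by case/eqP: v0; apply: (wv [::]).
have [all0|/existsNP[p /existsNP[j /not_implyP[Mj /eqP l0]]]] :=
  pselect (forall p j, (M < rk j)%N -> letter s p j v = 0); first by exists v.
apply: (IH (letter s p j v)) => //.
  move=> w wM sw; apply: (wv ((p, j) :: w)); last by rewrite /= sw.
  by move=> x; rewrite inE => /orP[/eqP -> //|]; exact: wM.
by apply: RL => //; exact: ltn_trans Mj.
Qed.

(** Infinitely many letters have to be killed.  Those to far indices are disposed
    of together, by the bound on the length of their nonzero products; the
    finitely many others are killed one by one. *)
Lemma stage s (R : S -> Prop) v : LA S ->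
  (forall p j u, (s < rk j)%N -> R u -> R (letter s p j u)) ->
  R v -> cleared s v -> v != 0 ->
  exists u, [/\ R u, cleared s.+1 u & u != 0].
Proof.
move=> la RL Rv cv v0; have [n kn] := la v.
pose M := maxn n s.+1.
have sM : (s < M)%N by rewrite /M; lia.
have kv : killed M v by apply: killed_leq kn; rewrite /M; lia.
have [r fr] : exists r, iter r (letter s false (unrk M)) v = 0.
  by apply: letter_nilp; rewrite unrkK.
pose R1 u := R u /\ cleared s u.
have R1L p j u : (s < rk j)%N -> R1 u -> R1 (letter s p j u).
  by move=> sj [Ru cu]; split; [exact: RL|exact: cleared_letter].
have wv w : (forall x, x \in w -> (M < rk x.2)%N) -> size w = r -> word s w v = 0.
  by move=> wM sw; have := word_kill sM kv fr wM; rewrite sw subnn; apply.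
have [u [R1u u0 uM]] := far_letters sM R1L wv (conj Rv cv) v0.
pose R2 w := R1 w /\ forall p j, (M < rk j)%N -> letter s p j w = 0.
pose ts := [seq (p, unrk r) | p <- [:: true; false], r <- iota s.+1 (M - s)].
have tsP t : t \in ts -> (s < rk t.2)%N.
  by move=> /allpairsP[[p k] [_ kr ->]]; rewrite /= unrkK; move: kr; rewrite mem_iota /=; lia.
have [|||//|//|w [[[Rw cw] wM] w0 wt]] :=
  @kill_list C S _ (fun t => letter s t.1 t.2) ts R2 u.
- move=> t w ts' [R1w wM]; split; first exact: R1L (tsP _ ts') R1w.
  by move=> p j Mj; apply: letter_com0 (wM _ _ Mj); [exact: ltn_trans Mj|exact: tsP].
- by move=> t w ts'; apply: letter_nilp; exact: tsP.
- by move=> t t' w /tsP H /tsP H'; exact: letter_com0.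
exists w; split=> //; apply: cleared_succ => // p j sj.
have [Mj|jM] := ltnP M (rk j); first exact: wM.
apply: (wt (p, j)); apply/allpairsP; exists (p, rk j); split.
- by case: (p).
- by rewrite mem_iota /=; lia.
- by rewrite rkK.
Qed.

End Stage.

(** * Existence of highest weight vectors *)

Section HighestWeight.
Variables (C : numClosedFieldType) (S : qmod C).
Hypotheses (laS : LA S) (nS : loc_nilp S).

Local Notation X p i j := (@gact C S p i j).
Let lX p i j : linear (X p i j) := @gact_lin C S p i j.

(** A filtration by c_N-submodules.  It is preserved by the stages s >= N, whose
    letters belong to c_N, and bounds the number of nonzero weights. *)
Inductive reach N : nat -> S -> Prop :=
| reach_killed L v : killed N v -> reach N L v
| reach_gact L p i j v : reach N L v -> reach N L.+1 (X p i j v)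
| reach_lin L a u v : reach N L u -> reach N L v -> reach N L (a *: u + v).

Lemma killed0 N : killed N (0 : S).
Proof. by move=> p i j _ _; exact: lin0 (lX _ _ _). Qed.

Lemma reach0 N L : reach N L 0.
Proof. exact: reach_killed (@killed0 N). Qed.

Lemma reachZ N L a v : reach N L v -> reach N L (a *: v).
Proof. by move=> rv; rewrite -[_ *: _]addr0; apply: reach_lin => //; exact: reach0. Qed.

Lemma reachD N L u v : reach N L u -> reach N L v -> reach N L (u + v).
Proof. by move=> ru rv; rewrite -[u]scale1r; exact: reach_lin. Qed.

Lemma reach_if N L (b : bool) v : reach N L v -> reach N L (if b then v else 0).
Proof. by case: b => // _; exact: reach0. Qed.

Lemma reach_c N L p i j v : (N <= rk i)%N -> (N <= rk j)%N ->
  reach N L v -> reach N L (X p i j v).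
Proof.
move=> ni nj rv; elim: rv p i j ni nj => {L v} [L v kv|L q k l v rv IH|L a u v _ IHu _ IHv] p i j ni nj.
- by rewrite kv //; exact: reach0.
- have := gact_comm p q i j k l v => ->.
  apply: reachD; first apply: reachD.
  + by apply: reachZ; apply: reach_gact; exact: IH.
  + by apply: reach_if; exact: reach_gact.
  rewrite -scaleN1r; apply: reachZ; apply: reach_if; apply: reachZ.
  exact: reach_gact.
- by rewrite lX; apply: reach_lin; [exact: IHu|exact: IHv].
Qed.

Definition shifted_weights (c : zindex -> C) (ts : seq zindex) (v : S) : S :=
  foldr (fun t u => X false t t u + c t *: u) v ts.

Lemma shifted_weights_lin c ts : linear (shifted_weights c ts).
Proof.
elim: ts => [//|t ts IH] a u v; rewrite /= IH (lX _ _ _ a) scalerDr !scalerDr.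
by rewrite !scalerA [c t * a]mulrC addrACA.
Qed.

Lemma shifted_weights_eigen c x ts v : (forall t, t \in ts -> X false t t v = x t *: v) ->
  shifted_weights c ts v = (\prod_(t <- ts) (x t + c t)) *: v.
Proof.
elim: ts => [|t ts IH] xv; first by rewrite big_nil scale1r.
rewrite /= IH => [|k kt]; last by apply: xv; rewrite inE kt orbT.
rewrite big_cons (linZ (lX _ _ _)) xv ?mem_head // !scalerA -scalerDl.
by congr (_ *: _); rewrite mulrDl [x t * _]mulrC.
Qed.

Definition dlt (t i : zindex) : C := (t == i)%:R.

Lemma shifted_weights_gact c ts p i j v :
  shifted_weights c ts (X p i j v)
  = X p i j (shifted_weights (fun t => c t + (dlt t i - dlt t j)) ts v).
Proof.
elim: ts => [//|t ts IH] /=; rewrite {}IH; set w := shifted_weights _ ts v.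
have dE k : (if t == k then X p i j w else 0) = dlt t k *: X p i j w.
  by rewrite /dlt; case: (t == k); rewrite ?scale1r ?scale0r.
have := weight_gact p i j t w; rewrite (dE i) (dE j) => ->.
rewrite (linD (lX _ _ _)) (linZ (lX _ _ _)) -!addrA; congr (_ + _).
by rewrite !scalerDl scaleNr addrA addrC.
Qed.

(** Every basis element shifts at most two weights, so that L of them make at
    most 2 L weights nonzero; the shifts c make the induction work. *)
Lemma reach_weights N L v c ts : reach N L v -> uniq ts ->
  (forall t, t \in ts -> (N <= rk t)%N) ->
  (2 * L < count (fun t => c t == 0%R) ts)%N -> shifted_weights c ts v = 0.
Proof.
move=> rv; elim: rv c ts => {L v} [L v kv|L p i j v _ IH|L a u v _ IHu _ IHv] c ts us nts ct.
- rewrite (@shifted_weights_eigen c (fun=> 0)) => [|t tt]; last first.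
    by rewrite kv ?scale0r //; exact: nts.
  have /hasP[t tt /eqP c0] : has (fun t => c t == 0) ts.
    by rewrite has_count; apply: leq_ltn_trans ct.
  by rewrite (big_rem t) //= c0 addr0 mul0r scale0r.
- pose c' t := c t + (dlt t i - dlt t j).
  rewrite shifted_weights_gact (IH c' ts us nts) ?(lin0 (lX _ _ _)) //.
  have le : (count (fun t => c t == 0%R) ts
      <= count (fun t => c' t == 0%R) ts + (count_mem i ts + count_mem j ts))%N.
    have h t (a b : bool) : ((c t == 0%R) <= (c t + (a%:R - b%:R) == 0)%R + (a + b))%N.
      case: a; case: b; rewrite ?subrr ?addr0 ?leq_addr //;
        exact: leq_trans (leq_b1 _) (leq_addl _ _).
    elim: ts {us nts ct} => [//|t ts IHt] /=.
    have arith (a b x y b' x' y' a' : nat) : (a <= b + (x + y))%N ->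
      (a' <= b' + (x' + y'))%N -> (a + a' <= b + b' + (x + x' + (y + y')))%N by lia.
    exact: arith (h t (t == i) (t == j)) IHt.
  have one k : (count_mem k ts <= 1)%N by rewrite (count_uniq_mem k us) leq_b1.
  have arith (a b x y : nat) : (a <= b + (x + y))%N -> (x <= 1)%N -> (y <= 1)%N ->
    (2 * L.+1 < a)%N -> (2 * L < b)%N by lia.
  exact: arith le (one i) (one j) ct.
- by rewrite shifted_weights_lin IHu // IHv // scaler0 addr0.
Qed.

(** The bracket of a weight operator with a root vector is a multiple of the root
    vector. *)
Lemma weight_kill p i j t v : X p i j v = 0 -> X p i j (X false t t v) = 0.
Proof.
move=> e; have := weight_gact p i j t v; rewrite e !if_same (lin0 (lX _ _ _)).
by rewrite addr0 subr0 => <-.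
Qed.

Definition weight_sign (t : zindex) : C := sg C (odd (rk t)).

(** For a far index j the weight operator of j vanishes on the vectors
    considered, so that the weight operator of t is, up to sign, the one of the
    sl(2) of t and j. *)
Lemma eigen_list s (R : S -> Prop) (ts : seq zindex) u :
  (forall a u v, R u -> R v -> R (a *: u + v)) ->
  (forall t v, t \in ts -> R v -> R (X false t t v)) ->
  (forall v, R v -> cleared s v) -> (forall t, t \in ts -> (rk t < s)%N) ->
  R u -> u != 0 ->
  exists v, [/\ R v, v != 0 & forall t, t \in ts ->
    exists n : nat, X false t t v = (weight_sign t * n%:R) *: v].
Proof.
move=> Rl + Rc + Ru u0; elim: ts => [|t ts IH] Rh Rs; first by exists u.
have sub x : x \in ts -> x \in t :: ts by move=> xt; rewrite inE xt orbT.
have tt : t \in t :: ts by exact: mem_head.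
have [v [Rv v0 ev]] := IH (fun x w xt => Rh x w (sub x xt)) (fun x xt => Rs x (sub x xt)).
have [n kn] := laS v.
pose M := maxn n s; pose j := unrk M.
have tM : (rk t < rk j)%N by rewrite unrkK /M; have := Rs t tt; lia.
pose Q w := [/\ R w, killed M w & forall x, x \in ts ->
    exists n : nat, X false x x w = (weight_sign x * n%:R) *: w].
have tj : t != j := rk_neq tM; have jt : j != t by rewrite eq_sym.
have Qcl w a c : Q w -> Q (a *: X false t t w + c *: w).
  move=> [Rw kw ew]; split.
  - apply: (Rl); first exact: Rh.
    have R0 : R 0 by have := Rl (-1) _ _ Rw Rw; rewrite scaleN1r addNr.
    by rewrite -[_ *: w]addr0; exact: Rl.
  - by move=> p i k Mi Mk; rewrite lX (linZ (lX _ _ _)) weight_kill ?kw // !scaler0 addr0.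
  - move=> x xs; have [m xm] := ew x xs; exists m.
    rewrite lX (linZ (lX _ _ _)) weight_diag xm (linZ (lX _ _ _)) scalerDr !scalerA.
    by rewrite ![_ * (weight_sign _ * _)]mulrC.
have jj w : Q w -> X false j j w = 0 by case=> _ kw _; apply: kw; rewrite unrkK.
have Qv : Q v by split=> //; apply: killed_leq kn; rewrite /M; lia.
have done_ w m : Q w -> X false t t w = (weight_sign t * m%:R) *: w ->
    forall x, x \in t :: ts -> exists n : nat, X false x x w = (weight_sign x * n%:R) *: w.
  move=> [_ _ ew] em x; rewrite inE => /orP[/eqP ->|]; [by exists m|exact: ew].
have ts' : (rk t < s)%N by exact: Rs.
have [ot|et] := boolP (odd (rk t)); last first.
  have [r fr] := nS v jt.
  have e0 w : Q w -> X false t j w = 0.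
    by case=> /Rc cw _ _; apply: cw; rewrite ?ts' // precE (negbTE et) tM orbT.
  have Qh c w : Q w -> Q (X false t t w - X false j j w - c *: w).
    by move=> Qw; have := Qcl w 1 (- c) Qw; rewrite jj // subr0 scale1r scaleNr.
  have [w [m [Qw w0]]] := sl2_eigen (lX _ _ _) (lX _ _ _)
    (X_sl2_ef t j) (fun u => X_sl2_hf u tj) Qh e0 Qv v0 fr.
  rewrite jj // subr0 => hw; exists w; split=> //; first by case: Qw.
  by apply: (done_ w m) => //; rewrite /weight_sign (negbTE et) sgF mul1r.
have [r fr] := nS v tj.
have e0 w : Q w -> X false j t w = 0.
  case=> /Rc cw _ _; apply: cw; rewrite ?ts' ?orbT // precE ot tM.
  by case: (odd (rk j)).
have Qh c w : Q w -> Q (X false j j w - X false t t w - c *: w).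
  by move=> Qw; have := Qcl w (-1) (- c) Qw; rewrite jj // sub0r scaleN1r scaleNr.
have [w [m [Qw w0]]] := sl2_eigen (lX _ _ _) (lX _ _ _)
  (X_sl2_ef j t) (fun u => X_sl2_hf u jt) Qh e0 Qv v0 fr.
rewrite jj // sub0r => /(congr1 -%R); rewrite opprK => hw.
exists w; split=> //; first by case: Qw.
by apply: (done_ w m) => //; rewrite /weight_sign ot sgT mulN1r scaleNr.
Qed.

Lemma cleared_lin s a (u v : S) : cleared s u -> cleared s v -> cleared s (a *: u + v).
Proof. by move=> cu cv p i j ij mk; rewrite lX cu // cv // scaler0 addr0. Qed.

Lemma cleared_weight s t (v : S) : cleared s v -> cleared s (X false t t v).
Proof. by move=> cv p i j ij mk; apply: weight_kill; exact: cv. Qed.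

Lemma killed_weight s t (v : S) : killed s v -> killed s (X false t t v).
Proof. by move=> kv p i j ij mk; apply: weight_kill; exact: kv. Qed.

Lemma cleared_exists N (R : S -> Prop) d (v : S) :
  (forall p j s u, (N <= s)%N -> (s < rk j)%N -> R u -> R (letter s p j u)) ->
  R v -> cleared N v -> v != 0 ->
  exists u, [/\ R u, cleared (N + d) u & u != 0].
Proof.
move=> RL Rv cv v0; elim: d => [|d [u [Ru cu u0]]]; first by exists v; rewrite addn0.
rewrite addnS; apply: (stage nS laS _ Ru cu u0) => p j w lj; apply: RL => //.
exact: leq_addr.
Qed.

(** The vector has weight zero for the sl(2) of t and j, so that one of its root
    vectors kills it as soon as the other does; the odd root vectors are brackets
    with the odd diagonal element at j. *)
Lemma weight0_far M t j v : X false t t v = 0 -> killed M v -> (M <= rk j)%N -> t != j ->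
  (X false t j v = 0 -> forall p, X p j t v = 0) /\
  (X false j t v = 0 -> forall p, X p t j v = 0).
Proof.
move=> ht kv Mj tj; have jt : j != t by rewrite eq_sym.
have hj q : X q j j v = 0 by apply: kv.
split=> e0.
  have [r fr] := nS v jt.
  have f0 : X false j t v = 0.
    apply: (sl2_zero (r := r) (lX _ _ _) (lX _ _ _) (X_sl2_ef t j)
      (fun u => X_sl2_hf u tj)) => //; first by rewrite ht hj subrr.
    by rewrite iterS fr (lin0 (lX _ _ _)).
  case; last exact: f0.
  have := chain_bracket true false j v tj.
  by rewrite f0 hj !(lin0 (lX _ _ _)) scaler0 add0r => <-.
have [r fr] := nS v tj.
have f0 : X false t j v = 0.
  apply: (sl2_zero (r := r) (lX _ _ _) (lX _ _ _) (X_sl2_ef j t)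
    (fun u => X_sl2_hf u jt)) => //; first by rewrite ht hj subrr.
  by rewrite iterS fr (lin0 (lX _ _ _)).
case; last exact: f0.
have := chain_bracket false true j v jt.
by rewrite f0 hj !(lin0 (lX _ _ _)) scaler0 add0r => <-.
Qed.

(** As the weights at p and q vanish, v is killed by both root vectors between p,
    respectively q, and any far index.  All of c_s is generated by brackets of
    root vectors through p, q and far indices. *)
Lemma killed_weights0 s p q v : cleared s v ->
  (rk p < s)%N -> ~~ odd (rk p) -> X false p p v = 0 ->
  (rk q < s)%N -> odd (rk q) -> X false q q v = 0 -> killed s v.
Proof.
move=> cv ps ep hp qs oq hq; have [n kn] := laS v.
pose M := maxn n s.
have kv : killed M v by apply: killed_leq kn; rewrite /M; lia.
have sM : (s <= M)%N by rewrite /M; lia.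
have far j : (M <= rk j)%N -> (s <= rk j)%N by exact: leq_trans.
have pj j a : (s <= rk j)%N -> X a p j v = 0.
  by move=> sj; apply: cv; rewrite ?ps // precE (negbTE ep) (leq_trans ps sj) orbT.
have jq j a : (s <= rk j)%N -> X a j q v = 0.
  move=> sj; apply: cv; rewrite ?qs ?orbT // precE oq (leq_trans qs sj).
  by case: (odd (rk j)).
have jp j a : (M <= rk j)%N -> X a j p v = 0.
  move=> Mj; have pjn : p != j by apply: rk_neq; exact: leq_trans ps (far _ Mj).
  by have [H _] := weight0_far hp kv Mj pjn; apply: H; exact: pj (far _ Mj).
have qj j a : (M <= rk j)%N -> X a q j v = 0.
  move=> Mj; have qjn : q != j by apply: rk_neq; exact: leq_trans qs (far _ Mj).
  by have [_ H] := weight0_far hq kv Mj qjn; apply: H; exact: jq (far _ Mj).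
have fl j k a : (M <= rk j)%N -> (s <= rk k)%N -> k != j -> X a j k v = 0.
  move=> Mj sk kj; have := chain_bracket a false p v kj.
  rewrite (pj k false sk) (jp j a Mj) (lin0 (lX a j p)) (lin0 (lX false p k)).
  by rewrite scaler0 add0r addbF => <-.
have fr j k a : (M <= rk k)%N -> (s <= rk j)%N -> k != j -> X a j k v = 0.
  move=> Mk sj kj; have := chain_bracket false a q v kj.
  rewrite (qj k a Mk) (jq j false sj) (lin0 (lX a q k)) (lin0 (lX false j q)).
  by rewrite scaler0 add0r => <-.
move=> a i j si sj.
(* X_ij is the bracket of X_ik and X_kj for a far index k. *)
pose k := unrk (maxn M (maxn (rk i) (rk j)).+1).
have Mk : (M <= rk k)%N by rewrite unrkK; lia.
have ki : k != i by rewrite eq_sym; apply: rk_neq; rewrite unrkK; lia.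
have kj : k != j by rewrite eq_sym; apply: rk_neq; rewrite unrkK; lia.
have jk : j != k by rewrite eq_sym.
have Xik := fr i k a Mk si ki; have Xkj := fl k j false Mk sj jk.
have [ij|ij] := eqVneq j i.
  have Xki : X false k i v = 0 by rewrite -ij.
  have := root_bracket a false i k v; rewrite Xik Xki (lin0 (lX a i k)) (lin0 (lX false k i)).
  by rewrite scaler0 add0r addbF (kv a k k Mk Mk) scaler0 subr0 ij => <-.
have := chain_bracket a false k v ij.
rewrite Xik Xkj (lin0 (lX a i k)) (lin0 (lX false k j)).
by rewrite scaler0 add0r addbF => <-.
Qed.

(** The product of the weight operators kills v, and it acts on v as the product
    of the weights of v. *)
Lemma zero_weight N L v (f : nat -> zindex) : reach N L v -> injective f ->
  (forall k, (N <= rk (f k))%N) ->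
  (forall k, (k < (2 * L).+1)%N -> exists n : nat,
     X false (f k) (f k) v = (weight_sign (f k) * n%:R) *: v) -> v != 0 ->
  exists2 k, (k < (2 * L).+1)%N & X false (f k) (f k) v = 0.
Proof.
move=> rv injf Nf ev v0; pose ts := [seq f k | k <- iota 0 (2 * L).+1].
have [x xP] : exists x : nat -> C, forall k, (k < (2 * L).+1)%N ->
    X false (f k) (f k) v = x k *: v.
  pose P k (c : C) := X false (f k) (f k) v = c *: v.
  exists (fun k => xget 0 [set c | P k c]) => k /ev[n en].
  exact: (@xgetPex _ 0 [set c | P k c] (ex_intro _ _ en)).
have us : uniq ts by rewrite map_inj_uniq ?iota_uniq.
have := @reach_weights N L v (fun=> 0) ts rv us.
have -> : count (fun=> (0 : C) == 0) ts = size ts.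
  by rewrite -[RHS]count_predT; apply: eq_count => t; rewrite eqxx.
rewrite size_map size_iota => H.
have {}H : shifted_weights (fun=> 0) ts v = 0.
  by apply: H => // t /mapP[k _ ->].
have H2 : forall ks, {subset ks <= iota 0 (2 * L).+1} ->
    shifted_weights (fun=> 0) [seq f k | k <- ks] v = (\prod_(k <- ks) x k) *: v.
  elim=> [|k ks IH] kss; first by rewrite big_nil scale1r.
  rewrite /= IH => [|y yk]; last by apply: kss; rewrite inE yk orbT.
  have kL : (k < (2 * L).+1)%N.
    by have := kss k (mem_head _ _); rewrite mem_iota.
  by rewrite big_cons (linZ (lX _ _ _)) xP // scale0r addr0 scalerA mulrC.
move: H; rewrite H2 // => /eqP; rewrite scaler_eq0 (negbTE v0) orbF prodf_seq_eq0.
case/hasP=> k; rewrite mem_iota add0n => kL /eqP xk.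
by exists k => //; rewrite xP // xk scale0r.
Qed.

(** The first N stages enlarge L in an uncontrolled way, the next ones do not
    change it: enough of them provide a positive and a negative index of weight
    zero. *)
Lemma killed_cleared_exists : (exists v : S, v != 0) ->
  exists s (v : S), [/\ v != 0, cleared s v & killed s v].
Proof.
case=> u0 u0n; have [N kN] := laS u0.
have [u1 [[L rL] cu1 u1n]] : exists u, [/\ exists L, reach N L u, cleared (0 + N) u & u != 0].
  apply: (@cleared_exists 0 (fun u => exists L, reach N L u) N u0) => //.
  - move=> p j s u _ _ [L rL]; exists L.+1; rewrite /letter.
    by case: (odd s); exact: reach_gact.
  - by exists 0%N; exact: reach_killed.
(* The indices of rank 2 (N + k) and 2 (N + k) + 1 with k <= 2 L have rank at
   least N and less than N + d. *)
pose d := (N + 4 * L + 4)%N; rewrite add0n in cu1.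
have RL p j s u : (N <= s)%N -> (s < rk j)%N -> reach N L u -> reach N L (letter s p j u).
  move=> Ns sj ru; have Nj : (N <= rk j)%N := leq_trans Ns (ltnW sj).
  by rewrite /letter; case: (odd s); apply: reach_c; rewrite ?unrkK.
have [u2 [rL2 cu2 u2n]] := cleared_exists d RL rL cu1 u1n.
set s := (N + d)%N in cu2.
pose ts := [seq unrk k | k <- iota N d].
have tsP t : t \in ts -> (N <= rk t < s)%N.
  by move=> /mapP[k kd ->]; rewrite unrkK; move: kd; rewrite mem_iota.
have [||||||v [[rv cv] v0 ev]] := @eigen_list s (fun u : S => reach N L u /\ cleared s u) ts u2.
- move=> a u w [ru cu] [rw cw].
  by split; [exact: reach_lin|exact: cleared_lin].
- move=> t w /tsP /andP[Nt _] [rw cw]; split; first exact: reach_c.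
  exact: cleared_weight.
- by move=> w [].
- by move=> t /tsP /andP[].
- by split.
- by [].
have inj b : injective (fun k => unrk (2 * (N + k) + b)).
  by move=> k l /(congr1 rk); rewrite !unrkK; lia.
have evb (b : bool) k : (k < (2 * L).+1)%N -> exists n : nat,
    X false (unrk (2 * (N + k) + b)) (unrk (2 * (N + k) + b)) v
    = (weight_sign (unrk (2 * (N + k) + b)) * n%:R) *: v.
  move=> kL; apply: ev; apply: map_f; rewrite mem_iota /d.
  by case: b; lia.
have Nb (b : bool) k : (N <= rk (unrk (2 * (N + k) + b)))%N by rewrite unrkK; lia.
have [k kL pk] := zero_weight rv (inj false) (Nb false) (evb false) v0.
have [l lL ql] := zero_weight rv (inj true) (Nb true) (evb true) v0.
exists s, v; split; [exact: v0|exact: cv|].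
apply: (killed_weights0 cv _ _ pk _ _ ql); rewrite unrkK /s /d.
- by lia.
- by rewrite oddD oddM.
- by lia.
- by rewrite oddD oddM.
Qed.

(** As c_s kills the vector, only the weight operators of the first s indices
    remain to be diagonalized. *)
Lemma weight_vector_exists : (exists v : S, v != 0) ->
  exists (v : S) (n : zindex -> nat), [/\ v != 0, forall p i j, prec i j -> X p i j v = 0,
    forall t, X false t t v = (weight_sign t * (n t)%:R) *: v
    & exists s, forall t, (s <= rk t)%N -> n t = 0%N].
Proof.
move=> /killed_cleared_exists[s [u [u0 cu ku]]].
pose ts := [seq unrk k | k <- iota 0 s].
have [||||||v [[kv cv] v0 ev]] := @eigen_list s (fun u : S => killed s u /\ cleared s u) ts u.
- move=> a x w [ru cx] [rw cw].
  by split; [exact: killed_lin|exact: cleared_lin].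
- move=> t w _ [rw cw]; split; [exact: killed_weight|exact: cleared_weight].
- by move=> w [].
- by move=> t /mapP[k kd ->]; rewrite unrkK; move: kd; rewrite mem_iota.
- by split.
- by [].
pose P t (m : nat) := X false t t v = (weight_sign t * m%:R) *: v.
exists v, (fun t => if (rk t < s)%N then xget 0%N [set m | P t m] else 0%N).
split; [exact: v0| | |by exists s => t; rewrite leqNgt => /negbTE ->].
- move=> p i j ij; have [lo|hi] := boolP ((rk i < s)%N || (rk j < s)%N); first exact: cv.
  by apply: kv; lia.
- move=> t; case: ifP => ts'; last first.
    rewrite mulr0 scale0r; have st : (s <= rk t)%N by lia.
    exact: kv.
  have [|m em] := ev t; last exact: (@xgetPex _ 0%N [set m | P t m] (ex_intro _ _ em)).
  by apply/mapP; exists (rk t); rewrite ?rkK // mem_iota.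
Qed.

End HighestWeight.

(** * Strict bipartitions *)

Section Weights.

Lemma partition_of (a : nat -> nat) s : (forall k, (a k.+1 < a k)%N \/ a k = 0 /\ a k.+1 = 0)%N ->
  (forall k, (s <= k)%N -> a k = 0)%N ->
  exists2 l, strict_partition l & forall k, nth 0%N l k = a k.
Proof.
move=> da az; have ex0 : exists m, a m == 0%N by exists s; rewrite az.
have [m /eqP am mmin] := ex_minnP ex0.
have lt k : (k < m)%N -> (0 < a k)%N.
  by rewrite lt0n; apply: contraTneq => ak; rewrite -leqNgt mmin ?ak.
have gt k : (m <= k)%N -> a k = 0%N.
  move=> /subnKC <-; elim: (k - m)%N => [|d IH]; first by rewrite addn0.
  by rewrite addnS; have [|[]] := da (m + d)%N; rewrite ?IH.
exists [seq a k | k <- iota 0 m].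
  apply/andP; split; last first.
    by apply/mapP => -[k]; rewrite mem_iota => km ak; have := lt k km; rewrite -ak.
  case: m {am mmin gt} lt => [//|m] lt /=.
  have: forall k, (k < 0 + m)%N -> (a k.+1 < a k)%N.
    by move=> k km; have [//|[E _]] := da k; have := lt k (ltnW km); rewrite E.
  elim: m 0%N {lt} => [//|m IH] i lt /=; rewrite lt ?IH //; last by lia.
  by move=> k km; apply: lt; lia.
move=> k; have [km|mk] := ltnP k m.
  by rewrite (nth_map 0%N) ?size_iota // nth_iota.
by rewrite nth_default ?size_map ?size_iota // gt.
Qed.

Lemma zval_rk t : `|zval t|.-1 = (rk t)./2.
Proof.
case: t => z z0; rewrite /rk /=; case: ifP => zp.
  by rewrite doubleK; lia.
by rewrite /= uphalf_double; lia.
Qed.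

Lemma bip_weightE l m t : bip_weight l m t =
  if odd (rk t) then - (nth 0%N m (rk t)./2)%:Z else (nth 0%N l (rk t)./2)%:Z.
Proof. by rewrite /bip_weight rk_pos zval_rk; case: (odd _). Qed.

Lemma sumn_nth l m : (size l <= m)%N -> sumn l = (\sum_(k < m) nth 0 l k)%N.
Proof.
elim: l m => [|x l IH] m; first by rewrite big1 // => k _; rewrite nth_nil.
by case: m => // m sm; rewrite big_ord_recl /= -IH.
Qed.

Lemma sum_bip_weight l m n : (size l <= n)%N -> (size m <= n)%N ->
  \sum_(s < n.*2) bip_weight l m (unrk s) = (sumn l)%:Z - (sumn m)%:Z.
Proof.
move=> /sumn_nth -> /sumn_nth ->; elim: n => [|n IH]; first by rewrite !big_ord0.
rewrite doubleS !big_ord_recr /= IH !bip_weightE !unrkK /= odd_double /= uphalf_double doubleK.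
by rewrite !PoszD opprD; ring.
Qed.

Variables (C : numClosedFieldType) (S : qmod C).

Lemma n_plus_kills (v : S) : (forall p i j, prec i j -> gact p i j v = 0) ->
  forall X, @n_plus C X -> qact X v = 0.
Proof.
move=> kv X; elim=> [|a Y Z [p [i [j [ij ->]]]] nZ IH]; first exact: qact0.
rewrite qact_linl ?IH ?[qact _ _]kv ?scaler0 ?addr0 //; first exact: q_oo_qgen.
by apply: q_oo_lspan nZ => _ [? [? [? [_ ->]]]]; exact: q_oo_qgen.
Qed.

(** Along the positive indices the weights decrease strictly until they vanish,
    and so do their opposites along -1, -2, ... *)
Lemma hw_exists : LA S -> loc_nilp S -> (exists v : S, v != 0) ->
  exists l m, [/\ strict_partition l, strict_partition m & has_highest_weight S l m].
Proof.
move=> la nS /(weight_vector_exists la nS)[v [n [v0 kv wv [s nz]]]].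
have drop i j : prec i j -> i != j ->
  exists d : nat, weight_sign C i * (n i)%:R - weight_sign C j * (n j)%:R = d%:R
    /\ (d = 0%N -> weight_sign C i * (n i)%:R = 0 /\ weight_sign C j * (n j)%:R = 0).
  move=> ij inj; apply: (strict_weights nS inj v0 _ (wv i) (wv j)) => p.
  exact: kv.
have natC (x y z : nat) : x%:R - y%:R = z%:R :> C -> (x = y + z)%N.
  by move=> /eqP; rewrite subr_eq -natrD eqr_nat addnC => /eqP.
have zero (t : zindex) : weight_sign C t * (n t)%:R = 0 -> n t = 0%N.
  move=> /eqP; rewrite mulf_eq0 pnatr_eq0 => /orP[|/eqP //].
  by rewrite /weight_sign sg_eq0.
have step (b : bool) k : (n (unrk (b + k.+1.*2)) < n (unrk (b + k.*2)))%N \/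
    (n (unrk (b + k.*2)) = 0 /\ n (unrk (b + k.+1.*2)) = 0)%N.
  have oddE i : odd (b + i.*2) = b by rewrite oddD odd_double addbF; case: (b).
  pose i := unrk (b + k.*2); pose j := unrk (b + k.+1.*2).
  have lt : (b + k.*2 < b + k.+1.*2)%N by rewrite doubleS; lia.
  have ij : i != j by apply: rk_neq; rewrite !unrkK.
  have ji : j != i by rewrite eq_sym.
  have si : weight_sign C i = sg C b by rewrite /weight_sign unrkK oddE.
  have sj : weight_sign C j = sg C b by rewrite /weight_sign unrkK oddE.
  have [d [dE dz]] : exists d : nat, n i = (n j + d)%N /\ (d = 0%N -> n i = 0%N /\ n j = 0%N).
    have pij : prec (if b then j else i) (if b then i else j).
      by rewrite precE /i /j; case: (b) lt oddE => lt oddE; rewrite !unrkK !oddE lt.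
    have [bt|/negbTE bf] := boolP b.
      rewrite bt in pij; have [d [dE dz]] := drop _ _ pij ji; exists d.
      split; last by move=> /dz[/zero -> /zero ->].
      by apply: natC; rewrite -dE si sj bt sgT !mulN1r opprK addrC.
    rewrite bf in pij; have [d [dE dz]] := drop _ _ pij ij; exists d.
    split; last by move=> /dz[/zero -> /zero ->].
    by apply: natC; rewrite -dE si sj bf sgF !mul1r.
  rewrite -/i -/j; case: d dE dz => [|d] dE dz; first by right; exact: dz.
  by left; rewrite dE; lia.
have vanish (b : bool) k : (s <= k)%N -> n (unrk (b + k.*2)) = 0%N.
  by move=> sk; apply: nz; rewrite unrkK; lia.
have [l sl lE] := partition_of (step false) (vanish false).
have [m sm mE] := partition_of (step true) (vanish true).
exists l, m; split=> //; exists v; split=> //; first exact: n_plus_kills.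
move=> i; apply: etrans (wv i) _; congr (_ *: _).
rewrite bip_weightE /weight_sign lE mE.
have : i = unrk (odd (rk i) + (rk i)./2.*2) by rewrite odd_double_half rkK.
case: (odd (rk i)) => /(congr1 n) ->; rewrite ?sgT ?sgF ?mulN1r ?mul1r //.
by rewrite mulrNz.
Qed.

(** The sum of the coordinates of a weight: the positive indices contribute the
    parts of the first partition, the negative ones those of the second with the
    opposite sign. *)
Lemma euler_hw l m : LA S -> has_highest_weight S l m ->
  exists2 v : S, v != 0 & euler v = ((sumn l)%:Z - (sumn m)%:Z)%:~R *: v.
Proof.
move=> la [v [v0 _ wv]]; exists v => //; have [n kn] := la v.
pose k := maxn n (maxn (size l) (size m)).
have kv : killed k.*2 v by apply: killed_leq kn; rewrite /k; lia.
rewrite (eulerE kv) /heul -(@sum_bip_weight l m k) ?rmorph_sum /=; try by rewrite /k; lia.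
by rewrite scaler_suml; apply: eq_bigr => s _; exact: wv.
Qed.

End Weights.

(** * Finite length *)

Section FiniteLength.
Variable C : numClosedFieldType.

Lemma qhom_lin (M N : qmod C) (f : M -> N) : is_qhom f -> linear f.
Proof. by case. Qed.

Lemma hpart_lin (M : qmod C) p : linear (@hpart C M p).
Proof. exact: gpart_lin. Qed.

Lemma submod0 (M : qmod C) : is_submod [set (0 : M)].
Proof.
apply: submod_gact.
- by split=> // a u v -> ->; rewrite scaler0 addr0.
- by move=> p v ->; exact: lin0 (@hpart_lin M p).
- by move=> p i j v ->; exact: lin0 (@gact_lin _ _ _ _ _).
Qed.

Lemma submodT (M : qmod C) : is_submod [set: M].
Proof. by apply: submod_gact; first by split. Qed.

Lemma submodI (M : qmod C) (A B : set M) : is_submod A -> is_submod B -> is_submod (A `&` B).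
Proof.
move=> sA sB; have [A0 Al] := submod_subspace sA; have [B0 Bl] := submod_subspace sB.
apply: submod_gact; first split; first by split.
- by move=> a u v [Au Bu] [Av Bv]; split; [exact: Al|exact: Bl].
- by move=> p v [Av Bv]; split; [exact: submod_hpart sA p v Av|exact: submod_hpart sB p v Bv].
- by move=> p i j v [Av Bv]; split; [exact: submodE sA p i j v Av|exact: submodE sB p i j v Bv].
Qed.

Lemma submod_preim (M N : qmod C) (f : M -> N) (A : set N) : is_qhom f ->
  is_submod A -> is_submod (f @^-1` A).
Proof.
move=> hf sA; have [A0 Al] := submod_subspace sA; have [lf pf _] := hf.
apply: submod_gact; first split.
- by rewrite /preimage /= (lin0 lf).
- by move=> a u v Au Av; rewrite /preimage /= lf; exact: Al.
- move=> p v Av; rewrite /preimage /= -(hpart_hom lf pf); exact: submod_hpart sA p _ Av.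
- move=> p i j v Av; rewrite /preimage /= (qhomE hf); exact: submodE sA p i j _ Av.
Qed.

Lemma submod_image (M N : qmod C) (f : M -> N) (A : set M) : is_qhom f ->
  is_submod A -> is_submod (f @` A).
Proof.
move=> hf sA; have [A0 Al] := submod_subspace sA; have [lf pf _] := hf.
apply: submod_gact; first split.
- by exists 0 => //; exact: lin0 lf.
- move=> a _ _ [u Au <-] [v Av <-]; exists (a *: u + v); [exact: Al|exact: lf].
- move=> p _ [v Av <-]; exists (hpart p v); first exact: submod_hpart sA p v Av.
  by rewrite (hpart_hom lf pf).
- move=> p i j _ [v Av <-]; exists (gact p i j v); first exact: submodE sA p i j v Av.
  by rewrite (qhomE hf).
Qed.

Definition sum_set (M : qmod C) (A B : set M) : set M :=
  [set v | exists a b, [/\ A a, B b & v = a + b]].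

Lemma submod_sum (M : qmod C) (A B : set M) : is_submod A -> is_submod B ->
  is_submod (sum_set A B).
Proof.
move=> sA sB; have [A0 Al] := submod_subspace sA; have [B0 Bl] := submod_subspace sB.
apply: submod_gact; first split.
- by exists 0, 0; rewrite addr0.
- move=> x _ _ [a [b [Aa Bb ->]]] [a' [b' [Aa' Bb' ->]]].
  exists (x *: a + a'), (x *: b + b'); split; [exact: Al|exact: Bl|].
  by rewrite scalerDr addrACA.
- move=> p _ [a [b [Aa Bb ->]]]; exists (hpart p a), (hpart p b); split.
  + exact: submod_hpart sA p a Aa.
  + exact: submod_hpart sB p b Bb.
  + exact: linD (@hpart_lin M p) _ _.
- move=> p i j _ [a [b [Aa Bb ->]]]; exists (gact p i j a), (gact p i j b); split.
  + exact: submodE sA p i j a Aa.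
  + exact: submodE sB p i j b Bb.
  + exact: linD (@gact_lin _ _ _ _ _) _ _.
Qed.

Lemma submod_fix (M : qmod C) (f : M -> M) : is_qhom f -> is_submod [set v | f v = v].
Proof.
move=> hf; have [lf pf _] := hf; apply: submod_gact; first split.
- exact: lin0 lf.
- by move=> a u v /= fu fv; rewrite lf fu fv.
- by move=> p v /= fv; rewrite -(hpart_hom lf pf) fv.
- by move=> p i j v /= fv; rewrite (qhomE hf) fv.
Qed.

(** Repetitions are allowed, so that filtrations can be pulled back without
    discarding steps. *)
Definition step (M : qmod C) (A B : set M) : Prop :=
  [/\ is_submod A, is_submod B, A `<=` B
    & forall N, is_submod N -> A `<=` N -> N `<=` B -> N = A \/ N = B].

Inductive filtered (M : qmod C) : set M -> Prop :=
| filtered0 : filtered [set 0]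
| filtered_step A B : filtered A -> step A B -> filtered B.

Lemma finite_lengthP (M : qmod C) : finite_length M <-> filtered [set: M].
Proof.
split=> [[k [F [F0 Fk sF stF]]]|].
  rewrite -Fk; have: (k <= k)%N by []; elim: {-2}k => [|i IH] ik.
    by rewrite F0; exact: filtered0.
  have [le _ H] := stF i ik.
  apply: filtered_step (IH (ltnW ik)) _; split=> //; apply: sF => //; exact: ltnW.
suff H (A : set M) : filtered A -> exists (k : nat) (F : nat -> set M),
    [/\ F 0%N = [set 0], F k = A, forall i, (i <= k)%N -> is_submod (F i)
      & forall i, (i < k)%N -> [/\ F i `<=` F i.+1, F i <> F i.+1
        & forall N, is_submod N -> F i `<=` N -> N `<=` F i.+1 -> N = F i \/ N = F i.+1]].
  exact: H.
elim=> {A} [|A B _ [k [F [F0 Fk sF stF]]] [sA sB AB H]].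
  by exists 0%N, (fun=> [set 0]); split=> // i _; exact: submod0.
have [AeB|AB'] := pselect (A = B); first by exists k, F; rewrite -AeB.
exists k.+1, (fun i => if (i <= k)%N then F i else B); split.
- by rewrite leq0n.
- by rewrite ltnn.
- by move=> i _; case: ifP => // /sF.
- move=> i ik; rewrite ltnS in ik; rewrite ik.
  case: ltnP => ik'; first exact: stF.
  have -> : i = k by apply/eqP; rewrite eqn_leq ik.
  by rewrite Fk.
Qed.

(** By the modular law, a submodule N between the two preimages is determined by
    the sum of the smaller submodule and the image of N. *)
Lemma filtered_preim (M L : qmod C) (f : M -> L) (W : set M) (B : set L) :
  is_qhom f -> is_submod W -> filtered (W `&` f @^-1` [set 0]) ->
  filtered B -> filtered (W `&` f @^-1` B).
Proof.
move=> hf sW k0; elim=> [//|A {}B _ IH [sA sB AB H]]; apply: filtered_step IH _.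
have lf := qhom_lin hf; have [A0 _] := submod_subspace sA.
split; try by apply: submodI => //; exact: submod_preim.
  by move=> v [Wv Av]; split=> //; exact: AB.
move=> N sN leN Nle; pose N' := sum_set A (f @` N).
have sN' : is_submod N' by apply: submod_sum => //; exact: submod_image.
have [N0 _] := submod_subspace sN.
have [||E|E] := H N' sN'.
- move=> a Aa; exists a, 0; split=> //; last by rewrite addr0.
  by exists 0 => //; exact: lin0 lf.
- move=> _ [a [_ [Aa [n Nn <-] ->]]].
  by apply: subspaceD (submod_subspace sB) (AB _ Aa) _; have [] := Nle _ Nn.
- left; apply/seteqP; split=> // n Nn; split; first by have [] := Nle _ Nn.
  rewrite /preimage /= -E; exists 0, (f n); split=> //; by rewrite add0r.
- right; apply/seteqP; split=> // x [Wx]; rewrite /preimage /= -E.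
  move=> [a [_ [Aa [n Nn <-] fx]]].
  have -> : x = (x - n) + n by rewrite subrK.
  apply: (subspaceD (submod_subspace sN) _ Nn); apply: leN; split.
    by apply: subspaceB (submod_subspace sW) Wx _; have [] := Nle _ Nn.
  by rewrite /preimage /= (linB lf) fx addrK.
Qed.

Lemma finite_length_inj (M L : qmod C) (f : M -> L) : is_qhom f -> injective f ->
  finite_length L -> finite_length M.
Proof.
move=> hf inj /finite_lengthP fL; apply/finite_lengthP.
have := @filtered_preim M L f setT setT hf (submodT M); rewrite !setTI; apply=> //.
suff -> : f @^-1` [set 0] = [set 0] by exact: filtered0.
have lf := qhom_lin hf.
apply/seteqP; split=> [v /= fv|v ->]; last exact: lin0 lf.
by apply: inj; rewrite fv (lin0 lf).
Qed.

(** The conditions prj i v = 0 are dropped one at a time; each step pulls back a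
    filtration of one summand. *)
Lemma finite_length_sum (I : eqType) (M : qmod C) (D : I -> qmod C)
    (prj : forall i, M -> D i) (s : seq I) :
  (forall i, is_qhom (prj i)) -> (forall i, finite_length (D i)) ->
  (forall v, (forall i, i \in s -> prj i v = 0) -> v = 0) -> finite_length M.
Proof.
move=> hp fD inj; apply/finite_lengthP.
pose W (t : seq I) : set M := [set v | forall i, i \in t -> prj i v = 0].
have W0 : W [::] = setT by apply/seteqP; split.
have WS i t : W (i :: t) = W t `&` prj i @^-1` [set 0].
  apply/seteqP; split=> v.
    move=> vW; split; last by apply: vW; exact: mem_head.
    by move=> j jt; apply: vW; rewrite inE jt orbT.
  by move=> [vW vi] j; rewrite inE => /orP[/eqP -> //|]; exact: vW.
have sW t : is_submod (W t).
  elim: t => [|i t IH]; first by rewrite W0; exact: submodT.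
  by rewrite WS; apply: submodI => //; apply: submod_preim => //; exact: submod0.
have fWs : filtered (W s).
  suff -> : W s = [set 0] by exact: filtered0.
  apply/seteqP; split=> [v|v ->]; first exact: inj.
  by move=> i _; exact: lin0 (qhom_lin (hp i)).
rewrite -W0; elim: s fWs {inj} => [//|i t IH]; rewrite WS => fW; apply: IH.
have /finite_lengthP fDi := fD i.
have := filtered_preim (hp i) (sW t) fW fDi.
by have -> : prj i @^-1` setT = setT by []; rewrite setIT.
Qed.

Lemma simple_subq (M : qmod C) (T : set M) (sT : is_submod T) : (exists2 v, T v & v != 0) ->
  (forall N, is_submod N -> N `<=` T -> N = [set 0] \/ N = T) -> is_simple (submodule sT).
Proof.
move=> [v Tv v0] H; split.
  exists (subq_make sT Tv : submodule sT); apply: contraNneq v0 => E.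
  by rewrite -(subq_makeK sT Tv) E (lin0 (qhom_lin (subq_qhom sT))).
move=> N sN; have [|E|E] := H _ (submod_image (subq_qhom sT) sN).
- by move=> _ [x _ <-]; exact: subq_injP.
- left; apply/seteqP; split=> [x Nx|x ->]; last by have [] := submod_subspace sN.
  apply: (@subq_inj_inj _ _ _ sT); rewrite (lin0 (qhom_lin (subq_qhom sT))).
  have : ((@subq_inj _ _ _ sT : submodule sT -> M) @` N) (subq_inj x) by exists x.
  by rewrite E.
- have im y : T y -> ((@subq_inj _ _ _ sT : submodule sT -> M) @` N) y by rewrite E.
  right; apply/seteqP; split=> // x _.
  by have [y Ny /subq_inj_inj <-] := im _ (subq_injP x).
Qed.

Definition euler_prod (M : qmod C) (ms : seq int) (v : M) : M :=
  foldr (fun m u => euler u - m%:~R *: u) v ms.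

Lemma euler_sub_qhom (M : qmod C) m : LA M -> is_qhom (fun u : M => euler u - m%:~R *: u).
Proof.
move=> la; have [le pe ge] := euler_qhom la.
split=> [a u v|p v pv|X v hX].
- by rewrite le scalerDr scalerBr !scalerA [_ * a]mulrC opprD addrACA.
- apply: (parB (qpar_grading M)); [exact: pe|exact: (parZ (qpar_grading M))].
- by rewrite ge // (linB (qact_linr hX)) (linZ (qact_linr hX)).
Qed.

Lemma euler_prod_qhom (M : qmod C) ms : LA M -> is_qhom (@euler_prod M ms).
Proof.
move=> la; elim: ms => [|m ms IH]; first by split.
have [l1 p1 g1] := euler_sub_qhom m la; have [l2 p2 g2] := IH; split.
- by move=> a u v; rewrite /euler_prod /= [foldr _ _ _]l2 l1.
- by move=> p v pv; apply: p1; exact: p2.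
- by move=> X v hX; rewrite /euler_prod /= [foldr _ _ _]g2 // g1.
Qed.

(** The image of a step of the filtration under the product built so far is zero
    or simple; in the second case the Euler operator has an eigenvector with
    eigenvalue m on it, hence acts on it by the scalar m, and one more factor
    kills the step. *)
Lemma euler_killer (M : qmod C) (P : int -> Prop) : LA M -> finite_length M ->
  (forall (T : set M) (sT : is_submod T), is_simple (submodule sT) ->
    exists m (v : submodule sT), [/\ P m, v != 0 & euler v = m%:~R *: v]) ->
  exists ms : seq int, (forall m, m \in ms -> P m) /\ forall v : M, euler_prod ms v = 0.
Proof.
move=> la /finite_lengthP fM HP.
suff H (A : set M) : filtered A ->
    exists ms : seq int, (forall m, m \in ms -> P m) /\ forall v : M, A v -> euler_prod ms v = 0.
  by have [ms [msP H1]] := H _ fM; exists ms; split=> // v; exact: H1.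
elim=> {A} [|A B _ [ms [msP msA]] [sA sB AB H]]; first by exists [::]; split=> // v ->.
have hq := euler_prod_qhom ms la; have lq := qhom_lin hq.
pose T := euler_prod ms @` B; have sT : is_submod T by exact: submod_image.
have [T0|/existsNP[v /not_implyP[Tv /eqP v0]]] := pselect (forall v, T v -> v = 0).
  by exists ms; split=> // v Bv; apply: T0; exists v.
have minT N : is_submod N -> N `<=` T -> N = [set 0] \/ N = T.
  move=> sN NT; have [N0 _] := submod_subspace sN.
  have [|||E|E] := H (B `&` euler_prod ms @^-1` N).
  - by apply: submodI => //; exact: submod_preim.
  - by move=> a Aa; split; [exact: AB|rewrite /preimage /= msA].
  - by move=> b [].
  - left; apply/seteqP; split=> [x Nx|x ->//].
    have [b Bb bx] := NT _ Nx; rewrite /= -bx; apply: msA; rewrite -E; split=> //.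
    by rewrite /preimage /= bx.
  - right; apply/seteqP; split=> // x [b Bb <-].
    by move: Bb; rewrite -E => -[].
have [m [w [Pm w0 ew]]] := HP T sT (simple_subq sT (ex_intro2 _ _ v Tv v0) minT).
exists (m :: ms); split=> [k|b Bb]; first by rewrite inE => /orP[/eqP ->|] //; exact: msP.
have lasub : LA (submodule sT).
  move=> x; have [n kn] := la (subq_inj x); exists n => p i j ni nj.
  by apply: subq_inj_inj; rewrite (qhomE (subq_qhom sT)) kn // (lin0 (qhom_lin (subq_qhom sT))).
pose N := T `&` (fun u : M => euler u - m%:~R *: u) @^-1` [set 0].
have sN : is_submod N.
  by apply: submodI => //; apply: submod_preim (submod0 _); exact: euler_sub_qhom.
have [|E|E] := minT N sN; first by move=> x [].
  case/eqP: w0; apply: (@subq_inj_inj _ _ _ sT).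
  rewrite (lin0 (qhom_lin (subq_qhom sT))).
  have : N (subq_inj w).
    split; first exact: subq_injP.
    rewrite /preimage /= (euler_hom (subq_qhom sT) lasub) ew.
    by rewrite (linZ (qhom_lin (subq_qhom sT))) subrr.
  by rewrite E.
have : T (euler_prod ms b) by exists b.
by rewrite -E => -[].
Qed.

End FiniteLength.

(** * Spectral projections *)

Section PolynomialsInOperator.
Variables (K : fieldType) (U : lmodType K) (E : U -> U).
Hypothesis lE : linear E.

Definition pev (p : {poly K}) (v : U) : U := \sum_(i < size p) p`_i *: iter i E v.

Lemma pev_wide n (p : {poly K}) v : (size p <= n)%N -> pev p v = \sum_(i < n) p`_i *: iter i E v.
Proof.
move=> pn; rewrite /pev (big_ord_widen n (fun i => p`_i *: iter i E v) pn).
rewrite big_mkcond; apply: eq_bigr => i _; case: ltnP => // ip.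
by rewrite nth_default ?scale0r.
Qed.

Lemma pev_lin p : linear (pev p).
Proof.
move=> a u v; rewrite /pev scaler_sumr -big_split; apply: eq_bigr => i _ /=.
by rewrite (lin_iter i lE) scalerDr !scalerA [a * _]mulrC.
Qed.

Lemma pevD (p q : {poly K}) v : pev (p + q) v = pev p v + pev q v.
Proof.
have pq := size_polyD p q.
rewrite (pev_wide _ pq) (pev_wide _ (leq_maxl _ (size q))) (pev_wide v (leq_maxr (size p) _)).
by rewrite -big_split; apply: eq_bigr => i _; rewrite coefD scalerDl.
Qed.

Lemma pevZ a (p : {poly K}) v : pev (a *: p) v = a *: pev p v.
Proof.
rewrite (pev_wide _ (size_scale_leq a p)) /pev scaler_sumr.
by apply: eq_bigr => i _; rewrite coefZ scalerA.
Qed.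

Lemma pevMX (p : {poly K}) v : pev (p * 'X) v = E (pev p v).
Proof.
have sz : (size (p * 'X)%R <= (size p).+1)%N.
  have [->|p0] := eqVneq p 0; first by rewrite mul0r size_poly0.
  by rewrite size_mulX.
rewrite (pev_wide _ sz) big_ord_recl coefMX /= scale0r add0r /pev (lin_sum lE).
by apply: eq_bigr => i _; rewrite coefMX /= (linZ lE).
Qed.

Lemma pev1 v : pev 1 v = v.
Proof. by rewrite /pev size_poly1 big_ord1 coef1 scale1r. Qed.

Lemma pev0 v : pev 0 v = 0.
Proof. by rewrite /pev size_poly0 big_ord0. Qed.

Lemma pevM (p q : {poly K}) v : pev (p * q) v = pev p (pev q v).
Proof.
elim/poly_ind: p => [|p c IH]; first by rewrite mul0r !pev0.
rewrite mulrDl mulrAC mul_polyC !pevD pevZ !pevMX IH; congr (_ + _).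
by rewrite -[c%:P]mulr1 mul_polyC pevZ pev1.
Qed.

Lemma pevB (p q : {poly K}) v : pev (p - q) v = pev p v - pev q v.
Proof. by rewrite pevD -[- q]scaleN1r pevZ scaleN1r. Qed.

Lemma pev_XsubC c v : pev ('X - c%:P) v = E v - c *: v.
Proof.
by rewrite pevB -[c%:P]mulr1 mul_polyC pevZ pev1 -['X]mul1r pevMX pev1.
Qed.

Lemma pev_sum I (r : seq I) (F : I -> {poly K}) v :
  pev (\sum_(i <- r) F i) v = \sum_(i <- r) pev (F i) v.
Proof.
elim: r => [|i r IH]; first by rewrite !big_nil pev0.
by rewrite !big_cons pevD IH.
Qed.

End PolynomialsInOperator.

Section SpectralProjections.
Variables (C : numFieldType) (ms : seq int).

Let root1 (m : int) : {poly C} := 'X - (m%:~R)%:P.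
(** The factors of the annihilating polynomial at the eigenvalue m, and the other
    ones. *)
Definition here (m : int) : {poly C} := \prod_(j <- ms | j == m) root1 j.
Definition elsewhere (m : int) : {poly C} := \prod_(j <- ms | j != m) root1 j.
Definition total : {poly C} := \prod_(j <- ms) root1 j.

Lemma here_elsewhere m : here m * elsewhere m = total.
Proof. by rewrite /total (bigID (pred1 m)). Qed.

Lemma coprime_here_elsewhere m : coprimep (here m) (elsewhere m).
Proof.
rewrite /here; elim/big_rec: _ => [|j p /eqP -> cp]; first exact: coprime1p.
rewrite coprimepMl cp andbT coprimep_sym coprimep_XsubC.
apply/rootP; rewrite horner_prod; apply/eqP; rewrite prodf_seq_eq0.
apply/hasPn => k _; apply/negP => /andP[km].
by rewrite hornerXsubC subr_eq0 eqr_int eq_sym (negbTE km).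
Qed.

Lemma projection_exists m :
  exists p : {poly C}, (elsewhere m %| p) && (here m %| p - 1).
Proof.
have /Bezout_eq1_coprimepP[[u w] /= uw] := coprime_here_elsewhere m.
exists (w * elsewhere m); rewrite dvdp_mull //=.
have -> : w * elsewhere m - 1 = - (u * here m).
  by rewrite -uw opprD addrC addrNK.
by rewrite dvdpNr dvdp_mull.
Qed.

(** A polynomial which is 1 modulo the factors at m and 0 modulo the others. *)
Definition projection m : {poly C} := xchoose (projection_exists m).

Lemma projection_elsewhere m : elsewhere m %| projection m.
Proof. by have /andP[] := xchooseP (projection_exists m). Qed.

Lemma projection_here m : here m %| projection m - 1.
Proof. by have /andP[] := xchooseP (projection_exists m). Qed.

Lemma here_dvd m k : k != m -> here k %| projection m.
Proof.
move=> km; apply: dvdp_trans (projection_elsewhere m).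
rewrite /elsewhere (bigID (pred1 k)) /=; apply: dvdp_mulr.
suff -> : here k = \prod_(j <- ms | (j != m) && (j == k)) root1 j by exact: dvdpp.
by apply: eq_bigl => j; case: eqP => [->|]; rewrite ?km ?andbF.
Qed.

Lemma total_dvd m p q : elsewhere m %| p -> here m %| q -> total %| p * q.
Proof. by move=> ep hq; rewrite -(here_elsewhere m) mulrC dvdp_mul. Qed.

Lemma projection_idem m : total %| projection m * (projection m - 1).
Proof. exact: total_dvd (projection_elsewhere m) (projection_here m). Qed.

Lemma projection_orth m k : m != k -> total %| projection m * projection k.
Proof. by move=> mk; apply: total_dvd (projection_elsewhere m) (here_dvd mk). Qed.

Lemma projection_nil m : total %| projection m * here m.
Proof. exact: total_dvd (projection_elsewhere m) (dvdpp _). Qed.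

Lemma hereE m : here m = root1 m ^+ count_mem m ms.
Proof.
rewrite /here (eq_bigr (fun=> root1 m)) => [|j /eqP -> //].
by rewrite big_const_seq iter_mulr_1.
Qed.

Lemma projection_out m : m \notin ms -> total %| projection m.
Proof.
move=> /count_memPn m0; rewrite -(here_elsewhere m) hereE m0 expr0 mul1r.
exact: projection_elsewhere.
Qed.

Lemma coprime_here m k : m != k -> coprimep (here m) (here k).
Proof.
move=> mk; rewrite !hereE; apply: coprimep_expl; apply: coprimep_expr.
by rewrite coprimep_XsubC2 // subr_eq0 eqr_int eq_sym.
Qed.

Lemma projection_sum : total %| 1 - \sum_(m <- undup ms) projection m.
Proof.
set r := (X in _ %| X).
have hr m : m \in undup ms -> here m %| r.
  move=> mms; rewrite /r (big_rem m) //= opprD addrA.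
  apply: dvdp_add; first by rewrite -opprB dvdpNr projection_here.
  rewrite dvdpNr big_seq; apply: (big_ind (fun p => here m %| p)) => [|p q|k kr]; first exact: dvdp0.
    exact: dvdp_add.
  by apply: here_dvd; move: kr; rewrite mem_rem_uniq ?undup_uniq // inE eq_sym => /andP[].
have -> : total = \prod_(m <- undup ms) here m.
  by rewrite /total -prodr_undup_exp_count; apply: eq_bigr => m _; rewrite hereE.
elim: (undup ms) (undup_uniq ms) hr => [|m t IH] /=; first by rewrite big_nil dvd1p.
move=> /andP[mt ut] hr; rewrite big_cons Gauss_dvdp; last first.
  rewrite big_seq; elim/big_rec: _ => [|k p kt cp]; first exact: coprimep1.
  rewrite coprimepMr cp andbT coprime_here //.
  by apply: contraNneq mt => ->.
rewrite hr ?mem_head // IH // => k kt; apply: hr; by rewrite inE kt orbT.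
Qed.

End SpectralProjections.

Section Decomposition.
Variables (C : numClosedFieldType) (M : qmod C) (ms : seq int).
Hypotheses (laM : LA M) (ms0 : forall v : M, euler_prod ms v = 0).

Let le : linear (@euler C M) := euler_lin laM.

Lemma pev_total v : pev (@euler C M) (total C ms) v = 0.
Proof.
rewrite -(ms0 v) /total; elim: ms v => [|m s IH] v; first by rewrite big_nil pev1.
by rewrite big_cons (pevM le) pev_XsubC // IH.
Qed.

Lemma pev_dvd p v : total C ms %| p -> pev (@euler C M) p v = 0.
Proof.
move=> /dvdpP[q ->]; rewrite (pevM le) pev_total.
exact: lin0 (pev_lin le q).
Qed.

Definition proj m : M -> M := pev (@euler C M) (projection C ms m).

Lemma iter_euler_qhom i : is_qhom (iter i (@euler C M)).
Proof.
have [l1 p1 g1] := euler_qhom laM; elim: i => [|i [l2 p2 g2]]; first by split.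
split=> [|p v pv|X v hX]; first exact: lin_iter.
- by apply: p1; exact: p2.
- by rewrite !iterS g2 // g1.
Qed.

Lemma pev_qhom p : is_qhom (pev (@euler C M) p).
Proof.
split=> [|r v rv|X v hX]; first exact: pev_lin.
- apply: qpar_sum => i; apply: (parZ (qpar_grading M)).
  by have [_ pi _] := iter_euler_qhom i; exact: pi.
- rewrite /pev (lin_sum (qact_linr hX)); apply: eq_bigr => i _.
  by have [_ _ gi] := iter_euler_qhom i; rewrite gi // (linZ (qact_linr hX)).
Qed.

Lemma proj_qhom m : is_qhom (proj m).
Proof. exact: pev_qhom. Qed.

Lemma proj_idem m v : proj m (proj m v) = proj m v.
Proof.
apply/eqP; rewrite -subr_eq0; apply/eqP; rewrite /proj -(pevM le) -(pevB (@euler C M)).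
have -> : projection C ms m * projection C ms m - projection C ms m
  = projection C ms m * (projection C ms m - 1) by rewrite mulrBr mulr1.
exact/pev_dvd/projection_idem.
Qed.

Lemma proj_orth m k v : m != k -> proj k (proj m v) = 0.
Proof.
by move=> mk; rewrite /proj -(pevM le) mulrC; apply: pev_dvd; exact: projection_orth.
Qed.

Lemma proj_out m v : m \notin ms -> proj m v = 0.
Proof. by move=> mm; apply: pev_dvd; exact: projection_out. Qed.

Lemma proj_sum v : v = \sum_(m <- undup ms) proj m v.
Proof.
apply/eqP; rewrite -subr_eq0 -{1}[v](pev1 (@euler C M)) -pev_sum -pevB.
exact/eqP/pev_dvd/projection_sum.
Qed.

Lemma pev_nseq m k (u : M) :
  euler_prod (nseq k m) u = pev (@euler C M) (('X - (m%:~R)%:P) ^+ k) u.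
Proof.
elim: k => [|k IH]; first by rewrite pev1.
by rewrite exprS (pevM le) pev_XsubC // -IH.
Qed.

Lemma proj_nil m v : proj m v = v ->
  euler_prod (nseq (count_mem m ms) m) v = 0.
Proof.
move=> <-; rewrite pev_nseq -hereE /proj -(pevM le) mulrC.
exact/pev_dvd/projection_nil.
Qed.

End Decomposition.

(** * Eigenvalues of the Euler operator on subquotients *)

Section Transfer.
Variable C : numClosedFieldType.

Lemma LA_inj (L M : qmod C) (f : L -> M) : is_qhom f -> injective f -> LA M -> LA L.
Proof.
move=> hf inj la v; have [n kn] := la (f v); exists n => p i j ni nj.
by apply: inj; rewrite (qhomE hf) kn // (lin0 (qhom_lin hf)).
Qed.

Lemma LA_surj (L S : qmod C) (q : L -> S) : is_qhom q -> (forall s, exists l, q l = s) ->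
  LA L -> LA S.
Proof.
move=> hq surj la s; have [l <-] := surj s; have [n kn] := la l.
by exists n; exact: killed_hom kn.
Qed.

Lemma iter_hom (L M : qmod C) (f : L -> M) k p i j v : is_qhom f ->
  f (iter k (gact p i j) v) = iter k (gact p i j) (f v).
Proof. by move=> hf; elim: k => [//|k IH]; rewrite !iterS (qhomE hf) IH. Qed.

Lemma loc_nilp_inj (L M : qmod C) (f : L -> M) : is_qhom f -> injective f ->
  loc_nilp M -> loc_nilp L.
Proof.
move=> hf inj nM i j v ij; have [k fk] := nM i j (f v) ij; exists k.
by apply: inj; rewrite iter_hom // fk (lin0 (qhom_lin hf)).
Qed.

Lemma loc_nilp_surj (L S : qmod C) (q : L -> S) : is_qhom q -> (forall s, exists l, q l = s) ->
  loc_nilp L -> loc_nilp S.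
Proof.
move=> hq surj nL i j s ij; have [l <-] := surj s; have [k fk] := nL i j l ij.
by exists k; rewrite -iter_hom // fk (lin0 (qhom_lin hq)).
Qed.

Lemma euler_prod_hom (L M : qmod C) (f : L -> M) ms v : is_qhom f -> LA L ->
  euler_prod ms (f v) = f (euler_prod ms v).
Proof.
move=> hf la; elim: ms => [//|m ms IH]; rewrite /euler_prod /= -!/(euler_prod _ _) IH.
by rewrite (euler_hom hf la) (linB (qhom_lin hf)) (linZ (qhom_lin hf)).
Qed.

Lemma euler_prod_eigen (M : qmod C) m k K (v : M) : LA M -> euler v = k%:~R *: v ->
  euler_prod (nseq K m) v = ((k - m)%:~R ^+ K) *: v.
Proof.
move=> la ev; elim: K => [|K IH]; first by rewrite scale1r.
rewrite /= IH (linZ (euler_lin la)) ev !scalerA -scalerBl; congr (_ *: _).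
by rewrite [m%:~R * _]mulrC -mulrBr -intrB exprSr.
Qed.

(** The nilpotency of E - m passes to the subquotient, where E has a highest
    weight vector as an eigenvector. *)
Lemma simple_subquotient (M S : qmod C) m K : LA M -> loc_nilp M ->
  (forall v : M, euler_prod (nseq K m) v = 0) -> is_simple S -> is_subquotient S M ->
  exists lambda mu, [/\ strict_partition lambda, strict_partition mu,
    (sumn lambda)%:Z - (sumn mu)%:Z = m & is_V S lambda mu].
Proof.
move=> la nM Km sS [L [i [q [hi inj hq surj]]]].
have laL := LA_inj hi inj la; have laS := LA_surj hq surj laL.
have nS := loc_nilp_surj hq surj (loc_nilp_inj hi inj nM).
have [l [k [sl sk hw]]] := hw_exists laS nS sS.1.
exists l, k; split=> //; have [v v0 ev] := euler_hw laS hw.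
have [x xv] := surj v.
have zero : euler_prod (nseq K m) v = 0.
  rewrite -xv (euler_prod_hom _ _ hq laL).
  suff -> : euler_prod (nseq K m) x = 0 by exact: lin0 (qhom_lin hq).
  by apply: inj; rewrite -(euler_prod_hom _ _ hi laL) Km (lin0 (qhom_lin hi)).
move: zero; rewrite (euler_prod_eigen _ _ laS ev) => /eqP.
rewrite scaler_eq0 (negbTE v0) orbF expf_eq0 intr_eq0 subr_eq0.
by move=> /andP[_ /eqP].
Qed.

Lemma submodule_eigen (M : qmod C) (P : int -> Prop) :
  (forall S, is_simple S -> is_subquotient S M ->
     exists l m, P ((sumn l)%:Z - (sumn m)%:Z) /\ has_highest_weight S l m) ->
  LA M -> finite_length M ->
  exists ms : seq int, (forall m, m \in ms -> P m) /\ forall v : M, euler_prod ms v = 0.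
Proof.
move=> H la fM; apply: euler_killer => // T sT simT.
have hs := subq_qhom sT; have inj := @subq_inj_inj _ _ _ sT.
have [|l [m [Pm hw]]] := H _ simT.
  exists (submodule sT), (@subq_inj _ _ _ sT), id; split=> //.
  by move=> s; exists s.
have [v v0 ev] := euler_hw (LA_inj hs inj la) hw.
by exists ((sumn l)%:Z - (sumn m)%:Z), v.
Qed.

Lemma Trep_LA (M : qmod C) : Trep M -> LA M.
Proof. by case=> _ _ /LAP. Qed.

Lemma Trep_killer (M : qmod C) : Trep M -> exists ms : seq int, forall v : M, euler_prod ms v = 0.
Proof.
move=> tM; have la := Trep_LA tM; have [iM fM _] := tM.
have [|//|//|ms [_ H]] := @submodule_eigen M (fun=> True); last by exists ms.
move=> S sS [L [i [q [hi inj hq surj]]]].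
have laS := LA_surj hq surj (LA_inj hi inj la).
have nS := loc_nilp_surj hq surj (loc_nilp_inj hi inj (integrable_loc_nilp iM)).
by have [l [m [_ _ hw]]] := hw_exists laS nS sS.1; exists l, m.
Qed.

Lemma Trep_m_killer (M : qmod C) m : Trep_ m M ->
  exists K, forall v : M, euler_prod (nseq K m) v = 0.
Proof.
move=> [tM HS]; have la := Trep_LA tM; have [iM fM _] := tM.
have [|//|//|ms [msm H]] := @submodule_eigen M (fun k => k = m).
  by move=> S sS /(HS S sS)[l [k [_ _ lk [_ hw]]]]; exists l, k.
exists (size ms) => v; rewrite -(H v); congr (euler_prod _ v).
by apply/esym/all_pred1P/allP => k /msm ->; rewrite /= eqxx.
Qed.

End Transfer.

(** * The decomposition *)

Section Summands.
Variables (C : numClosedFieldType) (M : qmod C) (ms : seq int).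
Hypotheses (tM : Trep M) (ms0 : forall v : M, euler_prod ms v = 0).

Let la : LA M := Trep_LA tM.
Let P m : M -> M := @proj C M ms m.
Let hP m : is_qhom (P m) := proj_qhom ms la m.

Definition summand m : qmod C := submodule (submod_fix (hP m)).
Definition summand_inj m : summand m -> M := @subq_inj _ _ _ (submod_fix (hP m)).
Definition summand_prj m (v : M) : summand m :=
  subq_make (submod_fix (hP m)) (proj_idem la ms0 m v).

Lemma summand_injK m v : summand_inj (summand_prj m v) = P m v.
Proof. by []. Qed.

Lemma summand_fix m (x : summand m) : P m (summand_inj x) = summand_inj x.
Proof. exact: (@subq_injP _ _ _ (submod_fix (hP m)) x). Qed.

Lemma summand_inj_qhom m : is_qhom (@summand_inj m).
Proof. exact: subq_qhom. Qed.

Lemma summand_inj_inj m : injective (@summand_inj m).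
Proof. exact: subq_inj_inj. Qed.

Lemma summand_prj_qhom m : is_qhom (summand_prj m).
Proof.
have [li _ ai] := summand_inj_qhom m; have [lp pp ap] := hP m.
split=> [a u v|p v pv|X v hX]; last 1 first.
- by apply: summand_inj_inj; rewrite ai // !summand_injK ap.
- by apply: summand_inj_inj; rewrite li !summand_injK lp.
- exact: pp pv.
Qed.

Lemma summand_prjK m : cancel (@summand_inj m) (summand_prj m).
Proof. by move=> x; apply: summand_inj_inj; rewrite summand_injK summand_fix. Qed.

Lemma Trep_summand m : Trep_ m (summand m).
Proof.
have [iM fM _] := tM; have hi := summand_inj_qhom m; have inj := @summand_inj_inj m.
have laD := LA_inj hi inj la.
have iD := integrable_retract iM la hi (summand_prj_qhom m) (@summand_prjK m).
split; first by split=> //; [exact: finite_length_inj hi inj fM|exact/LAP].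
move=> S sS qS.
apply: (simple_subquotient (K := count_mem m ms) laD (integrable_loc_nilp iD) _ sS qS) => v.
apply: inj; rewrite -(euler_prod_hom _ _ hi laD) (proj_nil la ms0 (summand_fix v)).
exact: esym (lin0 (qhom_lin hi)).
Qed.

Lemma direct_sum_summands : is_direct_sum M summand.
Proof.
exists summand_inj, summand_prj, (undup ms); split.
- by move=> m; split; [exact: summand_inj_qhom|exact: summand_prj_qhom].
- by move=> m x; exact: summand_prjK.
- move=> m m' x mm'; apply: summand_inj_inj.
  rewrite summand_injK -(summand_fix x) (lin0 (qhom_lin (summand_inj_qhom m'))).
  exact: proj_orth.
- split; first exact: undup_uniq.
  move=> m; rewrite mem_undup => mm x; apply: summand_inj_inj.
  rewrite (lin0 (qhom_lin (summand_inj_qhom m))) -summand_fix.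
  exact: proj_out.
- by move=> v; exact: proj_sum.
Qed.

End Summands.

Section Vanishing.
Variable C : numClosedFieldType.

(** The image of f is killed by powers of the coprime polynomials X - m and
    X - m'. *)
Lemma Trep_hom0 m m' (M N : qmod C) (f : M -> N) : m != m' -> Trep_ m M -> Trep_ m' N ->
  is_qhom f -> forall v, f v = 0.
Proof.
move=> mm tM tN hf v.
have laM := Trep_LA tM.1; have laN := Trep_LA tN.1.
have [K km] := Trep_m_killer tM; have [K' kn] := Trep_m_killer tN.
have le := euler_lin laN.
have E1 : pev (@euler C N) (('X - (m%:~R)%:P) ^+ K) (f v) = 0.
  by rewrite -pev_nseq // (euler_prod_hom _ _ hf laM) km (lin0 (qhom_lin hf)).
have E2 : pev (@euler C N) (('X - (m'%:~R)%:P) ^+ K') (f v) = 0.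
  by rewrite -pev_nseq.
have cop : coprimep (('X - (m%:~R)%:P) ^+ K : {poly C}) (('X - (m'%:~R)%:P) ^+ K').
  apply: coprimep_expl; apply: coprimep_expr.
  by rewrite coprimep_XsubC2 // subr_eq0 eqr_int eq_sym.
have /Bezout_eq1_coprimepP[[u w] /= uw] := cop.
rewrite -[f v](pev1 (@euler C N)) -uw pevD !(pevM le) E1 E2.
by rewrite !(lin0 (pev_lin le _)) addr0.
Qed.

End Vanishing.

Section DirectSum.
Variables (C : numClosedFieldType) (M : qmod C) (D : int -> qmod C).
Variables (inj : forall m, D m -> M) (prj : forall m, M -> D m) (s : seq int).
Hypotheses (hi : forall m, is_qhom (@inj m)) (hp : forall m, is_qhom (@prj m)).
Hypothesis injK : forall m x, prj m (@inj m x) = x.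
Hypothesis inj0 : forall m m' x, m != m' -> prj m' (@inj m x) = 0.
Hypothesis us : uniq s.
Hypothesis sumE : forall v, v = \sum_(m <- s) @inj m (@prj m v).

Lemma LA_sum : (forall m, LA (D m)) -> LA M.
Proof.
move=> la v; have [n nP] : exists n, forall m, m \in s -> killed n (@prj m v).
  elim: s => [|m t [n nP]]; first by exists 0%N.
  have [k kP] := la m (prj m v); exists (maxn n k) => l.
  rewrite inE => /orP[/eqP ->|/nP]; first exact: killed_leq (leq_maxr _ _) kP.
  exact: killed_leq (leq_maxl _ _).
exists n; rewrite (sumE v) big_seq.
apply: (big_ind (fun x => killed n x)) => [p i j _ _|x y kx ky|m ms].
- exact: lin0 (@gact_lin _ _ _ _ _).
- by rewrite -[x]scale1r; exact: killed_lin.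
- by apply: killed_hom; [exact: hi|exact: nP].
Qed.

Section Points.
Variable n : nat.
Hypothesis iD : forall m, exists rho, @Q_rep C n (D m) rho /\ Q_lifts rho.

Definition summand_rho m := projT1 (cid (iD m)).
Lemma summand_rep m : Q_rep (@summand_rho m).
Proof. by case: (projT2 (cid (iD m))). Qed.
Lemma summand_lift m : Q_lifts (@summand_rho m).
Proof. by case: (projT2 (cid (iD m))). Qed.

Definition sum_rho (A : salg C) (g : 'M[A]_(n + n)) (v : M) : seq (M * A) :=
  flatten [seq [seq (@inj m x.1, x.2) | x <- summand_rho g (prj m v)] | m <- s].

Lemma sum_rhoE (A : salg C) (U : lmodType C) (b : M -> A -> U) g v :
  \sum_(x <- sum_rho g v) b x.1 x.2
  = \sum_(m <- s) \sum_(x <- summand_rho g (prj m v)) b (@inj m x.1) x.2.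
Proof. by rewrite big_flatten big_map; apply: eq_bigr => m _; rewrite big_map. Qed.

Lemma bil_inj (A U : lmodType C) (b : M -> A -> U) m : is_bilinear b ->
  is_bilinear (fun x => b (@inj m x)).
Proof.
have li := qhom_lin (hi m).
by move=> [b1 b2]; split=> [a|x] c u v; rewrite ?li; [exact: b1|exact: b2].
Qed.

Lemma bil_sum (A U : lmodType C) (b : M -> A -> U) v a : is_bilinear b ->
  \sum_(m <- s) b (@inj m (prj m v)) a = b v a.
Proof. by move=> [b1 _]; rewrite {2}(sumE v) (lin_sum (b1 a)). Qed.

Lemma summand_rho0 m (A : salg C) (U : lmodType C) (b : D m -> A -> U) g :
  Q_points g -> is_bilinear b -> \sum_(x <- summand_rho g (0 : D m)) b x.1 x.2 = 0.
Proof.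
move=> qg hb; have [_ Hl _ _ _] := summand_rep m.
have := Hl A g (-1) 0 0 qg U b hb; rewrite scaler0 addr0 big_cat big_map /=.
have [b1 _] := hb.
have -> : \sum_(x <- summand_rho g (0 : D m)) b (-1 *: x.1) x.2
    = -1 *: \sum_(x <- summand_rho g (0 : D m)) b x.1 x.2.
  by rewrite scaler_sumr; apply: eq_bigr => x _; exact: (linZ (b1 x.2)).
by rewrite scaleN1r addNr.
Qed.

Lemma sum_rho_rep : Q_rep sum_rho.
Proof.
split.
- move=> A g p v qg pv.
  suff [t te th] : tens_homog p (sum_rho g v) by exists t.
  rewrite /sum_rho; elim: s => [|m l [t te th]]; first by exists [::].
  have [Hh _ _ _ _] := summand_rep m; have [_ pp _] := hp m; have [_ pi _] := hi m.
  have [t' te' th'] := Hh A g p (prj m v) qg (pp _ _ pv).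
  exists ([seq (@inj m x.1, x.2) | x <- t'] ++ t).
    move=> U b hb; rewrite /= !big_cat te // !big_map; congr (_ + _).
    exact: te' _ _ (bil_inj m hb).
  move=> x; rewrite mem_cat => /orP[/mapP[y yt ->]|]; last exact: th.
  by have [r [ry sy]] := th' y yt; exists r; split=> //; exact: pi.
- move=> A g a u v qg U b hb; rewrite sum_rhoE big_cat big_map /=.
  have [b1 _] := hb.
  have -> : \sum_(x <- sum_rho g u) b (a *: x.1) x.2 = a *: \sum_(x <- sum_rho g u) b x.1 x.2.
    rewrite scaler_sumr; apply: eq_bigr => x _; exact: (linZ (b1 x.2)).
  rewrite !sum_rhoE scaler_sumr -big_split; apply: eq_bigr => m _ /=.
  have [_ Hl _ _ _] := summand_rep m; rewrite (qhom_lin (hp m)).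
  have := Hl A g a (prj m u) (prj m v) qg U _ (bil_inj m hb); rewrite big_cat big_map /= => ->.
  congr (_ + _); rewrite scaler_sumr; apply: eq_bigr => x _.
  have [b1' _] := bil_inj m hb; exact: (linZ (b1' x.2)).
- move=> A v U b hb; rewrite sum_rhoE big_seq1 /= -(bil_sum v 1 hb).
  apply: eq_bigr => m _; have [_ _ H1 _ _] := summand_rep m.
  by rewrite (H1 A (prj m v) U _ (bil_inj m hb)) big_seq1.
- move=> A g h v qg qh U b hb; rewrite sum_rhoE big_allpairs_dep /=.
  rewrite (sum_rhoE (fun x a => \sum_(y <- sum_rho g x) b y.1 (y.2 * a))).
  rewrite [LHS]big_seq [RHS]big_seq; apply: eq_bigr => m ms.
  have [_ _ _ Hm _] := summand_rep m.
  rewrite (Hm A g h (prj m v) qg qh U _ (bil_inj m hb)) big_allpairs_dep.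
  apply: eq_bigr => x _ /=.
  have hb' : is_bilinear (fun d a => b d (a * x.2)) by exact: bil_shift.
  rewrite (sum_rhoE (fun d a => b d (a * x.2))) (big_rem m) //= injK.
  set y := (X in _ + X); suff -> : y = 0 by rewrite addr0.
  rewrite {}/y big_seq; apply: big1 => k.
  rewrite mem_rem_uniq // inE eq_sym => /andP[mk _].
  by rewrite inj0 //; exact: (summand_rho0 qg (bil_inj k hb')).
- move=> A B f g v pf qg U b hb; rewrite sum_rhoE big_map.
  rewrite (sum_rhoE (fun x a => b x (f a))); apply: eq_bigr => m _.
  have [_ _ _ _ Hn] := summand_rep m.
  by rewrite (Hn A B f g (prj m v) pf qg U _ (bil_inj m hb)) big_map.
Qed.

Lemma sum_rho_lift : Q_lifts sum_rho.
Proof.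
move=> A p r x a v pa aa pv U b hb; rewrite sum_rhoE !big_cons big_nil /= addr0.
rewrite -(bil_sum v 1 hb) -(bil_sum _ a hb) -big_split; apply: eq_bigr => m _ /=.
have [lp pp ap] := hp m.
rewrite (@summand_lift m A p r x a (prj m v) pa aa (pp _ _ pv) U _ (bil_inj m hb)).
by rewrite !big_cons big_nil /= addr0 (linZ lp) (ap _ _ (q_oo_gelt p x)).
Qed.

End Points.

Lemma Trep_sum : (forall m, Trep (D m)) -> Trep M.
Proof.
move=> tD; split; last by apply/LAP; apply: LA_sum => m; exact: Trep_LA.
- move=> n n0; have iD m : exists rho, @Q_rep C n (D m) rho /\ Q_lifts rho.
    by have [iDm _ _] := tD m; exact: iDm.
  by exists (sum_rho iD); split; [exact: sum_rho_rep|exact: sum_rho_lift].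
- apply: (@finite_length_sum C _ M D prj s hp) => [m|v v0]; first by case: (tD m).
  rewrite (sumE v) big_seq big1 // => m ms.
  by rewrite v0 // (lin0 (qhom_lin (hi m))).
Qed.

End DirectSum.

Theorem corollary5p11 (R : realType) :
  category_direct_sum (@Trep R[i]) (@Trep_ R[i]).
Proof.
split=> [m M [] //|M|m m' M N f mm tM tN hf]; last exact: Trep_hom0 mm tM tN hf.
split=> [tM|[D [tD [inj [prj [s [hom injK inj0 [us _] sumE]]]]]]].
  have [ms ms0] := Trep_killer tM.
  exists (summand ms tM); split; first by move=> m; exact: Trep_summand.
  exact: direct_sum_summands.
apply: (Trep_sum (fun m => (hom m).1) (fun m => (hom m).2) injK inj0 us sumE).
by move=> m; case: (tD m).
Qed.
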